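(* Let $R$ be a commutative noetherian ring, let $C$ be a semidualizing $R$-module, and let $M$ be an $R$-module. Given an integer $n\geq 0$, consider the following conditions: (i) $\operatorname{Tor}^{\mathcal{F}_C\mathcal{M}}_i(M,-)=0$ for all $i>n$; (ii) $\operatorname{Tor}^{\mathcal{F}_C\mathcal{M}}_{n+1}(M,-)=0$; (iii) $\mathcal{F}_C\text{-}\operatorname{pd}_R(M)\leq n$; (iv) $\operatorname{Tor}^{\mathcal{F}_C\mathcal{M}}_i(M,R/\mathfrak{m})=0$ for all $i>n$ and for each maximal ideal $\mathfrak{m}$ of $R$; (v) $\operatorname{Tor}^{\mathcal{F}_C\mathcal{M}}_{n+1}(M,R/\mathfrak{m})=0$ for each maximal ideal $\mathfrak{m}$ of $R$; (vi) $\mathcal{P}_C\text{-}\operatorname{pd}_R(M)\leq n$. The conditions (i)–(iii) are always equivalent. If $M$ is finitely generated, then conditions (i)–(vi) are equivalent.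
   Context: $R$ is a commutative noetherian ring. A finitely generated $R$-module $C$ is semidualizing if the homothety map $R\to\operatorname{Hom}_R(C,C)$ is an isomorphism and $\operatorname{Ext}^i_R(C,C)=0$ for all $i\geq 1$. $\mathcal{P}_C(R)$ is the class of $R$-modules isomorphic to $P\otimes_R C$ with $P$ projective, and $\mathcal{F}_C(R)$ is the class of $R$-modules isomorphic to $F\otimes_R C$ with $F$ flat; both are precovering. For a precovering class $\mathcal{X}$, a proper $\mathcal{X}$-resolution of $M$ is a complex $X=(\cdots\to X_1\to X_0\to 0)$ with each $X_i\in\mathcal{X}$ together with an augmentation $X_0\to M$ such that $X^+=(\cdots\to X_1\to X_0\to M\to 0)$ is a complex (not necessarily exact) and $\operatorname{Hom}_R(Y,X^+)$ is exact for all $Y\in\mathcal{X}$. The $\mathcal{X}$-projective dimension is $$\mathcal{X}\text{-}\operatorname{pd}_R(M)=\inf\{\sup\{n\mid X_n\neq 0\}\mid X\text{ is a proper }\mathcal{X}\text{-resolution of }M\},$$ with $\mathcal{X}\text{-}\operatorname{pd}_R(0)=-\infty$. If $G$ is a proper $\mathcal{F}_C$-resolution of $M$, then $\operatorname{Tor}^{\mathcal{F}_C\mathcal{M}}_i(M,N):=H_i(G\otimes_R N)$ for each $R$-module $N$ and $i\geq0$ (independent of the choice of $G$). The notation $\operatorname{Tor}^{\mathcal{F}_C\mathcal{M}}_i(M,-)=0$ means vanishing on all $R$-modules. *)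

(* Defs.v *)
From HB Require Import structures.
#[warning="-notation-overridden,-ambiguous-paths"]
From mathcomp Require Import all_boot all_order all_algebra.
From mathcomp Require Import generic_quotient ring_quotient.
From mathcomp Require Import boolp classical_sets constructive_ereal.

Set Implicit Arguments.
Unset Strict Implicit.
Unset Printing Implicit Defensive.

Import Order.TTheory GRing.Theory Num.Theory.
Local Open Scope ring_scope.
Local Open Scope quotient_scope.

Section Modules.
Variable R : comPzRingType.
Implicit Types U V W M N : lmodType R.

Definition is_zero_module V := forall x : V, x = 0.

Definition isomorphic V W := exists f : {linear V -> W}, bijective f.

(* Since R is commutative, its ideals are the R-submodules of R^o. *)
Definition ideal := submodClosed (R^o : lmodType R).

Definition noetherian := forall I : ideal,
  exists s : seq R, {subset s <= I} /\
    forall x, x \in I -> exists c : nat -> R,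
      x = \sum_(i < size s) c i * s`_i.

Definition maximal_ideal (I : ideal) :=
  (1 : R) \notin I /\
  forall J : ideal, {subset I <= J} -> (1 : R) \notin J -> {subset J <= I}.

Definition finitely_generated V :=
  exists s : seq V, forall x : V, exists c : nat -> R,
    x = \sum_(i < size s) c i *: s`_i.

Definition projective V :=
  forall (U W : lmodType R) (p : {linear U -> W}) (f : {linear V -> W}),
    (forall w, exists u, p u = w) ->
    exists g : {linear V -> U}, forall x, p (g x) = f x.

End Modules.

Section QuotientModule.
Variables (R : comPzRingType) (V : lmodType R) (S : submodClosed V).

(* submodClosed only records closure under sums and scaling, whereas
   Quotient.quot expects a zmodClosed predicate. *)
Definition submod_pred : {pred V} := [pred x | x \in S].
Lemma submod_pred_zmod : zmod_closed submod_pred.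
Proof.
split=> [|x y]; rewrite !inE ?rpred0// => Sx Sy.
by rewrite -scaleN1r rpredD// rpredZ.
Qed.
HB.instance Definition _ := GRing.isZmodClosed.Build V submod_pred submod_pred_zmod.

Definition quotm := Quotient.quot submod_pred.
HB.instance Definition _ := EqQuotient.on quotm.
HB.instance Definition _ := GRing.Zmodule.on quotm.

Definition quotm_scale (a : R) (x : quotm) : quotm := \pi_(quotm) (a *: repr x).

Lemma quotm_eqP (x y : V) : reflect (\pi_(quotm) x = \pi_(quotm) y) (x - y \in S).
Proof.
rewrite -[_ \in S]/(x - y \in submod_pred).
by apply: (iffP idP); rewrite Quotient.idealrBE => /eqP.
Qed.

Lemma quotm_scale_pi a x : quotm_scale a (\pi_(quotm) x) = \pi_(quotm) (a *: x).
Proof.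
by apply/quotm_eqP; rewrite -scalerBr rpredZ//; apply/quotm_eqP; rewrite reprK.
Qed.

Lemma quotm_piD x y : \pi_(quotm) (x + y) = \pi_(quotm) x + \pi_(quotm) y.
Proof. exact: raddfD. Qed.

Lemma quotm_scaleA a b x : quotm_scale a (quotm_scale b x) = quotm_scale (a * b) x.
Proof. by rewrite -[x]reprK (quotm_scale_pi b) !quotm_scale_pi scalerA. Qed.
Lemma quotm_scale1 : left_id 1 quotm_scale.
Proof. by move=> x; rewrite -[x]reprK quotm_scale_pi scale1r. Qed.
Lemma quotm_scaleDr : right_distributive quotm_scale +%R.
Proof.
move=> a x y; rewrite -[x]reprK -[y]reprK -quotm_piD !quotm_scale_pi.
by rewrite scalerDr quotm_piD.
Qed.
Lemma quotm_scaleDl x : {morph quotm_scale^~ x : a b / a + b}.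
Proof.
by move=> a b; rewrite -[x]reprK !quotm_scale_pi scalerDl quotm_piD.
Qed.
HB.instance Definition _ := GRing.Zmodule_isLmodule.Build R quotm
  quotm_scaleA quotm_scale1 quotm_scaleDr quotm_scaleDl.

End QuotientModule.

Section Homology.
Variables (R : comPzRingType) (U V W : lmodType R).
Variables (f : {linear U -> V}) (g : {linear V -> W}).

Definition kernel : {pred V} := [pred x | g x == 0].
Lemma kernel_submod : submod_closed kernel.
Proof.
split=> [|a x y]; rewrite !inE ?linear0// => /eqP gx /eqP gy.
by rewrite linearP gx gy scaler0 addr0.
Qed.
HB.instance Definition _ := GRing.isSubmodClosed.Build R V kernel kernel_submod.

Definition kerm := {x : V | x \in kernel}.
HB.instance Definition _ := SubChoice.on kerm.
HB.instance Definition _ := [SubChoice_isSubLmodule of kerm by <:].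

Definition boundary : {pred kerm} := [pred x | `[< exists u, f u = val x >]].
Lemma boundary_submod : submod_closed boundary.
Proof.
split=> [|a x y]; rewrite !inE; first by exists 0; rewrite !linear0.
by move=> [u fu] [v fv]; exists (a *: u + v); rewrite !linearP fu fv.
Qed.
HB.instance Definition _ :=
  GRing.isSubmodClosed.Build R kerm boundary boundary_submod.

(* Ker g / Im f, to be used when g \o f = 0. *)
Definition homology : lmodType R := quotm boundary.

End Homology.

Section HomModule.
Variables (R : comPzRingType) (U V : lmodType R).

Definition homm := {linear U -> V}.
HB.instance Definition _ := gen_eqMixin homm.
HB.instance Definition _ := gen_choiceMixin homm.

Lemma hommP (f g : homm) : f =1 g -> f = g.
Proof.
case: f g => [f [[fA] [fZ]]] [g [[gA] [gZ]]] /= /funext fg.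
move: fA fZ gA gZ; rewrite {}fg => fA fZ gA gZ.
by rewrite (Prop_irrelevance fA gA) (Prop_irrelevance fZ gZ).
Qed.

Definition hom0 : homm := \0.
Definition homN (f : homm) : homm := \- f.
Definition homD (f g : homm) : homm := f \+ g.
Definition homZ (a : R) (f : homm) : homm := a \*: f.

Lemma homDA : associative homD.
Proof. by move=> f g h; apply: hommP => x /=; rewrite addrA. Qed.
Lemma homDC : commutative homD.
Proof. by move=> f g; apply: hommP => x /=; rewrite addrC. Qed.
Lemma hom0D : left_id hom0 homD.
Proof. by move=> f; apply: hommP => x /=; rewrite add0r. Qed.
Lemma homND : left_inverse hom0 homN homD.
Proof. by move=> f; apply: hommP => x /=; rewrite addNr. Qed.
HB.instance Definition _ := GRing.isZmodule.Build homm homDA homDC hom0D homND.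

Lemma homZA a b f : homZ a (homZ b f) = homZ (a * b) f.
Proof. by apply: hommP => x /=; rewrite scalerA. Qed.
Lemma hom1Z : left_id 1 homZ.
Proof. by move=> f; apply: hommP => x /=; rewrite scale1r. Qed.
Lemma homZDr : right_distributive homZ +%R.
Proof. by move=> a f g; apply: hommP => x /=; rewrite scalerDr. Qed.
Lemma homZDl f : {morph homZ^~ f : a b / a + b}.
Proof. by move=> a b; apply: hommP => x /=; rewrite scalerDl. Qed.
HB.instance Definition _ :=
  GRing.Zmodule_isLmodule.Build R homm homZA hom1Z homZDr homZDl.

End HomModule.

Section HomFunctor.
Variables (R : comPzRingType) (U V W : lmodType R).

Definition hom_post (d : {linear V -> W}) (f : homm U V) : homm U W := d \o f.
Lemma hom_post_linear d : linear (hom_post d).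
Proof. by move=> a f g; apply: hommP => x /=; rewrite linearP. Qed.
HB.instance Definition _ d := GRing.isLinear.Build R (homm U V) (homm U W) _
  (hom_post d) (hom_post_linear d).

Definition hom_pre (d : {linear U -> V}) (f : homm V W) : homm U W := f \o d.
Lemma hom_pre_linear d : linear (hom_pre d).
Proof. by move=> a f g; apply: hommP. Qed.
HB.instance Definition _ d := GRing.isLinear.Build R (homm V W) (homm U W) _
  (hom_pre d) (hom_pre_linear d).

End HomFunctor.

Section Homothety.
Variables (R : comPzRingType) (C : lmodType R).

Definition homothety (a : R^o) : homm C C := a \*: idfun.
Lemma homothety_linear : linear homothety.
Proof. by move=> a x y; apply: hommP => u /=; rewrite scalerDl scalerA. Qed.
HB.instance Definition _ := GRing.isLinear.Build R R^o (homm C C) _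
  homothety homothety_linear.

End Homothety.

Section TensorProduct.
Variables (R : comPzRingType) (M N : lmodType R).

Definition bilinear_map (P : lmodType R) (b : M -> N -> P) :=
  (forall x, linear (b x)) /\ (forall y, linear (b^~ y)).

(* M (x) N is the set of formal sums of pairs (x, y), two sums being identified
   when every bilinear map gives them the same value; see tensor_bilinear,
   tensor_lift_tens and tensor_lift_unique for the universal property. *)
Definition tensor_eval (P : lmodType R) (b : M -> N -> P) (s : seq (M * N)) :=
  \sum_(p <- s) b p.1 p.2.

Definition tensor_equiv (s t : seq (M * N)) : bool :=
  `[< forall (P : lmodType R) (b : M -> N -> P), bilinear_map b ->
        tensor_eval b s = tensor_eval b t >].

Lemma tensor_equiv_refl : reflexive tensor_equiv.
Proof. by move=> s; apply/asboolP. Qed.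
Lemma tensor_equiv_sym : symmetric tensor_equiv.
Proof.
by move=> s t; apply/asboolP/asboolP => st P b /st ->.
Qed.
Lemma tensor_equiv_trans : transitive tensor_equiv.
Proof.
move=> t s u /asboolP st /asboolP tu; apply/asboolP => P b bb.
by rewrite st// tu.
Qed.
Canonical tensor_equiv_rel := EquivRel tensor_equiv
  tensor_equiv_refl tensor_equiv_sym tensor_equiv_trans.

Definition tensor := {eq_quot tensor_equiv}.
HB.instance Definition _ := EqQuotient.on tensor.
HB.instance Definition _ := Choice.on tensor.

Implicit Types (s t : seq (M * N)) (u v w : tensor).

Lemma tensor_piP s t :
  \pi_(tensor) s = \pi_(tensor) t <->
  forall (P : lmodType R) (b : M -> N -> P), bilinear_map b ->
    tensor_eval b s = tensor_eval b t.
Proof.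
by split=> [/eqmodP/asboolP//|st]; apply/eqmodP/asboolP.
Qed.

Lemma tensor_eval_repr (P : lmodType R) (b : M -> N -> P) s : bilinear_map b ->
  tensor_eval b (repr (\pi_(tensor) s)) = tensor_eval b s.
Proof. by move: P b; apply/tensor_piP; rewrite reprK. Qed.

Lemma tensor_eval_cat (P : lmodType R) (b : M -> N -> P) s t :
  tensor_eval b (s ++ t) = tensor_eval b s + tensor_eval b t.
Proof. exact: big_cat. Qed.

Definition fscale (a : R) s := [seq (a *: p.1, p.2) | p <- s].

Lemma tensor_eval_scale (P : lmodType R) (b : M -> N -> P) a s :
  bilinear_map b -> tensor_eval b (fscale a s) = a *: tensor_eval b s.
Proof.
case=> _ bl; rewrite /tensor_eval big_map scaler_sumr.
by apply: eq_bigr => -[x y] _ /=; rewrite (scalable_linear (bl y)).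
Qed.

Definition tensor0 : tensor := \pi_(tensor) [::].
Definition tensorD u v : tensor := \pi_(tensor) (repr u ++ repr v).
Definition tensorZ (a : R) u : tensor := \pi_(tensor) (fscale a (repr u)).
Definition tensorN u : tensor := tensorZ (-1) u.

Lemma tensorP u v :
  (forall (P : lmodType R) (b : M -> N -> P), bilinear_map b ->
    tensor_eval b (repr u) = tensor_eval b (repr v)) -> u = v.
Proof. by move=> uv; rewrite -[u]reprK -[v]reprK; apply/tensor_piP. Qed.

Lemma eval_tensor0 (P : lmodType R) (b : M -> N -> P) : bilinear_map b ->
  tensor_eval b (repr tensor0) = 0.
Proof. by move=> bb; rewrite tensor_eval_repr// /tensor_eval big_nil. Qed.
Lemma eval_tensorD (P : lmodType R) (b : M -> N -> P) u v : bilinear_map b ->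
  tensor_eval b (repr (tensorD u v)) =
  tensor_eval b (repr u) + tensor_eval b (repr v).
Proof. by move=> bb; rewrite tensor_eval_repr// tensor_eval_cat. Qed.
Lemma eval_tensorZ (P : lmodType R) (b : M -> N -> P) a u : bilinear_map b ->
  tensor_eval b (repr (tensorZ a u)) = a *: tensor_eval b (repr u).
Proof. by move=> bb; rewrite tensor_eval_repr// tensor_eval_scale. Qed.

Lemma tensorDA : associative tensorD.
Proof. by move=> u v w; apply: tensorP => P b bb; rewrite !eval_tensorD// addrA. Qed.
Lemma tensorDC : commutative tensorD.
Proof. by move=> u v; apply: tensorP => P b bb; rewrite !eval_tensorD// addrC. Qed.
Lemma tensor0D : left_id tensor0 tensorD.
Proof.
by move=> u; apply: tensorP => P b bb; rewrite eval_tensorD// eval_tensor0// add0r.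
Qed.
Lemma tensorND : left_inverse tensor0 tensorN tensorD.
Proof.
move=> u; apply: tensorP => P b bb.
by rewrite eval_tensorD// eval_tensor0// eval_tensorZ// scaleN1r addNr.
Qed.
HB.instance Definition _ :=
  GRing.isZmodule.Build tensor tensorDA tensorDC tensor0D tensorND.

Lemma tensorZA a c u : tensorZ a (tensorZ c u) = tensorZ (a * c) u.
Proof. by apply: tensorP => P b bb; rewrite !eval_tensorZ// scalerA. Qed.
Lemma tensor1Z : left_id 1 tensorZ.
Proof. by move=> u; apply: tensorP => P b bb; rewrite eval_tensorZ// scale1r. Qed.
Lemma tensorZDr : right_distributive tensorZ +%R.
Proof.
move=> a u v; apply: tensorP => P b bb.
by rewrite eval_tensorZ// !eval_tensorD// !eval_tensorZ// scalerDr.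
Qed.
Lemma tensorZDl u : {morph tensorZ^~ u : a c / a + c}.
Proof.
move=> a c; apply: tensorP => P b bb.
by rewrite eval_tensorZ// eval_tensorD// !eval_tensorZ// scalerDl.
Qed.
HB.instance Definition _ :=
  GRing.Zmodule_isLmodule.Build R tensor tensorZA tensor1Z tensorZDr tensorZDl.

Definition tens (x : M) (y : N) : tensor := \pi_(tensor) [:: (x, y)].

Lemma eval_tens (P : lmodType R) (b : M -> N -> P) x y : bilinear_map b ->
  tensor_eval b (repr (tens x y)) = b x y.
Proof. by move=> bb; rewrite tensor_eval_repr// /tensor_eval big_seq1. Qed.

Lemma tensor_bilinear : bilinear_map tens.
Proof.
split=> [x a y y'|y a x x']; apply: tensorP => P b bb;
  rewrite eval_tensorD// eval_tensorZ// !eval_tens//; [exact: bb.1|exact: bb.2].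
Qed.

Definition tensor_lift (P : lmodType R) (b : M -> N -> P) (bb : bilinear_map b)
  (u : tensor) : P := tensor_eval b (repr u).
Lemma tensor_lift_linear P b (bb : @bilinear_map P b) : linear (tensor_lift bb).
Proof.
by move=> a u v; rewrite /tensor_lift eval_tensorD// eval_tensorZ.
Qed.
HB.instance Definition _ P b (bb : @bilinear_map P b) :=
  GRing.isLinear.Build R tensor P _ (tensor_lift bb) (tensor_lift_linear bb).

Lemma tensor_lift_tens P b (bb : @bilinear_map P b) x y :
  tensor_lift bb (tens x y) = b x y.
Proof. exact: eval_tens. Qed.

Lemma tensor_sum u : u = \sum_(p <- repr u) tens p.1 p.2.
Proof.
rewrite -{1}[u]reprK; elim: (repr u) => [|[x y] s IHs]; first by rewrite big_nil.
rewrite big_cons -IHs; apply: tensorP => P b bb.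
rewrite eval_tensorD// !tensor_eval_repr// /tensor_eval big_cons.
by rewrite big_seq1.
Qed.

Lemma tensor_lift_unique P b (bb : @bilinear_map P b) (f : {linear tensor -> P}) :
  (forall x y, f (tens x y) = b x y) -> f =1 tensor_lift bb.
Proof.
move=> fb u; rewrite [u]tensor_sum !linear_sum; apply: eq_bigr => p _.
by rewrite fb; apply/esym/(tensor_lift_tens bb).
Qed.

End TensorProduct.

Section TensorFunctor.
Variables (R : comPzRingType) (M M' N N' : lmodType R).
Variables (f : {linear M -> M'}) (g : {linear N -> N'}).

Lemma tensor_map_bilinear : bilinear_map (fun x y => tens (f x) (g y)).
Proof.
split=> [x a y y'|y a x x']; rewrite linearP.
  exact: (@tensor_bilinear R M' N').1.
exact: (@tensor_bilinear R M' N').2.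
Qed.

Definition tensor_map : {linear tensor M N -> tensor M' N'} :=
  tensor_lift tensor_map_bilinear.

Lemma tensor_map_tens x y : tensor_map (tens x y) = tens (f x) (g y).
Proof. exact: tensor_lift_tens. Qed.

End TensorFunctor.

Section Flat.
Variables (R : comPzRingType).
Implicit Types (C V X : lmodType R).

Definition flat V :=
  forall (U W : lmodType R) (f : {linear U -> W}), injective f ->
    injective (tensor_map (idfun : {linear V -> V}) f).

Definition PC C : lmodType R -> Prop :=
  fun X => exists P, projective P /\ isomorphic X (tensor P C).

Definition FC C : lmodType R -> Prop :=
  fun X => exists F, flat F /\ isomorphic X (tensor F C).

End Flat.

Record chain_complex (R : comPzRingType) := ChainComplex {
  cobj :> nat -> lmodType R;
  cdiff : forall i, {linear cobj i.+1 -> cobj i};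
  cdiff_eq0 : forall i x, cdiff i (cdiff i.+1 x) = 0
}.

Section Complexes.
Variable R : comPzRingType.
Implicit Types (X : chain_complex R) (M N Y : lmodType R).

Definition outdiff X i : {linear X i -> X i.-1} :=
  match i with
  | 0 => \0
  | j.+1 => cdiff X j
  end.

Definition Hn X i : lmodType R := homology (cdiff X i) (outdiff X i).

Definition exact X := forall i, is_zero_module (Hn X i).

Lemma tensor_complex_eq0 X N i (u : tensor (X i.+2) N) :
  tensor_map (cdiff X i) (idfun : {linear N -> N})
    (tensor_map (cdiff X i.+1) (idfun : {linear N -> N}) u) = 0.
Proof.
rewrite [u]tensor_sum !linear_sum big1// => p _.
rewrite !tensor_map_tens cdiff_eq0.
have tl := (@tensor_bilinear R (X i) N).2 p.2.
by have := scalable_linear tl 0 0; rewrite /= !scale0r.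
Qed.
Definition tensor_complex X N :=
  @ChainComplex R (fun i => tensor (X i) N)
    (fun i => tensor_map (cdiff X i) idfun) (@tensor_complex_eq0 X N).

Lemma hom_complex_eq0 Y X i (f : homm Y (X i.+2)) :
  hom_post (cdiff X i) (hom_post (cdiff X i.+1) f) = 0.
Proof. by apply: hommP => y /=; rewrite cdiff_eq0. Qed.
Definition hom_complex Y X :=
  @ChainComplex R (fun i => homm Y (X i))
    (fun i => hom_post (cdiff X i)) (@hom_complex_eq0 Y X).

(* H^i(Hom(X, N)) *)
Definition cohomology X N i : lmodType R :=
  match i with
  | 0 => homology (\0 : {linear homm (X 0) N -> homm (X 0) N})
           (hom_pre (W := N) (cdiff X 0))
  | j.+1 => homology (hom_pre (W := N) (cdiff X j)) (hom_pre (cdiff X j.+1))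
  end.

(* A complex X together with an augmentation X_0 -> M killing the boundaries. *)
Record augmented M := Augmented {
  acomplex :> chain_complex R;
  augm : {linear acomplex 0 -> M};
  augm_eq0 : forall x, augm (cdiff acomplex 0 x) = 0
}.

(* X^+ is indexed so that M sits in degree 0 and X_i in degree i.+1. *)
Section Plus.
Variables (M : lmodType R) (X : augmented M).

Definition plus_obj i : lmodType R := if i is j.+1 then X j else M.
Definition plus_diff i : {linear plus_obj i.+1 -> plus_obj i} :=
  match i with
  | 0 => augm X
  | j.+1 => cdiff X j
  end.
Lemma plus_diff_eq0 i x : plus_diff i (plus_diff i.+1 x) = 0.
Proof. by case: i x => [|i] x; [exact: augm_eq0 | exact: cdiff_eq0]. Qed.
Definition plus := ChainComplex plus_diff_eq0.

End Plus.

Definition projective_resolution M (P : augmented M) :=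
  (forall i, projective (P i)) /\ exact (plus P).

(* Ext^i(M, N) = 0. As the cohomology does not depend on P, vanishing for some P
   and for every P are the same condition. *)
Definition Ext_vanishes i M N :=
  exists P : augmented M, projective_resolution P /\
    is_zero_module (cohomology P N i).

Definition semidualizing (C : lmodType R) :=
  [/\ finitely_generated C,
      bijective (@homothety R C) &
      forall i, (1 <= i)%N -> Ext_vanishes i C C].

Definition proper_resolution (cX : lmodType R -> Prop) M (X : augmented M) :=
  (forall i, cX (X i)) /\ (forall Y, cX Y -> exact (hom_complex Y (plus X))).

(* sup {i | X_i != 0}, in the extended integers; the sup of set0 is -oo. *)
Definition complex_length X : \bar int :=
  supremum -oo%E
    [set x : \bar int |
       exists i, ~ is_zero_module (X i) /\ x = (i%:Z)%:E]%classic.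

(* The value is -oo for M = 0 (take X = 0). *)
Definition relative_pd (cX : lmodType R -> Prop) M : \bar int :=
  infimum +oo%E
    [set x : \bar int |
       exists X : augmented M, proper_resolution cX X /\
         x = complex_length X]%classic.

Definition Tor_of M (G : augmented M) i N : lmodType R :=
  Hn (tensor_complex G N) i.

(* Tor^{F_C M}_i(M, N) = 0. As the homology does not depend on G, vanishing for
   some G and for every G are the same condition. *)
Definition Tor_vanishes (C : lmodType R) i M N :=
  exists G : augmented M, proper_resolution (FC C) G /\
    is_zero_module (Tor_of G i N).

End Complexes.

(* Main.v *)
From HB Require Import structures.
Require Import Defs.
From mathcomp Require Import all_boot all_order all_algebra.
From mathcomp Require Import generic_quotient ring_quotient.
From mathcomp Require Import boolp classical_sets functions constructive_ereal.

(** Write M' for Hom(C, M). Tensoring with C and taking Hom(C, -) are inverse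
    equivalences between the flat modules and F_C, and between the projective
    modules and P_C: the unit F -> Hom(C, F (x) C) is an isomorphism for flat
    F [hom_flat_tensor]. They exchange proper F_C-resolutions of M with proper
    flat resolutions of M' [hom_proper, tensor_proper], so the theorem becomes
    the classical comparison of flat dimension and Tor for M', where
    coefficients N for M correspond to C (x) N for M'. As the infimum in the
    definition of the relative dimension is attained [relative_pd_le], having
    dimension at most n means having a proper resolution that vanishes above
    n; hence dimension at most n implies vanishing of the relative Tor above
    n, and with it the conditions on residue fields.

    Flatness and purity are handled through finite systems of linear
    equations; a vanishing criterion for tensors [tensor_vanish] shows that
    the equational notion of flatness is the usual one.

    From Tor to F_C-dimension. Vanishing of the relative Tor in degree n+1
    with coefficients in all finitely presented modules says that the
    boundaries in degree n of Q = Hom(C, G) are pure in Q_n [Tor_trivial,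
    hom_tor_trivial]. So the cokernel of Q_(n+1) -> Q_n is a pure quotient of
    a flat module, hence flat, and Q truncated at n is again a proper
    resolution [tor_trivial_flat_quot, truncate]. Different coefficients may
    come with different resolutions G; they are compared by a mapping cone,
    which is an exact complex of flat modules and therefore has pure
    boundaries [tor_trivial_compare].

    From residue fields to P_C-dimension. For finitely generated M the module
    M' has a resolution F by finite free modules. A linear map from C onto R/m
    [residue_functional] turns the vanishing at m into the statement that the
    module K of boundaries of F in degree n meets mF_n in mK
    [hom_residue_trivial, tor_trivial_compare]. By elimination K is then a
    retract of F_n up to a scalar outside m [local_splitting]; the scalars
    with this property form an ideal that lies in no maximal ideal, so K is a
    direct summand, and F can be truncated.

    From P_C-dimension back to Tor. A proper P_C-resolution of M gives a
    finite projective resolution of M', but this need not be proper with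
    respect to flat modules, and a proper F_C-resolution of M has to be found.
    Over a noetherian ring a flat module Q is a pure submodule of its double
    character dual, which is flat and pure-injective [double_dual_pure,
    double_dual_flat, dual_pure_injective]. Going up the finite resolution,
    one embeds each syzygy into a cotorsion module with flat cokernel, and
    obtains by pushout a flat module over M' with cotorsion kernel
    [cotorsion_embedding, pushout_precover]. Maps from flat modules lift
    through such an epimorphism, and iterating yields a proper flat resolution
    of M' of the same length [flat_dim_proper]. *)

Set Implicit Arguments.
Unset Strict Implicit.
Unset Printing Implicit Defensive.
Import GRing.Theory.
Local Open Scope ring_scope.

(** * Linear maps, submodules and quotients *)

Section LinearTools.
Variable R : comPzRingType.
Implicit Types U V W X : lmodType R.

Definition onto U V (f : U -> V) := forall v, exists u, f u = v.

Definition exact_at U V W (f : U -> V) (g : V -> W) :=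
  forall v, g v = 0 <-> exists u, f u = v.

Definition short_exact U V W (f : U -> V) (g : V -> W) :=
  [/\ injective f, exact_at f g & onto g].

Definition submodule V (P : V -> Prop) :=
  P 0 /\ forall a x y, P x -> P y -> P (a *: x + y).

Lemma ex_linear U V (f : U -> V) : linear f -> exists g : {linear U -> V}, g =1 f.
Proof.
move=> fl; pose m := GRing.isLinear.Build R U V _ f fl.
by exists (HB.pack_for {linear U -> V} f m).
Qed.

Lemma linear_inj0 U V (f : {linear U -> V}) :
  (forall x, f x = 0 -> x = 0) -> injective f.
Proof.
by move=> f0 x y fxy; apply/eqP; rewrite -subr_eq0; apply/eqP/f0; rewrite linearB fxy subrr.
Qed.

Lemma inj_eq0 U V (f : {linear U -> V}) : injective f ->
  forall x, f x = 0 -> x = 0.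
Proof. by move=> fi x fx; apply: fi; rewrite fx linear0. Qed.

Section Carve.
Variables (V : lmodType R) (P : V -> Prop) (hP : submodule P).

(** The closure proof is an argument of the predicate, so that unification
    can recover the module structure of the subtype from the predicate. *)
Definition carve_pred of submodule P : {pred V} := [pred x | `[< P x >]].
Notation S := (carve_pred hP).
Lemma carve_closed : submod_closed S.
Proof.
by split=> [|a x y]; rewrite !inE; [case: hP|move=> Px Py; apply: hP.2].
Qed.
HB.instance Definition _ := GRing.isSubmodClosed.Build R V S carve_closed.
Definition carve := {x : V | x \in S}.
HB.instance Definition _ := SubChoice.on carve.
HB.instance Definition _ := [SubChoice_isSubLmodule of carve by <:].

Lemma carve_predE (x : V) : (x \in S : Prop) <-> P x.
Proof. by rewrite inE; split=> [/asboolP|Px] //; apply/asboolP. Qed.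

End Carve.

(** Submodules and quotients are handed over as an injective and a
    surjective linear map: no later argument depends on their encoding. *)
Lemma ex_sub V (P : V -> Prop) : submodule P ->
  exists (U : lmodType R) (i : {linear U -> V}),
    injective i /\ forall v, P v <-> exists u, i u = v.
Proof.
move=> hP; exists (carve hP), (val : {linear carve hP -> V}); split; first exact: val_inj.
move=> v; split=> [Pv|[u <-]]; last by apply/carve_predE/(valP u).
have vS : v \in carve_pred hP by apply/carve_predE.
by exists (Sub v vS).
Qed.

Lemma ex_quot V (P : V -> Prop) : submodule P ->
  exists (W : lmodType R) (p : {linear V -> W}),
    onto p /\ forall v, p v = 0 <-> P v.
Proof.
move=> hP; pose S : submodClosed V := carve_pred hP.
have piE x y : (\pi_(quotm S) x = \pi_(quotm S) y)%qT <-> P (x - y).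
  by rewrite -(carve_predE hP); split=> [/quotm_eqP|?] //; apply/quotm_eqP.
have [] := @ex_linear V (quotm S) (fun x => \pi_(quotm S) x)%qT.
  by move=> a x y; rewrite quotm_piD -quotm_scale_pi.
move=> p pE; exists (quotm S), p; split=> [w|v].
  by exists (repr w); rewrite pE reprK.
rewrite -[X in _ <-> P X]subr0 -piE -pE; split=> [->|].
  by rewrite -pE linear0.
by rewrite -pE linear0.
Qed.

(** Unique choice. Sub- and quotient modules are used below through their
    universal properties only, so every linear map into or out of one of
    them comes from a graph that is total and functional. *)
Lemma ex_linear_graph U V (g : U -> V -> Prop) :
    (forall u, exists v, g u v) -> (forall v, g 0 v -> v = 0) ->
    (forall a u u' v v', g u v -> g u' v' -> g (a *: u + u') (a *: v + v')) ->
  exists f : {linear U -> V}, forall u v, g u v <-> f u = v.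
Proof.
move=> gT g0 gP; have [f fP] := choice gT.
have gU u v v' : g u v -> g u v' -> v = v'.
  move=> gv gv'; apply/eqP; rewrite -subr_eq0; apply/eqP/g0.
  by have := gP (-1) _ _ _ _ gv' gv; rewrite !scaleN1r addrC subrr addrC.
have [|h hf] := @ex_linear U V f; last first.
  by exists h => u v; rewrite hf; split=> [|<-]; [exact: gU|exact: fP].
by move=> a x y; apply: gU (fP _) _; apply: gP.
Qed.

Lemma factor_inj U V X (i : {linear U -> V}) (f : {linear X -> V}) :
  injective i -> (forall x, exists u, i u = f x) ->
  exists g : {linear X -> U}, forall x, i (g x) = f x.
Proof.
move=> ii fi; have [//|||g gP] := @ex_linear_graph X U (fun x u => i u = f x).
- by move=> u iu; apply: ii; rewrite iu !linear0.
- by move=> a x x' u u' iu iu'; rewrite !linearP iu iu'.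
by exists g => x; apply/gP.
Qed.

Lemma factor_surj U V X (p : {linear U -> V}) (f : {linear U -> X}) :
  onto p -> (forall u, p u = 0 -> f u = 0) ->
  exists g : {linear V -> X}, forall u, g (p u) = f u.
Proof.
move=> ps pf.
have [v|v [u [pu <-]]||g gP] :=
  @ex_linear_graph V X (fun v x => exists u, p u = v /\ f u = x).
- by have [u pu] := ps v; exists (f u), u.
- exact: pf.
- move=> a v v' x x' [u [<- <-]] [u' [<- <-]].
  by exists (a *: u + u'); rewrite !linearP.
by exists g => u; apply/gP; exists u.
Qed.

Lemma kernel_submodule U V (f : {linear U -> V}) : submodule (fun u => f u = 0).
Proof. by split=> [|a x y fx fy]; rewrite ?linear0// linearP fx fy scaler0 addr0. Qed.

Lemma image_submodule U V (f : {linear U -> V}) :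
  submodule (fun v => exists u, f u = v).
Proof.
split=> [|a x y [u <-] [v <-]]; first by exists 0; rewrite linear0.
by exists (a *: u + v); rewrite linearP.
Qed.

Lemma ex_kernel U V (f : {linear U -> V}) :
  exists (K : lmodType R) (i : {linear K -> U}), injective i /\ exact_at i f.
Proof. exact: ex_sub (kernel_submodule f). Qed.

Lemma ex_cokernel U V (f : {linear U -> V}) :
  exists (W : lmodType R) (p : {linear V -> W}), onto p /\ exact_at f p.
Proof. exact: ex_quot (image_submodule f). Qed.

Lemma scale_comb (A L : finType) V (r : A -> R) (k : A -> L -> R) (y : L -> V) :
  \sum_a r a *: (\sum_l k a l *: y l) = \sum_l (\sum_a r a * k a l) *: y l.
Proof.
under eq_bigr do rewrite scaler_sumr.
rewrite exchange_big; apply: eq_bigr => l _; rewrite scaler_suml.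
by apply: eq_bigr => a _; rewrite scalerA.
Qed.

Lemma linear_comb U V (f : {linear U -> V}) (A : finType) (r : A -> R) (x : A -> U) :
  f (\sum_a r a *: x a) = \sum_a r a *: f (x a).
Proof. by rewrite linear_sum; apply: eq_bigr => a _; rewrite linearZ. Qed.

Lemma sumB_comb V (A : finType) (r : A -> R) (x y : A -> V) :
  \sum_a r a *: (x a - y a) = \sum_a r a *: x a - \sum_a r a *: y a.
Proof. by rewrite -sumrB; apply: eq_bigr => a _; rewrite scalerBr. Qed.

Lemma ex_comb V (A : finType) (v : A -> V) :
  exists f : {linear (A -> R^o) -> V}, forall c, f c = \sum_a c a *: v a.
Proof.
apply: (@ex_linear (A -> R^o) V (fun c => \sum_a c a *: v a)) => a c d.
rewrite scaler_sumr -big_split; apply: eq_bigr => i _ /=.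
by rewrite scalerDl scalerA.
Qed.

Lemma big_void V (F : void -> V) : \sum_a F a = 0.
Proof. by apply: big1 => -[]. Qed.

Lemma comb_delta V (A : finType) (v : A -> V) a :
  \sum_b (b == a)%:R *: v b = v a.
Proof.
rewrite (bigD1 a)//= eqxx scale1r big1 ?addr0// => b /negPf->.
by rewrite scale0r.
Qed.

Lemma delta_comb V (A : finType) (v : A -> V) a :
  \sum_b (a == b)%:R *: v b = v a.
Proof. by rewrite -[RHS]comb_delta; apply: eq_bigr => b _; rewrite eq_sym. Qed.

End LinearTools.

(** * Flatness and purity by systems of equations *)

Section EquationalFlatness.
Variable R : comPzRingType.
Implicit Types U V W X : lmodType R.

(** The equational criterion for flatness: every finite system of relations
    among elements of V comes from relations over R. It turns the closure
    properties of flat modules into short manipulations of systems. The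
    systems are indexed by arbitrary finite types, so that two of them
    combine along sums and products of their index types. *)
Definition eflat V :=
  forall (A B : finType) (r : B -> A -> R) (x : A -> V),
    (forall b, \sum_a r b a *: x a = 0) ->
    exists (L : finType) (k : A -> L -> R) (y : L -> V),
      (forall a, x a = \sum_l k a l *: y l) /\
      (forall b l, \sum_a r b a * k a l = 0).

(** Purity, stated as solvability of finite linear systems. *)
Definition epure U V (i : U -> V) :=
  forall (A B : finType) (r : B -> A -> R) (u : B -> U) (x : A -> V),
    (forall b, \sum_a r b a *: x a = i (u b)) ->
    exists x' : A -> U, forall b, \sum_a r b a *: x' a = u b.

(** The relevant system has one equation and no unknown. *)
Lemma epure_inj U V (i : {linear U -> V}) : epure i -> injective i.
Proof.
move=> pi; apply: linear_inj0 => u iu.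
have [|x'] := pi void unit (fun _ => of_void _) (fun _ => u) (of_void _).
  by move=> _; rewrite big_void.
by move=> /(_ tt); rewrite big_void.
Qed.

Lemma eflat_retract U V (i : {linear U -> V}) (p : {linear V -> U}) :
  (forall u, p (i u) = u) -> eflat V -> eflat U.
Proof.
move=> pK fV A B r x rx; have [|L [k [y [xy rk]]]] := fV A B r (i \o x).
  by move=> b /=; rewrite -linear_comb rx linear0.
exists L, k, (p \o y); split=> // a.
by rewrite -linear_comb -xy /= pK.
Qed.

Lemma eflat_pure_sub U V (i : {linear U -> V}) : epure i -> eflat V -> eflat U.
Proof.
move=> pi fV A B r x rx; have [|L [k [y [xy rk]]]] := fV A B r (i \o x).
  by move=> b /=; rewrite -linear_comb rx linear0.
have [|y' xy'] := pi L A k x y; first by move=> a; rewrite -xy.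
by exists L, k, y'; split.
Qed.

(** A relation in the quotient lifts to one in V with an error term in U;
    purity of U absorbs the error into the lift. *)
Lemma eflat_pure_quot U V W (i : {linear U -> V}) (p : {linear V -> W}) :
  short_exact i p -> epure i -> eflat V -> eflat W.
Proof.
move=> [ii ex ps] pi fV A B r x rx.
have [x1 px1] := choice (fun a => ps (x a)).
have /choice[u iu] : forall b, exists u, i u = \sum_a r b a *: x1 a.
  move=> b; apply/ex; rewrite linear_comb.
  by under eq_bigr do rewrite px1.
have [|x2 rx2] := pi A B r u x1; first by move=> b; rewrite iu.
have [b|L [k [y [xy rk]]]] := fV A B r (fun a => x1 a - i (x2 a)).
  by rewrite sumB_comb -iu -rx2 linear_comb subrr.
exists L, k, (p \o y); split=> // a; rewrite -linear_comb -xy linearB px1.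
by rewrite (_ : p (i _) = 0) ?subr0//; apply/ex; exists (x2 a).
Qed.

(** A solution in V of a system with constants in U becomes a relation in
    W. Flatness of W makes that relation a combination of relations over R;
    subtracting a lift of this combination moves the solution into U
    without changing the constants. *)
Lemma epure_flat_quot U V W (i : {linear U -> V}) (p : {linear V -> W}) :
  short_exact i p -> eflat W -> epure i.
Proof.
move=> [ii ex ps] fW A B r u x rx.
have [b|L [k [y [xy rk]]]] := fW A B r (p \o x).
  by rewrite /= -linear_comb rx; apply/ex; exists (u b).
have [y1 py1] := choice (fun a => ps (y a)).
have /choice[x' ix'] : forall a, exists u, i u = x a - \sum_l k a l *: y1 l.
  move=> a; apply/ex; rewrite linearB linear_comb.
  under [X in _ - X]eq_bigr do rewrite py1.
  by rewrite -xy subrr.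
exists x' => b; apply: ii; rewrite linear_comb.
under eq_bigr do rewrite ix'.
rewrite sumB_comb rx scale_comb [X in _ - X]big1 ?subr0// => l _.
by rewrite rk scale0r.
Qed.

(** Split off the part of the relation that is visible in the quotient; the
    remainder is a relation in U. *)
Lemma eflat_ext U V W (i : {linear U -> V}) (p : {linear V -> W}) :
  short_exact i p -> eflat U -> eflat W -> eflat V.
Proof.
move=> [ii ex ps] fU fW A B r x rx.
have [b|L [k [y [xy rk]]]] := fW A B r (p \o x).
  by rewrite /= -linear_comb rx linear0.
have [y1 py1] := choice (fun a => ps (y a)).
have /choice[x' ix'] : forall a, exists u, i u = x a - \sum_l k a l *: y1 l.
  move=> a; apply/ex; rewrite linearB linear_comb.
  under [X in _ - X]eq_bigr do rewrite py1.
  by rewrite -xy subrr.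
have [b|L' [k' [y' [xy' rk']]]] := fU A B r x'.
  apply: ii; rewrite linear_comb linear0.
  under eq_bigr do rewrite ix'.
  rewrite sumB_comb rx scale_comb big1 ?subr0// => l _.
  by rewrite rk scale0r.
exists (L + L')%type, (fun a l => match l with inl l => k a l | inr l => k' a l end),
  (fun l => match l with inl l => y1 l | inr l => i (y' l) end); split.
  move=> a; rewrite big_sumType/= -linear_comb -xy' ix' addrC subrK//.
by move=> b [l|l].
Qed.

Lemma eflat_pair U V : eflat U -> eflat V -> eflat (U * V)%type.
Proof.
move=> fU fV.
have [|i iE] := @ex_linear R U (U * V)%type (fun u => (u, 0)).
  by move=> a x y; congr pair; rewrite /= scaler0 addr0.
have [p pE] := @ex_linear R (U * V)%type V snd (fun _ _ _ => erefl).
apply: (@eflat_ext U _ V i p) fU fV; split.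
- by move=> x y; rewrite !iE => -[].
- move=> [u v]; rewrite pE /=; split=> [->|[u']]; first by exists u.
  by rewrite iE => -[].
- by move=> v; exists (0, v); rewrite pE.
Qed.

Lemma eflat_zero V : is_zero_module V -> eflat V.
Proof.
move=> V0 A B r x _; exists void, (fun _ => of_void _), (of_void _); split.
  by move=> a; rewrite big_void; apply: V0.
by move=> b [].
Qed.

End EquationalFlatness.

(** * Vanishing of tensors *)

Section TensorTools.
Variable R : comPzRingType.
Implicit Types U V W X : lmodType R.

Lemma ex_tensl U V (w : V) : exists f : {linear U -> tensor U V}, forall x, f x = tens x w.
Proof. exact: (ex_linear ((tensor_bilinear U V).2 w)). Qed.

Lemma ex_tensr U V (x : U) : exists f : {linear V -> tensor U V}, f =1 tens x.
Proof. exact: (ex_linear ((tensor_bilinear U V).1 x)). Qed.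

Lemma tens_combl U V (A : finType) (c : A -> R) (x : A -> U) (w : V) :
  tens (\sum_a c a *: x a) w = \sum_a c a *: tens (x a) w.
Proof.
have [f fE] := ex_tensl U w; rewrite -fE linear_comb.
by apply: eq_bigr => a _; rewrite fE.
Qed.

Lemma tens_combr U V (A : finType) (c : A -> R) (x : U) (w : A -> V) :
  tens x (\sum_a c a *: w a) = \sum_a c a *: tens x (w a).
Proof.
have [f fE] := ex_tensr V x; rewrite -fE linear_comb.
by apply: eq_bigr => a _; rewrite fE.
Qed.

Lemma tens_suml U V (A : finType) (x : A -> U) (w : V) :
  tens (\sum_a x a) w = \sum_a tens (x a) w.
Proof.
have [f fE] := ex_tensl U w; rewrite -fE linear_sum.
by apply: eq_bigr => a _; rewrite fE.
Qed.

Lemma tens0l U V (w : V) : tens (0 : U) w = 0.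
Proof. by have [f <-] := ex_tensl U w; rewrite linear0. Qed.

Lemma tens0r U V (x : U) : tens x (0 : V) = 0.
Proof. by have [f <-] := ex_tensr V x; rewrite linear0. Qed.

Lemma tensZl U V a (x : U) (w : V) : tens (a *: x) w = a *: tens x w.
Proof. by have [f fE] := ex_tensl U w; rewrite -!fE linearZ. Qed.

Lemma tensZr U V a (x : U) (w : V) : tens x (a *: w) = a *: tens x w.
Proof. by have [f fE] := ex_tensr V x; rewrite -!fE linearZ. Qed.

Lemma tensDl U V (x y : U) (w : V) : tens (x + y) w = tens x w + tens y w.
Proof. by have [f fE] := ex_tensl U w; rewrite -!fE linearD. Qed.

Lemma tensDr U V (x : U) (v w : V) : tens x (v + w) = tens x v + tens x w.
Proof. by have [f fE] := ex_tensr V x; rewrite -!fE linearD. Qed.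

Lemma tensNl U V (x : U) (w : V) : tens (- x) w = - tens x w.
Proof. by have [f fE] := ex_tensl U w; rewrite -!fE linearN. Qed.

Lemma tensor_sum_fin U V (u : tensor U V) :
  exists (A : finType) (x : A -> U) (w : A -> V), u = \sum_a tens (x a) (w a).
Proof.
rewrite [u]tensor_sum; set s := repr u; exists 'I_(size s).
by exists (fun i => (tnth (in_tuple s) i).1), (fun i => (tnth (in_tuple s) i).2);
  rewrite big_tnth.
Qed.

Lemma eq_tensor U V X (f g : {linear tensor U V -> X}) :
  (forall x y, f (tens x y) = g (tens x y)) -> f =1 g.
Proof.
by move=> fg u; rewrite [u]tensor_sum !linear_sum; apply: eq_bigr => p _.
Qed.

Lemma ex_tensor_lift U V X (b : U -> V -> X) : bilinear_map b ->
  exists f : {linear tensor U V -> X}, forall x y, f (tens x y) = b x y.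
Proof. by move=> bb; exists (tensor_lift bb); apply: tensor_lift_tens. Qed.

Lemma tensor_zero U V : is_zero_module U -> is_zero_module (tensor U V).
Proof.
move=> U0 u; rewrite [u]tensor_sum big1// => p _.
by rewrite (U0 p.1) tens0l.
Qed.

Section Vanishing.
Variables X W : lmodType R.

(** An element of the tensor product of X with the free module on the set W
    is a finitely supported function from W to X. Those below form the
    kernel of its map onto the tensor product of X and W: each is a family
    of relations between elements of W, weighted by elements of X. *)
Definition formal_relation (phi : W -> X) :=
  exists (J B : finType) (y : J -> X) (w : B -> W) (r : B -> J -> R),
    (forall j, \sum_b r b j *: w b = 0) /\
    forall v, phi v = \sum_b (w b == v)%:R *: (\sum_j r b j *: y j).

Lemma formal_relation_submodule : @submodule R (W -> X) formal_relation.
Proof.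
split=> [|a f g [J [B [y [w [r [rw fE]]]]]] [J' [B' [y' [w' [r' [rw' gE]]]]]]].
  exists void, void, (of_void _), (of_void _), (fun _ => of_void _); split=> [[]|v].
  by rewrite big_void.
exists (J + J')%type, (B + B')%type,
  (fun j => match j with inl j => a *: y j | inr j => y' j end),
  (fun b => match b with inl b => w b | inr b => w' b end),
  (fun b j => match b, j with inl b, inl j => r b j
     | inr b, inr j => r' b j | _, _ => 0 end); split.
  by case=> j; rewrite big_sumType/= ?rw ?rw' big1 ?addr0// => b _; rewrite scale0r.
move=> v; rewrite big_sumType/=; transitivity (a *: f v + g v) => //.
rewrite fE gE scaler_sumr; congr +%R.
  apply: eq_bigr => b _; rewrite big_sumType/= [X in _ + X]big1 => [|j _].
    rewrite addr0 !scaler_sumr; apply: eq_bigr => j _.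
    by rewrite !scalerA -!mulrA mulrCA (mulrC a).
  by rewrite scale0r.
apply: eq_bigr => b _; rewrite big_sumType/= [X in X + _]big1 ?add0r// => j _.
by rewrite scale0r.
Qed.

(** The classical vanishing criterion for sums of pure tensors. Placing x
    at w defines a bilinear map from X and W to the functions W -> X modulo
    formal relations; a vanishing sum of tensors therefore goes to a formal
    relation, and reading off its values yields the matrices. *)
Lemma tensor_vanish (A : finType) (x : A -> X) (w : A -> W) :
  \sum_a tens (x a) (w a) = 0 ->
  exists (J B : finType) (y : J -> X) (w' : B -> W)
      (r : A -> J -> R) (r' : B -> J -> R),
    [/\ forall a, x a = \sum_j r a j *: y j,
        forall b, \sum_j r' b j *: y j = 0 &
        forall j, \sum_a r a j *: w a + \sum_b r' b j *: w' b = 0].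
Proof.
move=> xw0.
have [Q [p [ps pE]]] := ex_quot formal_relation_submodule.
pose dl (x : X) (w : W) : W -> X := fun v => (w == v)%:R *: x.
have dlx w1 : linear (dl^~ w1).
  move=> a u v; apply/funext => z; rewrite /dl /=.
  by rewrite scalerDr; congr (_ + _); rewrite [LHS]scalerA mulrC -scalerA.
have bb : bilinear_map (fun x w => p (dl x w)).
  split=> [x1 a u v|w1 a u v]; last by rewrite dlx linearP.
  apply/eqP; rewrite -subr_eq0 -linearP -linearB; apply/eqP/pE.
  (* The formal relation 1 [a u + v] - a [u] - 1 [v] = 0, with weight x1. *)
  pose k (i : 'I_3) := if i == 0 :> nat then (a *: u + v) else
                       if i == 1 :> nat then u else v.
  pose c (i : 'I_3) : R := if i == 0 :> nat then 1 else
                       if i == 1 :> nat then - a else - 1.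
  exists unit, 'I_3, (fun _ => x1), k, (fun i _ => c i); split=> [_|z].
    rewrite !big_ord_recl big_ord0 /k /c /= scale1r addr0 scaleN1r scaleNr.
    by rewrite -opprD subrr.
  rewrite !big_ord_recl !big_ord0 /k /c /dl /= !(big_pred1 tt)//.
  rewrite scale1r addr0 scaleN1r scaleNr !scalerN -opprD; congr (_ - _).
  by congr (_ + _); rewrite [LHS]scalerA [RHS]scalerA mulrC.
have [f fE] := ex_tensor_lift bb.
have /pE : p (\sum_a dl (x a) (w a)) = 0.
  transitivity (f 0); last exact: linear0.
  rewrite -xw0 !linear_sum.
  by apply: eq_bigr => a _; rewrite fE.
case=> J [B [y [w' [r [rw dE]]]]].
pose s := [seq w a | a : A] ++ [seq w' b | b : B].
have sE z : z \in s -> \sum_(v : seq_sub s) (z == val v)%:R *: val v = z.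
  move=> zs; rewrite (bigD1 (SeqSub zs))//= eqxx scale1r big1 ?addr0// => v vz.
  case: eqP => [zE|_]; last by rewrite scale0r.
  by case/eqP: vz; apply: val_inj.
(* The auxiliary elements are all the values taken by w and w'. Adjoining
   the x a themselves to the weights gives the first matrix; the second one
   then records the equality of the two functions at each value. *)
exists (J + A)%type, (seq_sub s),
  (fun j => match j with inl j => y j | inr a => x a end), val,
  (fun a j => match j with inl j => 0 | inr a' => (a == a')%:R end),
  (fun v j => match j with inl j => \sum_b (w' b == val v)%:R * r b j
                         | inr a => - (w a == val v)%:R end); split.
- move=> a; rewrite big_sumType/= big1 ?add0r ?delta_comb// => j _.
  by rewrite scale0r.
- move=> v; rewrite big_sumType/=.
  under [X in _ + X]eq_bigr do rewrite scaleNr.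
  have := dE (val v); rewrite fct_sumE sumrN /dl => ->.
  rewrite [X in X - _](_ : _ = \sum_b (w' b == val v)%:R *: (\sum_j r b j *: y j)) ?subrr//.
  by rewrite scale_comb.
- case=> [j|a] /=.
    rewrite [X in X + _]big1 ?add0r => [|a _]; last by rewrite scale0r.
    under eq_bigr do rewrite scaler_suml.
    rewrite exchange_big/=; apply: etrans (rw j); apply: eq_bigr => b _.
    under eq_bigr do rewrite mulrC -scalerA.
    by rewrite -scaler_sumr sE// mem_cat; apply/orP; right; apply: map_f; rewrite mem_enum.
  under [X in _ + X]eq_bigr do rewrite scaleNr.
  rewrite sumrN comb_delta sE ?subrr// mem_cat; apply/orP; left.
  by apply: map_f; rewrite mem_enum.
Qed.

(** When the w a generate W, the auxiliary elements of the criterion are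
    combinations of them and can be eliminated. *)
Lemma tensor_vanish_gen (A : finType) (x : A -> X) (w : A -> W) :
  (forall v, exists c, v = \sum_a c a *: w a) ->
  \sum_a tens (x a) (w a) = 0 ->
  exists (J : finType) (y : J -> X) (r : A -> J -> R),
    (forall a, x a = \sum_j r a j *: y j) /\
    (forall j, \sum_a r a j *: w a = 0).
Proof.
move=> gw /tensor_vanish[J [B [y [w' [r [r' [xE r'y rw]]]]]]].
have [c cE] := choice (fun b => gw (w' b)).
exists J, y, (fun a j => r a j + \sum_b c b a * r' b j); split=> [a|j].
  under eq_bigr do rewrite scalerDl.
  rewrite big_split /= -xE -scale_comb big1 ?addr0// => b _.
  by rewrite r'y scaler0.
rewrite -[RHS](rw j); under eq_bigr do rewrite scalerDl.
rewrite big_split; congr (_ + _).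
under [RHS]eq_bigr do rewrite cE.
rewrite scale_comb; apply: eq_bigr => a _; congr (_ *: _).
by apply: eq_bigr => b _; rewrite mulrC.
Qed.

End Vanishing.

(** A tensor killed in V (x) W vanishes for a reason that involves
    auxiliary elements of W, which need not lie in the image of f, each
    with coefficient zero in V. Flatness rewrites these zero coefficients
    over R, after which the auxiliary elements cancel in W and the
    remaining relation pulls back along f. *)
Lemma eflat_flat V : eflat V -> flat V.
Proof.
move=> fV U W f fi; apply: linear_inj0 => u.
have [A [x [w ->]]] := tensor_sum_fin u.
rewrite linear_sum; under eq_bigr do rewrite tensor_map_tens /=.
move/tensor_vanish => [J [B [y [w' [r [r' [xE r'y rw]]]]]]].
have [L [k [z [yE r'k]]]] := fV J B r' y r'y.
under eq_bigr do rewrite xE; under eq_bigr do under eq_bigr do rewrite yE.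
under eq_bigr do rewrite scale_comb tens_combl.
rewrite exchange_big big1// => l _.
under eq_bigr do rewrite -tensZr.
have [g gE] := ex_tensr U (z l).
under eq_bigr do rewrite -gE.
rewrite -linear_sum; apply: etrans (linear0 g); congr (g _); apply: fi.
rewrite linear0 linear_comb /=.
have -> : \sum_a (\sum_j r a j * k j l) *: f (w a) =
          \sum_j k j l *: (\sum_a r a j *: f (w a)).
  under eq_bigr do rewrite scaler_suml.
  rewrite exchange_big; apply: eq_bigr => j _; rewrite scaler_sumr.
  by apply: eq_bigr => a _; rewrite scalerA mulrC.
have -> : \sum_j k j l *: (\sum_a r a j *: f (w a)) =
          - \sum_j k j l *: (\sum_b r' b j *: w' b).
  rewrite -sumrN; apply: eq_bigr => j _; rewrite -scalerN; congr (_ *: _).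
  by apply/eqP; rewrite -subr_eq0 opprK rw.
rewrite scale_comb big1 ?oppr0// => b _.
by under eq_bigr do rewrite mulrC; rewrite r'k scale0r.
Qed.

(** The system of the vanishing criterion has its constants in U, so it can
    be solved again inside U. *)
Lemma epure_tensor_inj U V (Y : lmodType R) (i : {linear U -> V}) : epure i ->
  injective (tensor_map i (idfun : {linear Y -> Y})).
Proof.
move=> pi; apply: linear_inj0 => u.
have [A [x [w ->]]] := tensor_sum_fin u.
rewrite linear_sum; under eq_bigr do rewrite tensor_map_tens /=.
move/tensor_vanish => [J [B [y [w' [r [r' [xE r'y rw]]]]]]].
have [|y' y'E] := pi J (A + B)%type
  (fun a j => match a with inl a => r a j | inr b => r' b j end)
  (fun a => match a with inl a => x a | inr b => 0 end) y.
  by case=> a; rewrite ?xE// r'y linear0.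
under eq_bigr => a _ do rewrite -(y'E (inl a)) tens_combl.
rewrite exchange_big /=.
transitivity (- \sum_b tens (\sum_j r' b j *: y' j) (w' b)); last first.
  rewrite big1 ?oppr0// => b _; rewrite (y'E (inr b)) tens0l//.
under [X in - X]eq_bigr do rewrite tens_combl.
rewrite [in RHS]exchange_big -sumrN; apply: eq_bigr => j _ /=.
under eq_bigr do rewrite -tensZr; under [X in - X]eq_bigr do rewrite -tensZr.
have [g gE] := ex_tensr Y (y' j).
under eq_bigr do rewrite -gE; under [X in - X]eq_bigr do rewrite -gE.
rewrite -!linear_sum -linearN; congr (g _).
by apply/eqP; rewrite -subr_eq0 opprK; apply/eqP/rw.
Qed.

(** Tensoring the inclusion of the column space of r into R^B with V turns
    a relation in V into a tensor that vanishes in V (x) R^B, hence already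
    over the column space; the vanishing criterion for the generating
    columns is the claim. *)
Lemma flat_eflat V : flat V -> eflat V.
Proof.
move=> fV A B r x rx.
pose col a : B -> R^o := fun b => r b a.
have [g gE] := ex_comb col.
have [U [i [ii iE]]] := ex_sub (image_submodule g).
have /choice[e eE] : forall a, exists u, i u = col a.
  move=> a; apply/iE; exists (fun a' => (a' == a)%:R).
  by rewrite gE comb_delta.
have xe0 : \sum_a tens (x a) (e a) = 0.
  apply: (fV U _ i ii); rewrite linear0 linear_sum.
  under eq_bigr do rewrite tensor_map_tens /= eE.
  have colE a : col a = \sum_b r b a *: (fun b' => (b' == b)%:R : R^o).
    apply/funext => b; rewrite fct_sumE /=.
    transitivity (\sum_b' r b' a * (b == b')%:R) => //.
    rewrite (bigD1 b)//= eqxx mulr1 big1 ?addr0// => b' /negPf.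
    by rewrite eq_sym => ->; rewrite mulr0.
  under eq_bigr do rewrite colE tens_combr.
  rewrite exchange_big big1// => b _.
  under eq_bigr do rewrite -tensZl.
  by rewrite -tens_suml rx tens0l.
have eg v : exists c, v = \sum_a c a *: e a.
  have /iE[c cE] : exists u, i u = i v by exists v.
  exists c; apply: ii; rewrite linear_comb -cE gE.
  by apply: eq_bigr => a _; rewrite eE.
have [J [y [k [xE ke]]]] := tensor_vanish_gen eg xe0.
exists J, k, y; split=> // b l.
have := congr1 (fun u => i u b) (ke l); rewrite linear_comb linear0.
under eq_bigr do rewrite eE.
rewrite fct_sumE => ke0; apply: etrans ke0.
by apply: eq_bigr => a _; apply: mulrC.
Qed.

End TensorTools.

(** * Free and projective modules *)

Section FreeModules.
Variable R : comPzRingType.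
Implicit Types U V W X : lmodType R.

Lemma big_support (T : eqType) V (F : T -> V) (s t : seq T) :
  uniq s -> uniq t -> {subset s <= t} -> (forall x, x \notin s -> F x = 0) ->
  \sum_(x <- t) F x = \sum_(x <- s) F x.
Proof.
move=> us ut st F0; rewrite (bigID (mem s)) /= [X in _ + X]big1; last first.
  by move=> x; apply: F0.
rewrite addr0 -big_filter; apply: perm_big; apply: uniq_perm => //.
  exact: filter_uniq.
by move=> x; rewrite mem_filter; case: (boolP (x \in s)) => //= /st ->.
Qed.

(** The free module on T, realised by finitely supported functions: any
    finitely many of its elements are supported on a common finite set,
    which gives flatness at once, because a relation may be read coordinate
    by coordinate. *)
Lemma ex_free (T : eqType) :
  exists (S : lmodType R) (e : T -> S),
    [/\ forall V (v : T -> V), exists f : {linear S -> V}, forall t, f (e t) = v t,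
        forall s, exists (L : finType) (k : L -> R) (t : L -> T),
          s = \sum_l k l *: e (t l) &
        eflat S].
Proof.
pose fsupp (f : T -> R^o) := exists s : seq T, forall t, t \notin s -> f t = 0.
have fsP : @submodule R (T -> R^o) fsupp.
  split=> [|a f g [s fs] [s' gs]]; first by exists [::].
  exists (s ++ s') => t; rewrite mem_cat negb_or => /andP[ts ts'].
  transitivity (a * f t + g t) => //.
  by rewrite fs// gs// mulr0 addr0.
have [S [i [ii iE]]] := ex_sub fsP.
have /choice[e eE] : forall t, exists u, i u = (fun t' => (t == t')%:R : R^o).
  move=> t; apply/iE; exists [:: t] => t'; rewrite inE eq_sym => /negPf->//.
have supp x : exists s : seq T, uniq s /\ forall t, t \notin s -> i x t = 0.
  have /iE[s sE] : exists u, i u = i x by exists x.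
  exists (undup s); split; first exact: undup_uniq.
  by move=> t; rewrite mem_undup; apply: sE.
have gen (A : finType) (x : A -> S) : exists s : seq T,
    forall a, x a = \sum_(l : 'I_(size s)) i (x a) (tnth (in_tuple s) l) *:
                                       e (tnth (in_tuple s) l).
  have [s sE] := choice (fun a => supp (x a)).
  pose t := undup (flatten [seq s a | a : A]).
  exists t => a; apply: ii; rewrite linear_sum.
  rewrite -(big_tnth _ _ t xpredT (fun z => i (i (x a) z *: e z))).
  apply/funext => z; rewrite fct_sumE.
  transitivity (\sum_(l <- t) i (x a) l * (l == z)%:R); last first.
    by apply: eq_bigr => l _; rewrite linearZ eE.
  have [zt|zt] := boolP (z \in t).
    rewrite (bigD1_seq z)//= ?undup_uniq// eqxx mulr1 big1 ?addr0// => l /negPf->.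
    by rewrite mulr0.
  rewrite big1_seq => [|l /andP[_ lt]]; last first.
    case: eqP => [lz|_]; last by rewrite mulr0.
    by rewrite -lz lt in zt.
  apply: (sE a).2; apply: contra zt; rewrite mem_undup => zs.
  by apply/flattenP; exists (s a) => //; apply: map_f; rewrite mem_enum.
exists S, e; split.
- move=> V v.
  pose g (f : S) (x : V) := exists s : seq T,
    [/\ uniq s, forall t, t \notin s -> i f t = 0 &
        x = \sum_(t <- s) i f t *: v t].
  have [f|x|a f f' x x'|h hE] := @ex_linear_graph R S V g.
  + by have [s [us fs]] := supp f; exists (\sum_(t <- s) i f t *: v t), s.
  + case=> s [_ _ ->]; rewrite big1// => t _; rewrite linear0.
    by transitivity ((0 : R) *: v t); rewrite // scale0r.
  + case=> s [us fs ->] [s' [us' fs' ->]].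
    pose t := undup (s ++ s').
    have ut : uniq t by exact: undup_uniq.
    have st : {subset s <= t} by move=> z zs; rewrite mem_undup mem_cat zs.
    have st' : {subset s' <= t} by move=> z zs; rewrite mem_undup mem_cat zs orbT.
    exists t; split => // [z|].
      rewrite mem_undup mem_cat negb_or linearP => /andP[zs zs'].
      transitivity (a * i f z + i f' z) => //.
      by rewrite fs// fs'// mulr0 addr0.
    rewrite -(big_support us ut st) => [|z zs]; last by rewrite fs ?scale0r.
    rewrite -(big_support us' ut st') => [|z zs]; last by rewrite fs' ?scale0r.
    rewrite scaler_sumr -big_split; apply: eq_bigr => z _ /=.
    by rewrite scalerA -scalerDl linearP.
  exists h => t; apply/hE; exists [:: t]; split=> // [t'|].
    by rewrite inE eq_sym eE => /negPf->.
  by rewrite big_seq1 eE eqxx scale1r.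
- move=> x; have [s sE] := gen unit (fun _ => x).
  by exists 'I_(size s), (fun l => i x (tnth (in_tuple s) l)),
    (fun l => tnth (in_tuple s) l); apply: (sE tt).
move=> A B r x rx; have [s sE] := gen A x.
exists 'I_(size s), (fun a l => i (x a) (tnth (in_tuple s) l)),
  (fun l => e (tnth (in_tuple s) l)); split=> // b l.
have := congr1 (fun u => i u (tnth (in_tuple s) l)) (rx b).
by rewrite linear_comb linear0 fct_sumE.
Qed.

Lemma free_cover V : exists (S : lmodType R) (p : {linear S -> V}),
  [/\ onto p, projective S & eflat S].
Proof.
have [S [e [lift gen fS]]] := ex_free V.
have [p pE] := lift V id; exists S, p; split=> //.
  by move=> v; exists (e v).
move=> U W q f qs; have [u uE] := choice (fun v => qs (f (e v))).
have [g gE] := lift U u; exists g => x.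
have [L [k [t ->]]] := gen x; rewrite !linear_comb.
by apply: eq_bigr => l _; rewrite gE uE.
Qed.

(** A projective module is a retract of a free one. *)
Lemma projective_eflat (P : lmodType R) : projective P -> eflat P.
Proof.
move=> prP; have [S [p [ps _ fS]]] := free_cover P.
have [i ip] := prP _ _ p (idfun : {linear P -> P}) ps.
by apply: (@eflat_retract _ _ _ i p) fS => u; rewrite ip.
Qed.

Lemma projective_retract U V (i : {linear U -> V}) (p : {linear V -> U}) :
  (forall u, p (i u) = u) -> projective V -> projective U.
Proof.
move=> pK prV X W q f qs; have [g gE] := prV X W q (f \o p) qs.
by exists (g \o i) => x; rewrite /= gE /= pK.
Qed.

Lemma projective_free (A : finType) : projective (A -> R^o : lmodType R).
Proof.
move=> U W q f qs.
pose d a : A -> R^o := fun b => (b == a)%:R.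
have dE (c : A -> R^o) : c = \sum_a c a *: d a.
  apply/funext => b; rewrite fct_sumE.
  transitivity (\sum_a c a * (b == a)%:R) => //.
  rewrite (bigD1 b)//= eqxx mulr1 big1 ?addr0// => b' /negPf.
  by rewrite eq_sym => ->; rewrite mulr0.
have [u uE] := choice (fun a => qs (f (d a))).
have [g gE] := ex_comb u; exists g => c.
rewrite gE linear_comb [in RHS](dE c) linear_comb.
by apply: eq_bigr => a _; rewrite uE.
Qed.

End FreeModules.

(** * Finite generation and presentations *)

Section Noetherian.
Variable R : comPzRingType.
Implicit Types U V W X : lmodType R.

Definition gens (A : finType) V (v : A -> V) :=
  forall x, exists c : A -> R, x = \sum_a c a *: v a.

Definition noeth V := forall P : V -> Prop, submodule P ->
  exists (A : finType) (v : A -> V), (forall a, P (v a)) /\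
    forall x, P x -> exists c : A -> R, x = \sum_a c a *: v a.

Lemma submodule_comb V (P : V -> Prop) (A : finType) (c : A -> R) (v : A -> V) :
  submodule P -> (forall a, P (v a)) -> P (\sum_a c a *: v a).
Proof.
move=> [P0 PD] Pv; elim/big_rec: _ => // a x _ Px.
exact: PD.
Qed.

Lemma noeth_ext U V W (i : {linear U -> V}) (p : {linear V -> W}) :
  exact_at i p -> onto p -> noeth U -> noeth W -> noeth V.
Proof.
move=> ex ps nU nW P PP.
have [|A [u [Pu uE]]] := nU (fun x => P (i x)).
  split=> [|a x y]; first by rewrite linear0; case: PP.
  by rewrite linearP; apply: PP.2.
have [|B [w [Pw wE]]] := nW (fun x => exists v, P v /\ p v = x).
  split=> [|a x y [v [Pv <-]] [v' [Pv' <-]]].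
    by exists 0; rewrite linear0; case: PP.
  by exists (a *: v + v'); rewrite linearP; split=> //; apply: PP.2.
have [v vE] := choice Pw.
exists (A + B)%type,
  (fun a => match a with inl a => i (u a) | inr b => v b end); split.
  by case=> [a|b] //; apply: (vE b).1.
move=> x Px; have [|c cE] := wE (p x); first by exists x.
have /ex[y yE] : p (x - \sum_b c b *: v b) = 0.
  rewrite linearB cE linear_comb.
  by under [X in _ - X]eq_bigr do rewrite (vE _).2; rewrite subrr.
have [|d dE] := uE y.
  rewrite yE -scaleN1r addrC; apply: PP.2 => //.
  by apply: submodule_comb => // b; apply: (vE b).1.
exists (fun a => match a with inl a => d a | inr b => c b end).
by rewrite big_sumType /= -linear_comb -dE yE subrK.
Qed.

Lemma noeth_ring : noetherian R -> noeth (R^o : lmodType R).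
Proof.
move=> hR P PP; have [s [sI sE]] := hR (carve_pred PP).
exists 'I_(size s), (fun i : 'I_(size s) => s`_i); split=> [i|x Px].
  by apply/(carve_predE PP)/sI/mem_nth.
have [|c ->] := sE x; first by apply/(carve_predE PP).
by exists (fun i : 'I_(size s) => c i).
Qed.

(** Induction on the number of generators: the first one spans an image of
    R, and the quotient needs one generator fewer. *)
Lemma noeth_gens (n : nat) V (v : 'I_n -> V) :
  noetherian R -> gens v -> noeth V.
Proof.
move=> hR; elim: n V v => [|n IHn] V v gv.
  move=> P PP; exists void, (of_void _); split=> [[]|x _].
  by exists (of_void _); have [c ->] := gv x; rewrite big_ord0 big_void.
have [f fE] := @ex_linear R R^o V (fun a => a *: v ord0)
  (fun a x y => etrans (scalerDl _ _ _) (congr1 (+%R^~ _) (esym (scalerA _ _ _)))).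
have [W [p [ps ex]]] := ex_cokernel f.
apply: (noeth_ext ex ps (noeth_ring hR)).
apply: (IHn _ (fun i => p (v (lift ord0 i)))) => w.
have [x <-] := ps w; have [c ->] := gv x.
exists (fun i => c (lift ord0 i)); rewrite big_ord_recl linearD.
rewrite (_ : p (_ *: _) = 0) ?add0r ?linear_comb//.
by apply/ex; exists (c ord0); rewrite fE.
Qed.

Lemma fg_gens V : finitely_generated V ->
  exists (A : finType) (v : A -> V), gens v.
Proof.
move=> [s sE]; exists 'I_(size s), (fun i : 'I_(size s) => s`_i) => x.
by have [c ->] := sE x; exists (fun i : 'I_(size s) => c i).
Qed.

Lemma gens_ord (A : finType) V (v : A -> V) : gens v ->
  gens (fun i : 'I_#|A| => v (enum_val i)).
Proof.
move=> gv x; have [c ->] := gv x; exists (fun i => c (enum_val i)).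
by rewrite (reindex (@enum_val A A)) //; apply: onW_bij; apply: enum_val_bij.
Qed.

Lemma gens_noeth (A : finType) V (v : A -> V) :
  noetherian R -> gens v -> noeth V.
Proof. by move=> hR /gens_ord; apply: noeth_gens. Qed.

Lemma gens_free (A : finType) :
  @gens A (A -> R^o) (fun a b => (b == a)%:R : R^o).
Proof.
move=> c; exists c; apply/funext => b; rewrite fct_sumE.
transitivity (\sum_a c a * (b == a)%:R) => //.
rewrite (bigD1 b)//= eqxx mulr1 big1 ?addr0// => b' /negPf.
by rewrite eq_sym => ->; rewrite mulr0.
Qed.

Definition presents (A L : finType) V (v : A -> V) (rel : L -> A -> R) :=
  [/\ gens v, forall l, \sum_a rel l a *: v a = 0 &
      forall c, \sum_a c a *: v a = 0 ->
        exists z : L -> R, forall a, c a = \sum_l z l * rel l a].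

Lemma ex_presentation (A : finType) V (v : A -> V) :
  noetherian R -> gens v -> exists (L : finType) (rel : L -> A -> R),
    presents v rel.
Proof.
move=> hR gv; have [f fE] := ex_comb v.
have [L [rel [relP relE]]] :=
  gens_noeth hR (@gens_free A) (kernel_submodule f).
exists L, rel; split=> // [l|c c0]; first by rewrite -fE.
have [|z zE] := relE c; first by rewrite fE.
by exists z => a; rewrite zE fct_sumE.
Qed.

Lemma ex_presented_map (A L : finType) V (v : A -> V) (rel : L -> A -> R) W (w : A -> W) :
  presents v rel -> (forall l, \sum_a rel l a *: w a = 0) ->
  exists f : {linear V -> W}, forall a, f (v a) = w a.
Proof.
move=> [gv v0 vE] w0.
have [p pE] := ex_comb v; have [q qE] := ex_comb w.
have [x|c|f fE] := @factor_surj _ _ _ _ p q.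
- by have [c ->] := gv x; exists c.
- rewrite pE qE => /vE[z zE].
  under eq_bigr do rewrite zE scaler_suml.
  rewrite exchange_big big1// => l _.
  under eq_bigr do rewrite -scalerA.
  by rewrite -scaler_sumr w0 scaler0.
exists f => a; have := fE (fun b => (b == a)%:R).
by rewrite pE qE !comb_delta.
Qed.

Lemma tens_gens (A : finType) X V (v : A -> V) : gens v ->
  forall u : tensor X V, exists x : A -> X, u = \sum_a tens (x a) (v a).
Proof.
move=> gv u; have [B [x [w ->]]] := tensor_sum_fin u.
have [c cE] := choice (fun b => gv (w b)).
exists (fun a => \sum_b c b a *: x b).
under eq_bigr do rewrite cE tens_combr.
rewrite exchange_big; apply: eq_bigr => a _.
by rewrite tens_combl.
Qed.

(** For a presented module V this is the exactness of X^L -> X^A -> X (x) V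
    -> 0. *)
Lemma tensor_vanish_pres (A L : finType) X V (v : A -> V) (rel : L -> A -> R)
    (x : A -> X) : presents v rel -> \sum_a tens (x a) (v a) = 0 ->
  exists g : L -> X, forall a, x a = \sum_l rel l a *: g l.
Proof.
move=> [gv _ vE] /(tensor_vanish_gen gv)[J [y [r [xE r0]]]].
have [z zE] := choice (fun j => vE _ (r0 j)).
exists (fun l => \sum_j z j l *: y j) => a.
rewrite scale_comb xE; apply: eq_bigr => j _; congr (_ *: _).
by rewrite zE; apply: eq_bigr => l _; rewrite mulrC.
Qed.

Lemma gens_linear_eq (A : finType) V W (v : A -> V) (f g : {linear V -> W}) :
  gens v -> (forall a, f (v a) = g (v a)) -> f =1 g.
Proof.
move=> gv fg x; have [c ->] := gv x; rewrite !linear_comb.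
by apply: eq_bigr => a _; rewrite fg.
Qed.

End Noetherian.

(** * Flat modules and their tensor products with C *)

Section Semidualizing.
Variables (R : comPzRingType) (hR : noetherian R).
Variables (C : lmodType R) (hC : semidualizing C).
Implicit Types F U V W X : lmodType R.

Lemma semidualizing_faithful (a : R) : (forall x : C, a *: x = 0) -> a = 0.
Proof.
move=> a0; have [_ /bij_inj hinj _] := hC.
have ha : @homothety R C a = homothety C 0.
  by apply: hommP => x /=; rewrite a0 scale0r.
exact: hinj ha.
Qed.

Lemma semidualizing_endo (h : {linear C -> C}) :
  exists a : R, forall x, h x = a *: x.
Proof.
have [_ [g _ gK] _] := hC; exists (g h) => x.
by rewrite -[in LHS](gK h).
Qed.

Lemma semidualizing_presented : exists (A L : finType) (c : A -> C) (rel : L -> A -> R),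
  presents c rel.
Proof.
have [/fg_gens[A [c gc]] _ _] := hC.
have [L [rel pr]] := ex_presentation hR gc.
by exists A, L, c, rel.
Qed.

(** The generators c a of C define a map from R to C^A, which is injective
    because C is faithful. It stays injective after tensoring with F, and
    sends y to the family of the y (x) c a. *)
Lemma flat_unit_inj F : eflat F -> forall y : F, (forall x : C, tens y x = 0) -> y = 0.
Proof.
move=> fF y y0; have [A [L [c [rel [gc _ _]]]]] := semidualizing_presented.
have [|g gE] := @ex_linear R R^o (A -> C) (fun r a => r *: c a).
  move=> r s t; apply/funext => a.
  transitivity (r *: (s *: c a) + t *: c a) => //.
  by rewrite scalerDl scalerA.
have gi : injective g.
  apply: linear_inj0 => r rc0; apply: semidualizing_faithful => x.
  have [s ->] := gc x; rewrite scaler_sumr big1// => a _.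
  rewrite scalerA mulrC -scalerA.
  have -> : r *: c a = g r a by rewrite gE.
  by rewrite rc0; exact: scaler0.
have y1 : tens y (1 : R^o) = 0.
  apply: (eflat_flat fF gi); rewrite linear0 tensor_map_tens /= gE.
  pose dl (a : A) (x : C) : A -> C := fun b => (a == b)%:R *: x.
  have dlP a : linear (dl a).
    move=> r u v; apply/funext => b; rewrite /dl scalerDr; congr (_ + _).
    by rewrite scalerA mulrC -scalerA.
  have -> : (fun a => 1 *: c a) = \sum_a dl a (c a).
    apply/funext => b; rewrite fct_sumE scale1r /dl.
    by rewrite comb_delta.
  have [f fE] := ex_tensr (A -> C : lmodType R) y.
  rewrite -fE linear_sum big1// => a _.
  have [d dE] := ex_linear (dlP a).
  rewrite fE -dE.
  have := tensor_map_tens (idfun : {linear F -> F}) d y (c a) => /= <-.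
  by rewrite y0 linear0.
have [|f fE] := @ex_tensor_lift R F R^o F (fun x r => (r : R) *: x).
  split=> [x a u v|r a u v].
    by rewrite scalerDl scalerA.
  by rewrite scalerDr !scalerA mulrC.
by rewrite -[y]scale1r -fE y1 linear0.
Qed.

(** Write phi (c i) as the sum of the f i j (x) c j. That phi respects the
    presentation of C is a linear system satisfied by the f i j in F, so by
    flatness f is a combination, with coefficients y s in F, of solutions k
    over R. Each solution over R is the matrix of an endomorphism of C,
    that is, of multiplication by some a s; hence phi is tensoring with the
    sum of the a s *: y s. *)
Lemma flat_unit_surj F : eflat F ->
  forall phi : {linear C -> tensor F C}, exists y, forall x, phi x = tens y x.
Proof.
move=> fF phi; have [A [L [c [rel pr]]]] := semidualizing_presented.
have [gc rel0 _] := pr.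
have [f fE] := choice (fun i => tens_gens gc (phi (c i))).
have /choice[g gE] l : exists g : L -> F,
    forall j, \sum_i rel l i *: f i j = \sum_m rel m j *: g m.
  apply: (tensor_vanish_pres pr); transitivity (phi (\sum_i rel l i *: c i)).
    rewrite linear_comb; under [RHS]eq_bigr do rewrite fE scaler_sumr.
    rewrite exchange_big; apply: eq_bigr => j _; rewrite tens_combl.
    by [].
  by rewrite rel0 linear0.
(* Unknowns f i j and g l m; for each relation l and each generator j of C,
   one equation. *)
have [|Y [k [y [kE rk]]]] := fF ((A * A) + (L * L))%type (L * A)%type
  (fun e u => match u with
    | inl ij => (e.2 == ij.2)%:R * rel e.1 ij.1
    | inr lm => - ((e.1 == lm.1)%:R * rel lm.2 e.2) end)
  (fun u => match u with inl ij => f ij.1 ij.2 | inr lm => g lm.1 lm.2 end).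
  case=> l j; rewrite big_sumType /=.
  rewrite -(pair_bigA _ (fun i j' => ((j == j')%:R * rel l i) *: f i j')) /=.
  rewrite -(pair_bigA _ (fun l' m => - ((l == l')%:R * rel m j) *: g l' m)) /=.
  rewrite exchange_big /=.
  have -> : \sum_j' \sum_i ((j == j')%:R * rel l i) *: f i j' =
            \sum_j' (j == j')%:R *: \sum_i rel l i *: f i j'.
    apply: eq_bigr => j' _; rewrite scaler_sumr.
    by apply: eq_bigr => i _; rewrite scalerA.
  have -> : \sum_l' \sum_m - ((l == l')%:R * rel m j) *: g l' m =
            - \sum_l' (l == l')%:R *: \sum_m rel m j *: g l' m.
    rewrite -sumrN; apply: eq_bigr => l' _; rewrite scaler_sumr -sumrN.
    by apply: eq_bigr => m _; rewrite scaleNr scalerA.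
  by rewrite !delta_comb gE subrr.
have rk' l j s : \sum_i rel l i * k (inl (i, j)) s =
                 \sum_m rel m j * k (inr (l, m)) s.
  have kl p : k (inl p) s = k (inl (p.1, p.2)) s by case: p.
  have kr p : k (inr p) s = k (inr (p.1, p.2)) s by case: p.
  have := rk (l, j) s; rewrite big_sumType /=.
  under eq_bigr do rewrite kl; under [X in _ + X]eq_bigr do rewrite kr.
  rewrite -(pair_bigA _ (fun i j' => (j == j')%:R * rel l i * k (inl (i, j')) s)) /=.
  rewrite -(pair_bigA _ (fun l' m => - ((l == l')%:R * rel m j) * k (inr (l', m)) s)) /=.
  rewrite exchange_big /=.
  rewrite (bigD1 j)//= [X in _ + X + _]big1 => [|j' /negPf]; last first.
    by rewrite eq_sym => jj'; rewrite big1// => i _; rewrite jj' !mul0r.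
  rewrite [X in _ + X](bigD1 l)//= [X in _ + (_ + X)]big1 => [|l' /negPf]; last first.
    by rewrite eq_sym => ll'; rewrite big1// => m _; rewrite ll' mul0r oppr0 mul0r.
  rewrite !addr0 !eqxx.
  under eq_bigr do rewrite mul1r.
  under [X in _ + X]eq_bigr do rewrite mul1r mulNr.
  by rewrite sumrN => /eqP; rewrite subr_eq0 => /eqP.
have /choice[a aE] s : exists a : R,
    forall i, \sum_j k (inl (i, j)) s *: c j = a *: c i.
  have [l|h hE] := @ex_presented_map R A L C c rel C
    (fun i => \sum_j k (inl (i, j)) s *: c j) pr.
    rewrite scale_comb.
    under eq_bigr do rewrite rk' scaler_suml.
    rewrite exchange_big big1// => m _.
    under eq_bigr do rewrite mulrC -scalerA.
    by rewrite -scaler_sumr rel0 scaler0.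
  by have [a aE] := semidualizing_endo h; exists a => i; rewrite -hE aE.
exists (\sum_s a s *: y s).
have [t tE] := ex_tensr C (\sum_s a s *: y s).
move=> x; rewrite -tE; apply: (gens_linear_eq gc) => {x} i.
rewrite tE fE tens_combl.
under eq_bigr do rewrite (kE (inl (i, _))) tens_combl.
rewrite exchange_big; apply: eq_bigr => s _ /=.
by rewrite -tensZr -aE tens_combr.
Qed.

(** The unit of the adjunction between tensoring with C and Hom(C, -) is an
    isomorphism on flat modules. *)
Lemma hom_flat_tensor F : eflat F ->
  exists f : {linear F -> homm C (tensor F C)},
    bijective f /\ forall y x, f y x = tens y x.
Proof.
move=> fF; have [f0 f0E] := choice (fun y : F => ex_tensr C y).
have [|f fE] := @ex_linear R F (homm C (tensor F C)) f0.
  move=> a y z; apply: hommP => x /=; rewrite !f0E.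
  by rewrite tensDl tensZl.
have fE' y x : f y x = tens y x by rewrite fE f0E.
exists f; split=> //.
have [|g gf] := @choice _ _ (fun phi y => f y = phi).
  move=> phi; have [y yE] := flat_unit_surj fF phi.
  by exists y; apply: hommP => x; rewrite fE' yE.
exists g => // y; apply: (linear_inj0 (f := f)) => [z fz0|]; last exact: gf.
by apply: flat_unit_inj => // x; rewrite -fE' fz0.
Qed.

End Semidualizing.

(** * Proper resolutions *)

Section Resolutions.
Variable R : comPzRingType.
Implicit Types U V W M N : lmodType R.

Lemma homology_eq0 U V W (f : {linear U -> V}) (g : {linear V -> W}) :
  is_zero_module (homology f g) <->
  forall x, g x = 0 -> exists u, f u = x.
Proof.
split=> [H0 x gx|ex y].
  have xk : x \in kernel g by rewrite inE gx.
  have /(quotm_eqP (@boundary R U V W f g)) :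
      (\pi_(quotm (@boundary R U V W f g)) (exist _ x xk) =
       \pi_(quotm (@boundary R U V W f g)) 0)%qT.
    exact: etrans (H0 _) (esym (H0 _)).
  by rewrite subr0 inE.
have [x xk] : exists x : kerm g, (\pi_(quotm (@boundary R U V W f g)) x)%qT = y.
  by exists (repr y); rewrite reprK.
rewrite -xk; transitivity (\pi_(quotm (@boundary R U V W f g)) 0)%qT; last exact: raddf0.
apply/(quotm_eqP (@boundary R U V W f g)); rewrite subr0 inE; apply/ex.
by apply/eqP; have := valP x; rewrite inE.
Qed.

Definition resolves M (X : augmented M) :=
  [/\ onto (augm X),
      forall x, augm X x = 0 -> exists u, cdiff X 0 u = x &
      forall i x, cdiff X i x = 0 -> exists u, cdiff X i.+1 u = x].

Definition hom_exact (Y : lmodType R) M (X : augmented M) :=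
  [/\ forall f : {linear Y -> M}, exists g : {linear Y -> X 0},
        forall y, augm X (g y) = f y,
      forall f : {linear Y -> X 0}, (forall y, augm X (f y) = 0) ->
        exists g : {linear Y -> X 1}, forall y, cdiff X 0 (g y) = f y &
      forall i (f : {linear Y -> X i.+1}), (forall y, cdiff X i (f y) = 0) ->
        exists g : {linear Y -> X i.+2}, forall y, cdiff X i.+1 (g y) = f y].

Lemma hom_eqP U V (f g : homm U V) : f = g <-> f =1 g.
Proof. by split=> [->//|]; apply: hommP. Qed.

Lemma exact_hom_plus Y M (X : augmented M) :
  exact (hom_complex Y (plus X)) <-> hom_exact Y X.
Proof.
split=> [ex|[aX d0 dS] [|[|i]]].
- split=> [f|f af|i f df].
  + have /homology_eq0/(_ f erefl)[g gE] := ex 0%N.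
    by exists g => y; rewrite -gE.
  + have /homology_eq0/(_ f)[|g gE] := ex 1%N; first exact: hommP.
    by exists g => y; rewrite -gE.
  + have /homology_eq0/(_ f)[|g gE] := ex i.+2; first exact: hommP.
    by exists g => y; rewrite -gE.
- apply/homology_eq0 => f _; have [g gE] := aX f.
  by exists g; apply: hommP.
- apply/homology_eq0 => f /hom_eqP df; have [g gE] := d0 f df.
  by exists g; apply: hommP.
- apply/homology_eq0 => f /hom_eqP df; have [g gE] := dS i f df.
  by exists g; apply: hommP.
Qed.

Lemma proper_resolutionE (cX : lmodType R -> Prop) M (X : augmented M) :
  proper_resolution cX X <->
  (forall i, cX (X i)) /\ forall Y, cX Y -> hom_exact Y X.
Proof.
by split=> -[Xc ex]; split=> // Y /ex /exact_hom_plus.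
Qed.

Lemma Tor_eq0 M (G : augmented M) i N :
  is_zero_module (Tor_of G i.+1 N) <->
  forall x : tensor (G i.+1) N, tensor_map (cdiff G i) idfun x = 0 ->
    exists u : tensor (G i.+2) N, tensor_map (cdiff G i.+1) idfun u = x.
Proof. exact: homology_eq0. Qed.

Lemma Tor_zero M (G : augmented M) i N :
  is_zero_module (G i.+1) -> is_zero_module (Tor_of G i.+1 N).
Proof.
move=> G0; apply/Tor_eq0 => x _; exists 0.
by rewrite linear0; apply/esym/tensor_zero.
Qed.

Lemma ex_inverse U V (f : {linear U -> V}) : bijective f ->
  exists g : {linear V -> U}, cancel f g /\ cancel g f.
Proof.
move=> [g fg gf]; have [|h hE] := @ex_linear R V U g.
  by move=> a x y; rewrite -[RHS]fg linearP !gf.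
by exists h; split=> x; rewrite hE.
Qed.

Lemma hom_exact_iso (Y Y' : lmodType R) M (X : augmented M) (f : {linear Y -> Y'}) :
  bijective f -> hom_exact Y' X -> hom_exact Y X.
Proof.
move=> /ex_inverse[f' [ff' f'f]] [aX d0 dS]; split=> [h|h h0|i h h0].
- have [g gE] := aX (h \o f'); exists (g \o f) => y.
  by rewrite /= gE /= ff'.
- have [|g gE] := d0 (h \o f'); first by move=> y; apply: h0.
  by exists (g \o f) => y; rewrite /= gE /= ff'.
- have [|g gE] := dS i (h \o f'); first by move=> y; apply: h0.
  by exists (g \o f) => y; rewrite /= gE /= ff'.
Qed.

Lemma ex_scale V (v : V) : exists f : {linear R^o -> V}, forall a, f a = (a : R) *: v.
Proof.
apply: (@ex_linear R R^o V (fun a => (a : R) *: v)) => a x y.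
by rewrite scalerDl scalerA.
Qed.

(** Elements of a module are linear maps from R. *)
Lemma hom_exact_ring M (X : augmented M) : hom_exact R^o X -> resolves X.
Proof.
move=> [aX d0 dS]; split=> [m|x ax|i x dx].
- have [f fE] := ex_scale m; have [g gE] := aX f.
  by exists (g 1); rewrite gE fE scale1r.
- have [f fE] := ex_scale x; have [|g gE] := d0 f.
    by move=> a; rewrite fE linearZ /= ax scaler0.
  by exists (g 1); rewrite gE fE scale1r.
- have [f fE] := ex_scale x; have [|g gE] := dS i f.
    by move=> a; rewrite fE linearZ /= dx scaler0.
  by exists (g 1); rewrite gE fE scale1r.
Qed.

(** The lifting problem takes place in the image of d. *)
Lemma projective_lift_ker (P U V W : lmodType R) (d : {linear U -> V}) (e : {linear V -> W})
    (f : {linear P -> V}) :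
  projective P -> (forall v, e v = 0 -> exists u, d u = v) ->
  (forall y, e (f y) = 0) -> exists g : {linear P -> U}, forall y, d (g y) = f y.
Proof.
move=> prP ex ef0; have [I [i [ii iE]]] := ex_sub (image_submodule d).
have [u|d' d'E] := factor_inj (f := d) ii; first by apply/iE; exists u.
have [y|f' f'E] := factor_inj (f := f) ii.
  by have /ex[u du] := ef0 y; apply/iE; exists u.
have [w|g gE] := prP _ _ d' f'.
  have /iE[u du] : exists v, i v = i w by exists w.
  by exists u; apply: ii; rewrite d'E.
by exists g => y; rewrite -d'E gE f'E.
Qed.

Lemma projective_hom_exact (P : lmodType R) M (X : augmented M) :
  projective P -> resolves X -> hom_exact P X.
Proof.
move=> prP [aX d0 dS]; split=> [f|f f0|i f f0].
- exact: prP.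
- exact: projective_lift_ker d0 f0.
- exact: projective_lift_ker (dS i) f0.
Qed.

End Resolutions.

(** * Relative dimension *)

Section RelativeDimension.
Variable R : comPzRingType.
Local Open Scope classical_set_scope.
Import Order.TTheory.

Lemma supremum_eq (A : set (\bar int)) x0 x :
  A !=set0 -> supremums A x -> supremum x0 A = x.
Proof.
move=> /set0P A0 Ax; rewrite /supremum (negPf A0).
by apply: xget_subset1 => //; apply: is_subset1_supremums.
Qed.

Lemma infimum_eq (A : set (\bar int)) x0 x :
  A x -> lbound A x -> infimum x0 A = x.
Proof.
move=> Ax lx; have A0 : A != set0 by apply/set0P; exists x.
have Ix : infimums A x by split=> // y; apply.
rewrite /infimum (negPf A0).
by apply: xget_subset1 => //; apply: is_subset1_infimums.
Qed.

Lemma complex_lengthP (X : chain_complex R) :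
  [\/ (forall i, is_zero_module (X i)) /\ complex_length X = -oo%E,
      exists m, [/\ ~ is_zero_module (X m),
        forall i, (m < i)%N -> is_zero_module (X i) &
        complex_length X = ((m%:Z)%:E)%E] |
      (forall m, exists i, (m < i)%N /\ ~ is_zero_module (X i)) /\
      complex_length X = +oo%E].
Proof.
pose S : set (\bar int) := [set x | exists i, ~ is_zero_module (X i) /\ x = (i%:Z)%:E%E].
have [X0|/existsNP[i0 Xi0]] := pselect (forall i, is_zero_module (X i)).
  constructor 1; split=> //; rewrite /complex_length.
  rewrite (_ : [set x | _] = set0) ?supremum0//.
  by apply/seteqP; split=> // x [i [/(_ (X0 i))]].
have S0 : S !=set0 by exists (i0%:Z)%:E%E, i0.
have [[b bX]|nb] := pselect (exists b, forall i, ~ is_zero_module (X i) -> (i <= b)%N).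
  constructor 2.
  pose p i := `[< ~ is_zero_module (X i) >].
  have [||m /asboolP Xm maxm] := @ex_maxnP p b.
  - by exists i0; apply/asboolP.
  - by move=> i /asboolP; apply: bX.
  exists m; split=> // [i mi|].
    apply: contrapT => Xi; have := maxm i (asboolT Xi).
    by rewrite leqNgt mi.
  apply: supremum_eq => //; split; first last.
    by move=> y; apply; exists m.
  move=> _ [i [Xi ->]]; rewrite lee_fin lez_nat.
  exact/maxm/asboolP.
constructor 3.
have ub m : exists i, (m < i)%N /\ ~ is_zero_module (X i).
  apply: contrapT => nm; apply: nb; exists m => i Xi.
  by rewrite leqNgt; apply/negP => mi; apply: nm; exists i.
split=> //; apply: supremum_eq => //; split=> [y _|[y| |] yS].
- exact: leey.
- have [i [yi Xi]] := ub `|y|%N.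
  have : ((i%:Z)%:E <= y%:E)%E by apply: yS; exists i.
  rewrite lee_fin => iy; exfalso; move: yi; rewrite ltnNge => /negP; apply.
  by rewrite -lez_nat (le_trans iy)// abszE Num.Theory.ler_norm.
- by [].
- have : ((i0%:Z)%:E <= -oo)%E by apply: yS; exists i0.
  by [].
Qed.

Lemma complex_length_le (X : chain_complex R) (n : nat) :
  (complex_length X <= (n%:Z)%:E)%E <->
  forall i, (n < i)%N -> is_zero_module (X i).
Proof.
case: (complex_lengthP X) => [[X0 ->]|[m [Xm Xi ->]]|[ub ->]].
- by split=> // _; rewrite leNye.
- rewrite lee_fin lez_nat; split=> [mn i ni|nX].
    by apply: Xi; apply: leq_ltn_trans ni.
  by rewrite leqNgt; apply/negP => /nX.
- split=> [|nX]; first by rewrite leNgt ltey.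
  by have [i [ni]] := ub n; case; apply: nX.
Qed.

(** The possible lengths of a complex are -oo, the natural numbers and +oo.
    They are well ordered, so the infimum that defines the relative
    dimension is attained. *)
Lemma relative_pd_le (cX : lmodType R -> Prop) (M : lmodType R) (n : nat) :
  (relative_pd cX M <= (n%:Z)%:E)%E <->
  exists X : augmented M, proper_resolution cX X /\
    forall i, (n < i)%N -> is_zero_module (X i).
Proof.
pose S : set (\bar int) := [set x | exists X : augmented M, proper_resolution cX X /\
         x = complex_length X].
have least : (S = set0 /\ relative_pd cX M = +oo%E) \/
             (S (relative_pd cX M) /\ lbound S (relative_pd cX M)).
  have [S0|/set0P[x0 Sx0]] := eqVneq S set0.
    by left; split=> //; rewrite /relative_pd -/S S0 /infimum eqxx.
  right; suff [x [Sx lx]] : exists x, S x /\ lbound S x.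
    have -> : relative_pd cX M = x by exact: infimum_eq Sx lx.
    by [].
  have [SN|SN] := pselect (S -oo%E); first by exists -oo%E; split=> // y _; rewrite leNye.
  have val x : S x -> x = +oo%E \/ exists m : nat, x = ((m%:Z)%:E)%E.
    case=> X [pX xE]; case: (complex_lengthP X) => [[_ xN]|[m [_ _ xm]]|[_ xP]].
    - by case: SN; exists X; split=> //; rewrite -xN.
    - by right; exists m; rewrite xE.
    - by left; rewrite xE.
  have [[m Sm]|nS] := pselect (exists m : nat, S ((m%:Z)%:E)%E).
    pose p i := `[< S ((i%:Z)%:E)%E >].
    have [|k /asboolP Sk mink] := @ex_minnP p; first by exists m; apply/asboolP.
    exists ((k%:Z)%:E)%E; split=> // y Sy; case: (val y Sy) => [->|[j yj]].
      exact: leey.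
    by rewrite yj lee_fin lez_nat; apply: mink; apply/asboolP; rewrite -yj.
  exists x0; split=> // y Sy.
  case: (val y Sy) => [->|[j yj]]; first exact: leey.
  by case: nS; exists j; rewrite -yj.
case: least => [[S0 ->]|[[X [pX pdE]] lb]].
  split=> [|[X [pX _]]]; first by rewrite leNgt ltey.
  by have : S (complex_length X) by [exists X]; rewrite S0.
split=> [|[Y [pY Y0]]].
  by rewrite pdE => /complex_length_le X0; exists X.
by apply: le_trans (lb (complex_length Y) _) _; [exists Y|apply/complex_length_le].
Qed.

End RelativeDimension.

(** * Resolutions of M and of Hom(C, M) *)

Section FoxbyTransfer.
Variables (R : comPzRingType) (hR : noetherian R).
Variables (C : lmodType R) (hC : semidualizing C).
Variable K : lmodType R -> Prop.
Hypothesis Kflat : forall P, K P -> eflat P.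
Hypothesis Kiso : forall (U V : lmodType R) (f : {linear U -> V}), bijective f -> K U -> K V.
Hypothesis Kring : K R^o.
Implicit Types U V W X M N : lmodType R.

(** The common form of the classes F_C and P_C, with K the class of flat,
    respectively projective, modules. *)
Definition twist : lmodType R -> Prop :=
  fun X => exists P, K P /\ isomorphic X (tensor P C).

Lemma twist_tensor P : K P -> twist (tensor P C).
Proof. by move=> KP; exists P; split=> //; exists idfun; exists id. Qed.

Lemma ex_uncurry U X (f : {linear U -> homm C X}) :
  exists g : {linear tensor U C -> X}, forall u c, g (tens u c) = f u c.
Proof.
have bb : bilinear_map (fun u c => f u c : X).
  split=> [u a x y|c a u v]; first by rewrite linearP.
  by rewrite linearP.
exact: ex_tensor_lift bb.
Qed.

Lemma ex_curry U X (g : {linear tensor U C -> X}) :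
  exists f : {linear U -> homm C X}, forall u c, f u c = g (tens u c).
Proof.
have [f fE] := choice (fun u : U => ex_tensr C u).
have [|h hE] := @ex_linear R U (homm C X) (fun u => g \o f u).
  by move=> a u v; apply: hommP => c /=; rewrite !fE tensDl tensZl linearP.
by exists h => u c; rewrite hE /= fE.
Qed.

Lemma hom_complex_aug_eq0 M (G : augmented M) (f : homm C (G 1%N)) :
  hom_post (augm G) (cdiff (hom_complex C G) 0 f) = 0.
Proof. by apply: hommP => c; apply: augm_eq0. Qed.

Lemma tensor_cdiffE (X : chain_complex R) N i (x : X i.+1) (y : N) :
  cdiff (tensor_complex X N) i (tens x y) = tens (cdiff X i x) y.
Proof. exact: tensor_map_tens. Qed.

Definition hom_augmented M (G : augmented M) : augmented (homm C M) :=
  @Augmented R (homm C M) (hom_complex C G) (hom_post (augm G))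
    (@hom_complex_aug_eq0 M G).

(** Maps from P (x) C to G are maps from P to Hom(C, G). *)
Lemma hom_exact_adjoint P M (G : augmented M) :
  hom_exact (tensor P C) G -> hom_exact P (hom_augmented G).
Proof.
move=> [aG d0 dS]; split=> [f|f f0|i f f0].
- have [f' f'E] := ex_uncurry f; have [g' g'E] := aG f'.
  have [g gE] := ex_curry g'; exists g => y.
  by apply: hommP => c /=; rewrite gE g'E f'E.
- have [f' f'E] := ex_uncurry f; have [z|g' g'E] := d0 f'.
    have -> : 0 = (\0 : {linear tensor P C -> M}) z by [].
    apply: (@eq_tensor _ _ _ _ (augm G \o f') \0) => y c /=.
    by rewrite f'E; have /hom_eqP/(_ c) := f0 y.
  have [g gE] := ex_curry g'; exists g => y.
  by apply: hommP => c /=; rewrite gE g'E f'E.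
- have [f' f'E] := ex_uncurry f; have [z|g' g'E] := dS i f'.
    have -> : 0 = (\0 : {linear tensor P C -> G i}) z by [].
    apply: (@eq_tensor _ _ _ _ (cdiff G i \o f') \0) => y c /=.
    by rewrite f'E; have /hom_eqP/(_ c) := f0 y.
  have [g gE] := ex_curry g'; exists g => y.
  by apply: hommP => c /=; rewrite gE g'E f'E.
Qed.

(** This is the class of F if X is F (x) C, because the unit at F is an
    isomorphism. *)
Lemma twist_hom X : twist X -> K (homm C X).
Proof.
case=> P [KP [f /ex_inverse[g [fg gf]]]].
have [h [hb hE]] := hom_flat_tensor hR hC (Kflat KP).
have [h' [hh' h'h]] := ex_inverse hb.
apply: (Kiso (f := hom_post g \o h)) KP.
exists (h' \o hom_post f) => [y|phi] /=.
  by rewrite -[RHS]hh'; congr (h' _); apply: hommP => c /=; rewrite gf.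
by rewrite h'h; apply: hommP => c /=; rewrite fg.
Qed.

Lemma hom_proper M (G : augmented M) : proper_resolution twist G ->
  [/\ forall i, K (hom_augmented G i),
      forall P, K P -> hom_exact P (hom_augmented G) &
      resolves (hom_augmented G)].
Proof.
move=> /proper_resolutionE[Gt Ge].
have ex P : K P -> hom_exact P (hom_augmented G).
  by move=> KP; apply/hom_exact_adjoint/Ge/twist_tensor.
by split=> // [i|]; [apply: twist_hom|apply/hom_exact_ring/ex].
Qed.

(** Maps between modules of the form U (x) C come from maps between the U,
    because the unit at U is an isomorphism. *)
Lemma hom_flat_descend P U (f : {linear tensor P C -> tensor U C}) : K U ->
  exists g : {linear P -> U}, forall y c, f (tens y c) = tens (g y) c.
Proof.
move=> KU; have [f' f'E] := ex_curry f.
have [h [/ex_inverse[h' [hh' h'h]] hE]] := hom_flat_tensor hR hC (Kflat KU).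
exists (h' \o f') => y c /=.
by rewrite -hE h'h f'E.
Qed.

(** The inverse passage: a proper resolution Q of Hom(C, M) is tensored
    with C and augmented by evaluation. A lifting problem against P (x) C
    descends to one against P for Q. *)
Lemma tensor_proper M (Q : augmented (homm C M)) :
  (forall i, K (Q i)) -> (forall P, K P -> hom_exact P Q) ->
  exists G : augmented M, proper_resolution twist G /\
    forall i, is_zero_module (Q i) -> is_zero_module (G i).
Proof.
move=> KQ Qe; have [a aE] := ex_uncurry (augm Q).
have a0 x : a (cdiff (tensor_complex Q C) 0 x) = 0.
  have -> : 0 = (\0 : {linear tensor (Q 1%N) C -> M}) x by [].
  apply: (@eq_tensor _ _ _ _ (a \o cdiff (tensor_complex Q C) 0) \0) => y c /=.
  by rewrite tensor_cdiffE aE augm_eq0.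
exists (Augmented (acomplex := tensor_complex Q C) a0); split; last first.
  by move=> i; apply: tensor_zero.
apply/proper_resolutionE; split=> [i|Y [P [KP [e eb]]]]; first exact: twist_tensor.
apply: (hom_exact_iso eb) => {e eb Y}.
have [aQ d0 dS] := Qe P KP; split=> [f|f f0|i f f0].
- have [f' f'E] := ex_curry f; have [g gE] := aQ f'.
  exists (tensor_map g idfun) => z.
  apply: (@eq_tensor _ _ _ _ (a \o tensor_map g idfun) f) => y c /=.
  by rewrite tensor_lift_tens aE gE f'E.
- have [f' f'E] := @hom_flat_descend P (Q 0%N) f (KQ 0%N).
  have [y|g gE] := d0 f'.
    by apply: hommP => c; rewrite -aE -f'E; apply: f0.
  exists (tensor_map g idfun) => z.
  apply: (@eq_tensor _ _ _ _ (cdiff (tensor_complex Q C) 0 \o tensor_map g idfun) f).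
  by move=> y c /=; rewrite tensor_lift_tens tensor_cdiffE gE f'E.
- have [f' f'E] := @hom_flat_descend P (Q i.+1) f (KQ i.+1).
  have [y|g gE] := dS i f'.
    apply: (flat_unit_inj hR hC (Kflat (KQ i))) => c.
    by rewrite -tensor_cdiffE -f'E; apply: f0.
  exists (tensor_map g idfun) => z.
  apply: (@eq_tensor _ _ _ _ (cdiff (tensor_complex Q C) i.+1 \o tensor_map g idfun) f).
  by move=> y c /=; rewrite tensor_lift_tens tensor_cdiffE gE f'E.
Qed.

End FoxbyTransfer.

(** * Truncation of proper resolutions *)

Section Truncation.
Variables (R : comPzRingType) (K : lmodType R -> Prop).
Hypothesis Kiso : forall (U V : lmodType R) (f : {linear U -> V}), bijective f -> K U -> K V.
Hypothesis Kzero : forall U, is_zero_module U -> K U.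

Variables (M : lmodType R) (Q : augmented M) (n : nat).

(** Quotients of the terms of Q are used in every degree, by zero below n
    and by everything above n, so that one definition of the differentials
    serves all degrees. *)
Definition trunc_pred i (x : Q i) : Prop :=
  if (n < i)%N then True else if i == n then exists u, cdiff Q i u = x else x = 0.

Lemma trunc_submodule i : submodule (@trunc_pred i).
Proof.
rewrite /trunc_pred; case: ltnP => _; first by split.
case: eqP => _; first exact: image_submodule.
by split=> // a x y -> ->; rewrite scaler0 addr0.
Qed.

(** In degree n the truncation is the cokernel of the differential, which
    embeds into the term below; so exactness in degree n is automatic,
    while lifts in lower degrees are those of Q, projected. *)
Lemma truncate : (forall i, K (Q i)) -> resolves Q ->
    (forall P, K P -> hom_exact P Q) ->
    (forall (W : lmodType R) (p : {linear Q n -> W}), onto p -> exact_at (cdiff Q n) p -> K W) ->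
  exists X : augmented M, [/\ forall i, K (X i),
    forall P, K P -> hom_exact P X & forall i, (n < i)%N -> is_zero_module (X i)].
Proof.
move=> KQ [aQ a0 dS] Qe KW.
have [W pW] := choice (fun i => ex_quot (@trunc_submodule i)).
pose p i := projT1 (cid (pW i)).
have pP i : onto (p i) /\ forall v, p i v = 0 <-> trunc_pred v by exact: projT2 (cid (pW i)).
have pon i := (pP i).1; have p0 i := (pP i).2.
have dker i u : p i.+1 u = 0 -> p i (cdiff Q i u) = 0.
  move/p0; rewrite /trunc_pred => pu; apply/p0; rewrite /trunc_pred.
  have [//|] := ltnP n i; rewrite leq_eqVlt => /orP[/eqP ni|ni].
    by case: eqP => [_|/(_ ni)//]; exists u.
  rewrite (ltn_eqF ni); move: pu; rewrite ltnNge ni /=.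
  by case: eqP => _; [case=> v <-; rewrite cdiff_eq0|move=> ->; rewrite linear0].
have dW i := cid (@factor_surj _ _ _ _ (p i.+1) (p i \o cdiff Q i) (pon i.+1) (@dker i)).
pose d i := projT1 (dW i).
have dE i u : d i (p i.+1 u) = p i (cdiff Q i u) by exact: (projT2 (dW i)).
have dd i x : d i (d i.+1 x) = 0.
  by have [u <-] := pon i.+2 x; rewrite !dE cdiff_eq0 linear0.
have [u pu0|a aE] := factor_surj (f := augm Q) (pon 0%N).
  move/p0: pu0; rewrite /trunc_pred ltn0.
  by case: eqP => _; [case=> v <-; rewrite augm_eq0|move=> ->; rewrite linear0].
have ad x : a (d 0%N x) = 0.
  by have [u <-] := pon 1%N x; rewrite dE aE augm_eq0.
pose X := @Augmented R M (ChainComplex dd) a ad.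
have Wzero i : (n < i)%N -> is_zero_module (W i).
  by move=> ni x; have [u <-] := pon i x; apply/p0; rewrite /trunc_pred ni.
have pinj i : (i < n)%N -> injective (p i).
  move=> ni; apply: linear_inj0 => x /p0; rewrite /trunc_pred.
  by rewrite ltnNge (ltnW ni) (ltn_eqF ni).
have pbij i : (i < n)%N -> bijective (p i).
  move=> ni; have [g gE] := choice (pon i); exists g => // x.
  by apply: (pinj i ni); rewrite gE.
have pn x : p n x = 0 <-> exists u, cdiff Q n u = x.
  by rewrite p0 /trunc_pred ltnn eqxx.
have pim i : i = n -> forall x, (exists u, cdiff Q i u = x) -> p i x = 0.
  by move=> -> x /pn.
exists X; split=> //=.
  move=> i; have [ni|] := ltnP i n; first exact: Kiso (pbij i ni) (KQ i).
  rewrite leq_eqVlt => /orP[/eqP ni|ni]; last exact/Kzero/Wzero.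
  rewrite -ni; exact: KW (pon n) pn.
move=> P KP; have [la l0 lS] := Qe P KP; split=> /= [f|f f0|i f f0].
- have [g gE] := la f; exists (p 0%N \o g) => y /=.
  by rewrite aE gE.
- have [n0|n0] := posnP n.
    exists \0 => y; rewrite linear0; have := f0 y.
    have [x <-] := pon 0%N (f y); rewrite aE => /a0 xu.
    exact/esym/pim.
  have [p' [pp' p'p]] := ex_inverse (pbij 0%N n0).
  have [y|g gE] := l0 (p' \o f).
    by rewrite /= -aE p'p.
  by exists (p 1%N \o g) => y /=; rewrite dE gE /= p'p.
- have [ni|] := ltnP i.+1 n; last rewrite leq_eqVlt => /orP[/eqP ni|ni].
  + have [p' [pp' p'p]] := ex_inverse (pbij i.+1 ni).
    have [y|g gE] := lS i (p' \o f).
      by apply: (pinj i (ltnW ni)); rewrite -dE /= p'p linear0.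
    by exists (p i.+2 \o g) => y /=; rewrite dE gE /= p'p.
  + exists \0 => y; rewrite linear0; have := f0 y.
    have [x <-] := pon i.+1 (f y); rewrite dE => px.
    have /dS xu : cdiff Q i x = 0 by apply: (pinj i); rewrite ?ni// linear0.
    exact/esym/pim.
  + by exists \0 => y; rewrite linear0; apply/esym/Wzero.
Qed.

End Truncation.

(** * Vanishing of relative Tor and purity of boundaries *)

Section TorTrivial.
Variable R : comPzRingType.
Implicit Types U V W X M N : lmodType R.

Lemma comb_pairl (L A : finType) V (f : L -> R) (F : L * A -> V) (a : A) :
  \sum_p ((a == p.2)%:R * f p.1) *: F p = \sum_l f l *: F (l, a).
Proof.
have -> : \sum_p ((a == p.2)%:R * f p.1) *: F p =
          \sum_l \sum_b ((a == b)%:R * f l) *: F (l, b).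
  by rewrite pair_bigA; apply: eq_bigr => -[].
apply: eq_bigr => l _; rewrite -(delta_comb (fun b => f l *: F (l, b)) a).
by apply: eq_bigr => b _; rewrite scalerA.
Qed.

Lemma comb_pairr (L A : finType) V (f : A -> R) (F : L * A -> V) (l : L) :
  \sum_p ((l == p.1)%:R * f p.2) *: F p = \sum_a f a *: F (l, a).
Proof.
have -> : \sum_p ((l == p.1)%:R * f p.2) *: F p =
          \sum_l' \sum_b ((l == l')%:R * f b) *: F (l', b).
  by rewrite pair_bigA; apply: eq_bigr => -[].
rewrite -(delta_comb (fun l => \sum_a f a *: F (l, a)) l); apply: eq_bigr => l' _.
by rewrite scaler_sumr; apply: eq_bigr => b _; rewrite scalerA.
Qed.

(** Vanishing of the homology of X (x) N in degree n+1, for N presented by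
    rel, expressed by elements of X: a chain whose boundary vanishes in X
    (x) N is a boundary there. This form makes sense for a system of any
    shape, and can be moved between complexes without tensor products. *)
Definition tor_trivial (X : chain_complex R) n (L K : finType) (rel : L -> K -> R) :=
  forall (z : L -> X n) (g : K -> X n.+1),
    (forall k, cdiff X n (g k) = \sum_l rel l k *: z l) ->
    exists (g' : L -> X n.+1) (h : K -> X n.+2),
      forall k, g k = \sum_l rel l k *: g' l + cdiff X n.+1 (h k).

Lemma Tor_trivial M (G : augmented M) n N (L K : finType) (e : K -> N)
    (rel : L -> K -> R) :
  presents e rel -> is_zero_module (Tor_of G n.+1 N) -> tor_trivial G n rel.
Proof.
move=> pr /Tor_eq0 T0 z g dg; have [ge e0 _] := pr.
have [|u uE] := T0 (\sum_k tens (g k) (e k)).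
  rewrite linear_sum; under eq_bigr do rewrite tensor_map_tens /= dg tens_combl.
  rewrite exchange_big big1// => l _.
  under eq_bigr do rewrite -tensZr.
  have [f fE] := ex_tensr N (z l); under eq_bigr do rewrite -fE.
  by rewrite -linear_sum e0 linear0.
have [h hE] := tens_gens ge u.
have [|g' g'E] := tensor_vanish_pres (x := fun k => g k - cdiff G n.+1 (h k)) pr.
  under eq_bigr do rewrite tensDl tensNl.
  rewrite big_split /= sumrN -uE hE linear_sum.
  by under eq_bigr do rewrite tensor_map_tens /=; rewrite subrr.
by exists g', h => k; rewrite -g'E subrK.
Qed.

Lemma ex_presented_module (L K : finType) (rel : L -> K -> R) :
  exists (N : lmodType R) (e : K -> N), presents e rel.
Proof.
have [f fE] := ex_comb (fun l => rel l : K -> R^o).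
have [N [p [ps ex]]] := ex_cokernel f.
have pE (c : K -> R^o) : \sum_k c k *: p (fun b => (b == k)%:R) = p c.
  have [d dE] := gens_free c; rewrite [in RHS]dE linear_comb.
  apply: eq_bigr => k _; congr (_ *: _).
  rewrite [in LHS]dE fct_sumE.
  transitivity (\sum_a d a * (k == a)%:R) => //.
  rewrite (bigD1 k)//= eqxx mulr1 big1 ?addr0// => b' /negPf.
  by rewrite eq_sym => ->; rewrite mulr0.
exists N, (fun k => p (fun b => (b == k)%:R)); split.
- by move=> x; have [c <-] := ps x; exists c; rewrite pE.
- move=> l; rewrite (pE (rel l)); apply/ex; exists (fun a => (a == l)%:R).
  by rewrite fE comb_delta.
- move=> c; rewrite (pE c) => /ex[z zE]; exists z => k.
  by rewrite -zE fE fct_sumE.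
Qed.

(** The boundaries of an exact complex of flat modules are pure. The
    solution z of the system need not consist of boundaries, but its own
    boundary solves the homogeneous system one degree lower. By flatness it
    is a combination of relations over R, and by induction the combination
    can be chosen with coefficients that are boundaries; their preimages
    correct z. *)
Lemma exact_flat_pure (E : nat -> lmodType R) (d : forall i, {linear E i.+1 -> E i}) :
  (forall i, eflat (E i)) -> onto (d 0%N) -> (forall i x, d i (d i.+1 x) = 0) ->
  (forall i x, d i x = 0 -> exists u, d i.+1 u = x) ->
  forall i (A B : finType) (r : A -> B -> R) (z : A -> E i) (g : B -> E i.+1),
    (forall b, d i (g b) = \sum_a r a b *: z a) ->
    exists z' : A -> E i.+1, forall b, d i (g b) = \sum_a r a b *: d i (z' a).
Proof.
move=> fE d0 dd ex; elim=> [|i IHi] A B r z g dg.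
  have [z' z'E] := choice (fun a => d0 (z a)); exists z' => b.
  by rewrite dg; apply: eq_bigr => a _; rewrite z'E.
have [b|L [k [y [zy rk]]]] := fE i A B (fun b a => r a b) (fun a => d i (z a)).
  by rewrite -linear_comb -dg dd.
have [a|y' y'E] := IHi L A (fun l a => k a l) y z; first exact: zy.
have /choice[z' z'E] a : exists u, d i.+1 u = z a - \sum_l k a l *: y' l.
  by apply: ex; rewrite linearB linear_comb y'E subrr.
exists z' => b; under eq_bigr do rewrite z'E.
rewrite sumB_comb dg scale_comb [X in _ - X]big1 ?subr0// => l _.
by rewrite rk scale0r.
Qed.

Definition chain_map M (Q Q' : augmented M) (al : forall i, {linear Q i -> Q' i}) :=
  (forall x, augm Q' (al 0%N x) = augm Q x) /\
  forall i x, cdiff Q' i (al i.+1 x) = al i (cdiff Q i x).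

(** Consecutive components are built together with the square relating
    them, so that each step of the recursion only needs the lifting
    property of Q'. *)
Lemma ex_chain_map M (Q Q' : augmented M) :
  (forall i, hom_exact (Q i) Q') -> exists al, @chain_map M Q Q' al.
Proof.
move=> ex; have [aQ' _ _] := ex 0%N.
have [a0 a0E] := aQ' (augm Q).
have [_ d0 _] := ex 1%N.
have [x|a1 a1E] := d0 (a0 \o cdiff Q 0); first by rewrite /= a0E augm_eq0.
pose square i := {p : {linear Q i -> Q' i} * {linear Q i.+1 -> Q' i.+1} |
  forall x, cdiff Q' i (p.2 x) = p.1 (cdiff Q i x)}.
have nextP i (s : square i) : exists f : {linear Q i.+2 -> Q' i.+2},
    forall x, cdiff Q' i.+1 (f x) = (sval s).2 (cdiff Q i.+1 x).
  have [_ _ dS] := ex i.+2.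
  have [x|f fE] := dS i ((sval s).2 \o cdiff Q i.+1); last by exists f.
  by rewrite /= (svalP s) cdiff_eq0 linear0.
pose next i (s : square i) : square i.+1 :=
  exist _ ((sval s).2, projT1 (cid (nextP i s))) (projT2 (cid (nextP i s))).
pose start : square 0%N := exist _ (a0, a1) a1E.
pose fix t i : square i := if i is j.+1 then next j (t j) else start.
exists (fun i => (sval (t i)).1); split=> [x|i x]; first exact: a0E.
exact: (svalP (t i)).
Qed.

(** The mapping cone of the comparison map is an exact complex of flat
    modules, so its boundaries are pure. A chain g of Q whose boundary is
    divisible by rel, together with the witness for its image in Q', is
    such a chain in the cone; the first component of a correction in the
    cone corrects g in Q. *)
Lemma tor_trivial_compare M (Q Q' : augmented M) n (L K : finType)
    (rel : L -> K -> R) :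
  (forall i, eflat (Q i)) -> (forall i, eflat (Q' i)) ->
  resolves Q -> resolves Q' -> (exists al, @chain_map M Q Q' al) ->
  tor_trivial Q' n rel -> tor_trivial Q n rel.
Proof.
move=> fQ fQ' [aQ a0 aS] [aQ' a0' aS'] [al [ala ald]] T z g dg.
(* The cone, with the augmentations cancelled against each other. *)
pose E i : lmodType R := if i is j.+1 then (Q j * Q' j.+1)%type else Q' 0%N.
pose d0 (x : E 1%N) : E 0%N := cdiff Q' 0 x.2 + al 0%N x.1.
pose dS i (x : E i.+2) : E i.+1 := (- cdiff Q i x.1, cdiff Q' i.+1 x.2 + al i.+1 x.1).
have d0l : linear d0.
  by move=> a x y; rewrite /d0 !linearP /= scalerDr addrACA.
have dSl i : linear (@dS i).
  move=> a x y; congr pair; rewrite /= !linearP /=.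
    by [].
  by rewrite scalerDr addrACA.
have dE i : exists d : {linear E i.+1 -> E i},
    d =1 match i return E i.+1 -> E i with 0 => d0 | j.+1 => @dS j end.
  by case: i => [|i]; [apply: ex_linear d0l|apply: ex_linear (dSl i)].
pose d i := projT1 (cid (dE i)).
have d0E x : d 0%N x = d0 x by exact: (projT2 (cid (dE 0%N))).
have dSE i x : d i.+1 x = dS i x by exact: (projT2 (cid (dE i.+1))).
have fE i : eflat (E i) by case: i => [|i] //=; apply: eflat_pair.
have don : onto (d 0%N).
  move=> q; have [f af] := aQ (augm Q' q).
  have [|u uE] := a0' (q - al 0%N f); first by rewrite linearB ala af subrr.
  by exists (f, u); rewrite d0E /d0 /= uE subrK.
have dd i x : d i (d i.+1 x) = 0.
  case: i x => [|i] x; rewrite ?d0E !dSE.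
    by rewrite /d0 /dS /= linearD cdiff_eq0 add0r linearN ald subrr.
  congr pair; rewrite /= linearN ?cdiff_eq0 ?oppr0//.
  by rewrite linearD cdiff_eq0 add0r ald subrr.
have ex i x : d i x = 0 -> exists u, d i.+1 u = x.
  have fin j (f : Q j.+1) (f' : Q j) (q : Q' j.+1) : cdiff Q j f = f' ->
      cdiff Q' j q + al j f' = 0 -> exists u, d j.+1 u = (f', q).
    move=> ff' qf'.
    have [|u uE] := aS' j (q + al j.+1 f); first by rewrite linearD ald ff'.
    exists (- f, u); rewrite dSE /dS /= !linearN opprK ff'.
    by rewrite uE addrK.
  case: i x => [|i] [f q]; rewrite ?d0E ?dSE => dx.
    have [|f' f'E] := a0 f; last exact: fin f'E dx.
    have := congr1 (augm Q') dx.
    by rewrite /d0 /= linearD augm_eq0 add0r ala linear0.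
  case: dx => df dq; have [|f' f'E] := aS i f; last exact: fin f'E dq.
  by rewrite -[LHS]opprK df oppr0.
have [k|q' [h' h'E]] := T (fun l => al n (z l)) (fun k => al n.+1 (g k)).
  by rewrite ald dg linear_comb.
(* The sign of h' makes the second component of the boundary of ga equal to
   the combination of the q' l. *)
pose ga k : E n.+2 := (g k, - h' k).
pose ze l : E n.+1 := (- z l, q' l).
have [k|ze' ze'E] := exact_flat_pure fE don dd ex (z := ze) (g := ga) (r := rel).
  rewrite dSE /dS /= dg h'E.
  have [p1 p1E] := @ex_linear R (E n.+1) (Q n) fst (fun _ _ _ => erefl).
  have [p2 p2E] := @ex_linear R (E n.+1) (Q' n.+1) snd (fun _ _ _ => erefl).
  have -> : \sum_l rel l k *: ze l =
    (p1 (\sum_l rel l k *: ze l), p2 (\sum_l rel l k *: ze l)).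
    by rewrite p1E p2E; case: (\sum_l _).
  rewrite !linear_comb; congr pair.
    by apply: eq_bigr => l _; rewrite p1E.
  rewrite linearN addrC addrK.
  by apply: eq_bigr => l _; rewrite p2E.
have /choice[e eE] k : exists u, d n.+2 u = ga k - \sum_l rel l k *: ze' l.
  by apply: ex; rewrite linearB linear_comb ze'E subrr.
exists (fun l => (ze' l).1), (fun k => - (e k).1) => k.
have [p1 p1E] := @ex_linear R (E n.+2) (Q n.+1) fst (fun _ _ _ => erefl).
have := congr1 p1 (eE k); rewrite linearB linear_comb dSE !p1E /= => eq1.
rewrite linearN eq1 addrC.
under [X in _ + X]eq_bigr do rewrite -p1E.
by rewrite subrK.
Qed.

(** If the criterion holds for all systems, the boundaries in degree n are
    pure in Q n, and a pure quotient of a flat module is flat. *)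
Lemma tor_trivial_flat_quot M (Q : augmented M) n :
  eflat (Q n) ->
  (forall (L K : finType) (rel : L -> K -> R), tor_trivial Q n rel) ->
  forall W (p : {linear Q n -> W}), onto p -> exact_at (cdiff Q n) p -> eflat W.
Proof.
move=> fQ T W p ps ex.
have [I [i [ii iE]]] := ex_sub (image_submodule (cdiff Q n)).
have Ib x : exists u, i u = cdiff Q n x by apply/iE; exists x.
apply: (eflat_pure_quot (i := i) (p := p)) fQ; first split=> //.
  by move=> v; rewrite ex iE.
move=> A B r u x rx.
have /choice[g gE] b : exists y, cdiff Q n y = i (u b) by apply/iE; exists (u b).
have [b|g' [h hE]] := T A B (fun a b => r b a) x g; first by rewrite gE rx.
have [x' x'E] := choice (fun a => Ib (g' a)).
exists x' => b; apply: ii; rewrite linear_comb -gE hE linearD cdiff_eq0 addr0.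
by rewrite linear_comb; apply: eq_bigr => a _; rewrite x'E.
Qed.

End TorTrivial.

Section HomTorTrivial.
Variables (R : comPzRingType) (C : lmodType R).
Variables (A Lc : finType) (c : A -> C) (rho : Lc -> A -> R).
Hypothesis pr : presents c rho.

(** The system rel for elements of Hom(C, G), written for their values on
    the generators of C: to the equations of rel at each generator are
    added the relations of C, which say that the values define a
    homomorphism. *)
Definition hom_system (L K : finType) (rel : L -> K -> R)
    (u : L * A) (e : K * A + L * Lc) : R :=
  match e with
  | inl ka => (ka.2 == u.2)%:R * rel u.1 ka.1
  | inr lm => (lm.1 == u.1)%:R * rho lm.2 u.2
  end.

(** A solution of the larger system in G has boundaries that respect the
    relations of C, hence are the values of maps from C. These maps are
    boundaries in Hom(C, G), because that complex is exact, and their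
    preimages solve rel. *)
Lemma hom_tor_trivial M (G : augmented M) n (L K : finType) (rel : L -> K -> R) :
  resolves (hom_augmented C G) ->
  tor_trivial G n (hom_system rel) -> tor_trivial (hom_augmented C G) n rel.
Proof.
move=> [_ h0 hS] T z g dg; have [gc rho0 _] := pr.
(* In degree 0 the cycles are the elements killed by the augmentation. *)
have lift (w : homm C (G n)) : (forall a, exists u, w (c a) = cdiff G n u) ->
    exists g'', cdiff (hom_augmented C G) n g'' = w.
  clear T z g dg; case: n w => [|n] w wE.
    apply: h0; apply: hommP; apply: (gens_linear_eq gc) => a /=.
    by have [u ->] := wE a; rewrite augm_eq0.
  apply: hS; apply: hommP; apply: (gens_linear_eq gc) => a /=.
  by have [u ->] := wE a; rewrite cdiff_eq0.
have dgE k a : cdiff G n (g k (c a)) = \sum_l rel l k *: z l (c a).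
  have [ev evE] := @ex_linear R (homm C (G n)) (G n) (fun f => f (c a))
    (fun _ _ _ => erefl).
  transitivity (ev (cdiff (hom_augmented C G) n (g k))); first by rewrite evE.
  by rewrite dg linear_comb; apply: eq_bigr => l _; rewrite evE.
have [e|g' [h hE]] := T (fun u => z u.1 (c u.2))
    (fun e => match e with inl ka => g ka.1 (c ka.2) | inr _ => 0 end).
  case: e => [[k a]|[l m]] /=.
    by rewrite dgE (comb_pairl (fun l => rel l k) (fun u => z u.1 (c u.2)) a).
  rewrite linear0 (comb_pairr (rho m) (fun u => z u.1 (c u.2)) l) /=.
  by rewrite -linear_comb rho0 linear0.
have gE k a : g k (c a) = \sum_l rel l k *: g' (l, a) + cdiff G n.+1 (h (inl (k, a))).
  have := hE (inl (k, a)); rewrite /= => ->; congr (_ + _).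
  exact: (comb_pairl (fun l => rel l k)).
have rg l m : \sum_a rho m a *: g' (l, a) = - cdiff G n.+1 (h (inr (l, m))).
  have := hE (inr (l, m)); rewrite /= comb_pairr => /esym/eqP.
  by rewrite addr_eq0 => /eqP.
have /choice[w wE] l : exists w : {linear C -> G n}, forall a, w (c a) = cdiff G n (g' (l, a)).
  apply: (ex_presented_map pr) => m.
  by rewrite -linear_comb rg linearN cdiff_eq0 oppr0.
have /choice[g'' g''E] l : exists g'', cdiff (hom_augmented C G) n g'' = w l.
  by apply: lift => a; exists (g' (l, a)).
have /choice[h' h'E] k : exists u, cdiff (hom_augmented C G) n.+1 u =
    g k - \sum_l rel l k *: g'' l.
  apply: hS; rewrite linearB linear_comb; apply/eqP; rewrite subr_eq0; apply/eqP.
  apply: hommP; apply: (gens_linear_eq gc) => a.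
  have [ev evE] := @ex_linear R (homm C (G n)) (G n) (fun f => f (c a))
    (fun _ _ _ => erefl).
  rewrite -[RHS]evE linear_comb.
  transitivity (cdiff G n (g k (c a))) => //.
  rewrite gE linearD cdiff_eq0 addr0 linear_comb; apply: eq_bigr => l _.
  by rewrite evE g''E wE.
by exists g'', h' => k; rewrite h'E addrC subrK.
Qed.

End HomTorTrivial.

(** * Maximal ideals and splitting of submodules of free modules *)

Section MaximalIdeals.
Variable R : comPzRingType.

(** Zorn's lemma is applied to the sets whose union with I is a proper
    ideal, so that the empty chain is harmless. *)
Lemma ex_maximal_ideal (I : R^o -> Prop) : submodule I -> ~ I 1 ->
  exists m : ideal R, maximal_ideal m /\ forall x, I x -> x \in m.
Proof.
move=> [I0 ID] I1.
pose J (A : set R^o) (x : R^o) := I x \/ A x.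
pose P (A : set R^o) := submodule (J A) /\ ~ J A 1.
have [|A [[AP A1] Amax]] := @Zorn_bigcup R^o P.
  move=> F FP totF; split; last first.
    case=> [//|[X FX X1]]; have [_] := FP _ FX; apply; by right.
  have inF X a x y : F X -> J X x -> J X y -> J (\bigcup_(X in F) X)%classic (a *: x + y).
    move=> FX Jx Jy; have [[_ D] _] := FP _ FX.
    by case: (D a x y Jx Jy) => [?|?]; [left|right; exists X].
  split=> [|a x y]; first by left.
  case=> [Ix|[X FX Xx]] [Iy|[Y FY Yy]].
  - by left; apply: ID.
  - by apply: (inF Y) => //; [left|right].
  - by apply: (inF X) => //; [right|left].
  - have [XY|YX] := totF X Y FX FY.
      by apply: (inF Y) => //; right => //; apply: XY.
    by apply: (inF X) => //; right => //; apply: YX.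
pose m : ideal R := carve_pred AP.
have mE x : x \in m <-> J A x by apply: carve_predE.
exists m; split; last by move=> x Ix; apply/mE; left.
split=> [|J' mJ' J'1 x xJ'].
  by apply/negP => /mE.
apply: contrapT => xm.
have IJ' y : J (fun y => y \in J') y -> y \in J'.
  by case=> // Iy; apply/mJ'/mE; left.
apply: (Amax (fun y => y \in J')); split.
- by move=> y Ay; apply/mJ'/mE; right.
- by move=> /(_ x xJ') Ax; apply: xm; apply/mE; right.
- split=> [|a y z /IJ' yJ /IJ' zJ]; first by right; apply: rpred0.
  by right; apply: rpredD => //; apply: rpredZ.
- by move/IJ'; apply/negP.
Qed.

Section Residue.
Variables (m : ideal R) (hm : maximal_ideal m).
Implicit Types (a b x y : R).

Lemma maximal1 : (1 : R) \notin m. Proof. by case: hm. Qed.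

Lemma idealMl a x : x \in m -> a * x \in m.
Proof. by move=> xm; have := @rpredZ _ _ m a x xm. Qed.

Lemma maximal_inv a : a \notin m -> exists u, 1 - u * a \in m.
Proof.
move=> am; pose J (x : R^o) := exists u, x - u * a \in m.
have JP : @submodule R R^o J.
  split=> [|c x y [u xu] [v yv]]; first by exists 0; rewrite mul0r subr0; apply: rpred0.
  exists (c * u + v).
  have -> : c *: x + y - (c * u + v) * a = c * (x - u * a) + (y - v * a).
    by rewrite mulrDl opprD mulrBr mulrA addrACA.
  by apply: rpredD => //; apply: idealMl.
have [[u]|nJ] := pselect (J 1); first by exists u.
have mJ : {subset m <= carve_pred JP}.
  by move=> x xm; apply/(carve_predE JP); exists 0; rewrite mul0r subr0.
case/negP: am; apply: (hm.2 (carve_pred JP) mJ).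
  by apply/negP => /(carve_predE JP).
by apply/(carve_predE JP); exists 1; rewrite mul1r subrr; apply: rpred0.
Qed.

Lemma maximal_prime a b : a \notin m -> b \notin m -> a * b \notin m.
Proof.
move=> /maximal_inv[u um] bm; apply: contra bm => abm.
have -> : b = b * (1 - u * a) + u * (a * b).
  by rewrite mulrBr mulr1 (mulrC b) -mulrA subrK.
by apply: rpredD; apply: idealMl.
Qed.

Definition ideal_span (V : lmodType R) (P : V -> Prop) (x : V) :=
  exists (A : finType) (a : A -> R) (k : A -> V),
    [/\ forall i, a i \in m, forall i, P (k i) & x = \sum_i a i *: k i].

(** Generation after inverting b, which replaces localisation at the
    maximal ideal. *)
Definition spans_up_to (V : lmodType R) (P : V -> Prop) d (x : 'I_d -> V) b :=
  forall z, P z -> exists c : 'I_d -> R, b *: z = \sum_i c i *: x i.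

(** A relation whose first coefficient is invertible modulo m expresses
    that coefficient times the first generator by the others. *)
Lemma spans_drop (V : lmodType R) (P : V -> Prop) d (x : 'I_d.+1 -> V) b (c : 'I_d.+1 -> R) :
  b \notin m -> spans_up_to P x b ->
  c ord0 \notin m -> \sum_i c i *: x i = 0 ->
  exists b', b' \notin m /\ spans_up_to P (fun i => x (lift ord0 i)) b'.
Proof.
move=> bm sp cm c0; exists (c ord0 * b); split; first exact: maximal_prime.
move=> z /sp[e eE]; exists (fun i => c ord0 * e (lift ord0 i) - e ord0 * c (lift ord0 i)).
under eq_bigr do rewrite scalerBl -!scalerA.
rewrite sumrB -!scaler_sumr.
move: c0; rewrite big_ord_recl => /eqP; rewrite addr_eq0 => /eqP c0.
move: eE; rewrite big_ord_recl => eE.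
have -> : \sum_i c (lift ord0 i) *: x (lift ord0 i) = - (c ord0 *: x ord0).
  by rewrite c0 opprK.
rewrite scalerN opprK (scalerA (e ord0)) (mulrC (e ord0)).
by rewrite -!scalerA -scalerDr addrC -eE.
Qed.

Lemma ideal_sum (A : finType) (a c : A -> R) :
  (forall i, a i \in m) -> \sum_i a i * c i \in m.
Proof.
by move=> am; apply: rpred_sum => i _; rewrite mulrC; apply: idealMl.
Qed.

(** Nakayama's lemma for one generator: x_0 in mP yields (b - a) x_0 in the
    span of the others with a in m, and b - a is still outside m. *)
Lemma spans_nakayama (V : lmodType R) (P : V -> Prop) d (x : 'I_d.+1 -> V) b :
  b \notin m -> spans_up_to P x b -> ideal_span P (x ord0) ->
  exists b', b' \notin m /\ spans_up_to P (fun i => x (lift ord0 i)) b'.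
Proof.
move=> bm sp [A [a [k [am Pk xE]]]].
have [c cE] := choice (fun t => sp _ (Pk t)).
have bx : b *: x ord0 = \sum_i (\sum_t a t * c t i) *: x i.
  rewrite -scale_comb xE scaler_sumr; apply: eq_bigr => t _.
  by rewrite -cE !scalerA mulrC.
apply: (spans_drop (c := fun i => (i == ord0)%:R * b - \sum_t a t * c t i) bm sp).
  rewrite eqxx mul1r; apply: contra bm => bcm.
  rewrite -[b](subrK (\sum_t a t * c t ord0)); apply: rpredD => //.
  exact: ideal_sum.
under eq_bigr do rewrite scalerBl -scalerA.
by rewrite sumrB -bx (comb_delta (fun i => b *: x i)) subrr.
Qed.

Section LocalSplitting.
Variable J : finType.
Let F : lmodType R := (J -> R^o).

(** Local splitting of K in a free module F when K meets mF in mK, without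
    localising: rho is a retraction of F onto K up to the factor a.
    Induction on the number of generators of K after inverting an element
    outside m. If some generator has a coordinate outside m, that
    coordinate splits off the generator, and the elements of K on which the
    coordinate vanishes satisfy the same hypotheses with one generator
    fewer. Otherwise all generators lie in mF, hence in mK, and Nakayama
    removes one. *)
Lemma local_splitting d (K : F -> Prop) b (x : 'I_d -> F) :
  submodule K -> b \notin m -> (forall i, K (x i)) -> spans_up_to K x b ->
  (forall z, K z -> (forall j, z j \in m) -> ideal_span K z) ->
  exists a (rho : {linear F -> F}),
    [/\ a \notin m, forall z, K (rho z) & forall z, K z -> rho z = a *: z].
Proof.
elim: d K b x => [|d IHd] K b x KP bm Kx sp Km.
  exists b, \0; split=> // [z|z /sp[c]]; first by case: KP.
  by rewrite big_ord0.
have [[i [j xij]]|nx] := pselect (exists i j, x i j \notin m); last first.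
  have [|b' [b'm sp']] := spans_nakayama bm sp.
    apply: Km => // j; apply: contrapT => /negP xj.
    by apply: nx; exists ord0, j.
  by apply: (IHd K b' (fun i => x (lift ord0 i))).
set dl := x i j in xij.
have KB u v a c : K u -> K v -> K (a *: u - c *: v).
  move=> Ku Kv; rewrite -scaleNr; apply: KP.2 => //; rewrite -[_ *: v]addr0.
  by apply: KP.2 => //; case: KP.
pose K' (z : F) := K z /\ z j = 0.
have cut z : K z -> K' (dl *: z - z j *: x i).
  move=> Kz; split; first exact: KB.
  transitivity (dl * z j - z j * dl) => //.
  by rewrite mulrC subrr.
have K'P : submodule K'.
  split=> [|a u v [Ku uj] [Kv vj]]; first by split; first by case: KP.
  split; first exact: KP.2.
  by transitivity (a * u j + v j) => //; rewrite uj vj mulr0 addr0.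
have sp' : spans_up_to K' (fun l => dl *: x (lift i l) - x (lift i l) j *: x i) (dl * b).
  move=> z [Kz zj]; have [c cE] := sp z Kz; exists (c \o lift i) => /=.
  move: cE; rewrite (bigD1_ord i)//= => cE.
  under eq_bigr do rewrite scalerBr.
  rewrite sumrB.
  have -> : \sum_l c (lift i l) *: (dl *: x (lift i l)) =
            dl *: (b *: z - c i *: x i).
    rewrite cE addrAC subrr add0r scaler_sumr; apply: eq_bigr => l _.
    by rewrite !scalerA mulrC.
  have -> : \sum_l c (lift i l) *: (x (lift i l) j *: x i) = - (c i * dl) *: x i.
    under eq_bigr do rewrite scalerA.
    rewrite -scaler_suml; congr (_ *: _).
    have := congr1 (fun u : F => u j) cE.
    rewrite -[LHS]/(b * z j) zj mulr0 => /esym/eqP.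
    rewrite -[(_ + _) j]/(c i * dl + (\sum_l c (lift i l) *: x (lift i l)) j).
    by rewrite fct_sumE addrC addr_eq0 => /eqP xj; apply: xj.
  by rewrite scaleNr opprK scalerBr !scalerA (mulrC (c i)) subrK.
have [l|z [Kz zj] zm|a [rho [am Krho rhoE]]] := IHd K' (dl * b) _ K'P (maximal_prime xij bm) _ sp'.
- by apply: cut.
- have [A [a [k [am Kk zE]]]] := Km z Kz zm.
  have [u um] := maximal_inv xij.
  exists (A + unit)%type,
    (fun s => match s with inl t => u * a t | inr _ => 1 - u * dl end),
    (fun s => match s with inl t => dl *: k t - k t j *: x i | inr _ => z end).
  split=> [[t|_]|[t|_]|] //=; first exact: idealMl.
    exact: cut.
  rewrite big_sumType /= (big_pred1 tt)//.
  have dz : dl *: z = \sum_t a t *: (dl *: k t - k t j *: x i).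
    under eq_bigr do rewrite scalerBr !scalerA.
    rewrite sumrB -scaler_suml.
    have -> : \sum_t a t * k t j = 0 by apply: etrans zj; rewrite zE fct_sumE.
    rewrite scale0r subr0 zE scaler_sumr; apply: eq_bigr => t _.
    by rewrite scalerA mulrC.
  under eq_bigr do rewrite -scalerA.
  by rewrite -scaler_sumr -dz scalerA -scalerDl addrC subrK scale1r.
have [|rh rhE] := @ex_linear R F F
    (fun z => rho (dl *: z - z j *: x i) + (a * z j) *: x i).
  move=> e u v.
  have -> : (e *: u + v) j = e * u j + v j by [].
  have -> : dl *: (e *: u + v) - (e * u j + v j) *: x i =
    e *: (dl *: u - u j *: x i) + (dl *: v - v j *: x i).
    rewrite scalerDr scalerDl opprD addrACA scalerBr !scalerA.
    by rewrite (mulrC e dl).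
  rewrite linearP mulrDr scalerDl scalerDr scalerA addrACA.
  by rewrite mulrCA.
exists (a * dl), rh; split=> [|z|z Kz]; first exact: maximal_prime.
  rewrite rhE addrC; apply: KP.2 => //; exact: (Krho _).1.
by rewrite rhE rhoE; [rewrite scalerBr !scalerA subrK|apply: cut].
Qed.

End LocalSplitting.

End Residue.

(** The scalars a for which K is a retract up to a form an ideal that lies
    in no maximal ideal. *)
Lemma global_splitting (hR : noetherian R) (J : finType) (K : (J -> R^o) -> Prop) :
  @submodule R (J -> R^o) K ->
  (forall m : ideal R, maximal_ideal m -> forall z, K z ->
     (forall j, z j \in m) -> ideal_span m K z) ->
  exists rho : {linear (J -> R^o) -> (J -> R^o)},
    (forall z, K (rho z)) /\ forall z, K z -> rho z = z.
Proof.
move=> KP Km.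
pose I (a : R^o) := exists rho : {linear (J -> R^o) -> (J -> R^o)},
    (forall z, K (rho z)) /\ forall z, K z -> rho z = (a : R) *: z.
have IP : @submodule R R^o I.
  split=> [|a x y [f [Kf fE]] [g [Kg gE]]].
    by exists \0; split=> z; [case: KP|rewrite scale0r].
  have [|h hE] := @ex_linear R (J -> R^o) (J -> R^o) (fun z => a *: f z + g z).
    by move=> c u v; rewrite (linearP f) (linearP g) !scalerDr !scalerA (mulrC a) addrACA.
  exists h; split=> z; rewrite hE; first by apply: KP.2.
  by move=> Kz; rewrite fE// gE// scalerA -scalerDl.
have [[rho [Kr rE]]|I1] := pselect (I 1).
  by exists rho; split=> // z /rE ->; rewrite scale1r.
have [m [hm mI]] := ex_maximal_ideal IP I1.
have [A [v [Kv vE]]] := gens_noeth hR (@gens_free R J) KP.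
have [i|z Kz|z Kz zm|a [rho [am Kr rE]]] := @local_splitting m hm J #|A| K 1
   (fun i => v (enum_val i)) KP (maximal1 hm).
- exact: Kv.
- have [c zE] := vE z Kz; exists (fun i => c (enum_val i)); rewrite scale1r zE.
  by rewrite (reindex (@enum_val A A)) //; apply: onW_bij; apply: enum_val_bij.
- exact: Km.
by case/negP: am; apply: mI; exists rho.
Qed.

Lemma split_quot_projective (hR : noetherian R) (J : finType) (W : lmodType R)
    (p : {linear (J -> R^o) -> W}) : onto p ->
  (forall m : ideal R, maximal_ideal m -> forall z, p z = 0 ->
     (forall j, z j \in m) -> ideal_span m (fun z => p z = 0) z) ->
  projective W.
Proof.
move=> ps pm.
have [rho [Kr rE]] := global_splitting hR (kernel_submodule p) pm.
have [|f fE] := @ex_linear R (J -> R^o) (J -> R^o) (fun z => z - rho z).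
  by move=> a x y; rewrite linearP opprD addrACA scalerBr.
have [z pz|s sE] := factor_surj (f := f) ps.
  by rewrite fE rE// subrr.
apply: (projective_retract (i := s) (p := p)) (@projective_free R J) => w.
have [z <-] := ps w.
by rewrite sE fE linearB Kr subr0.
Qed.

End MaximalIdeals.

(** * Coefficients in residue fields *)

Section ResidueFunctional.
Variables (R : comPzRingType) (hR : noetherian R).
Variables (C : lmodType R) (hC : semidualizing C).
Variables (m : ideal R) (hm : maximal_ideal m).

Lemma ex_residue : exists e : quotm m,
   (forall x, exists a : R, x = a *: e) /\ forall a : R, a *: e = 0 <-> a \in m.
Proof.
pose e : quotm m := (\pi_(quotm m) (1 : R^o))%qT.
have sE (a : R) : a *: e = (\pi_(quotm m) (a : R^o))%qT.
  transitivity (quotm_scale (S := m) a e) => //.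
  by rewrite quotm_scale_pi; congr (\pi_(quotm m) _)%qT; apply: mulr1.
exists e; split=> [x|a].
  by exists (repr x); rewrite sE reprK.
rewrite sE; have -> : (0 : quotm m) = (\pi_(quotm m) (0 : R^o))%qT by rewrite raddf0.
by split=> [/quotm_eqP|am]; [rewrite subr0|apply/quotm_eqP; rewrite subr0].
Qed.

Lemma residue_presents : exists (e : quotm m) (L : finType) (a : L -> R),
  [/\ presents (fun _ : unit => e) (fun l (_ : unit) => a l),
      forall r : R, r *: e = 0 <-> r \in m, forall l, a l \in m &
      forall x, x \in m -> exists c : L -> R, x = \sum_l c l * a l].
Proof.
have [e [eg e0]] := ex_residue.
have [|L [a [am aE]]] := noeth_ring hR (P := fun x => x \in m).
  by split=> [|r x y xm ym]; [apply: rpred0|apply: rpredD => //; apply: rpredZ].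
exists e, L, a; split=> //; split=> [x|l|c].
- by have [r ->] := eg x; exists (fun _ => r); rewrite (big_pred1 tt).
- by rewrite (big_pred1 tt)//; apply/e0.
- rewrite (big_pred1 tt)// => /e0/aE[r rE]; exists r => -[]; exact: rE.
Qed.

(** C is not zero modulo m, because it is faithful. Take generators of C
    after inverting b outside m, as few as possible: then every relation
    has its first coefficient in m, so the first coordinate is well defined
    modulo m, up to the factor u inverse to b. *)
Lemma residue_functional (N : lmodType R) (e : N) :
  (forall a : R, a *: e = 0 <-> a \in m) ->
  exists (la : {linear C -> N}) (c0 : C), la c0 = e.
Proof.
move=> eE; have [/fg_gens[A [c gc]] _ _] := hC.
have sp : spans_up_to (fun _ : C => True) (fun i : 'I_#|A| => c (enum_val i)) 1.
  by move=> z _; rewrite scale1r; apply: (gens_ord gc).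
move: #|A| (fun i : 'I_#|A| => c (enum_val i)) (1 : R) (maximal1 hm) sp => {A c gc} d.
elim: d => [|d IHd] x b bm sp.
  have b0 : b = 0.
    by apply: (semidualizing_faithful hC) => z; have [e' ->] := sp z I; rewrite big_ord0.
  by case/negP: bm; rewrite b0; apply: rpred0.
have [[r [r0 rm]]|nr] := pselect (exists r : 'I_d.+1 -> R,
    \sum_i r i *: x i = 0 /\ r ord0 \notin m).
  have [b' [b'm sp']] := spans_drop hm bm sp rm r0.
  exact: IHd b'm sp'.
have [u um] := maximal_inv hm bm.
pose g (z : C) (y : N) := exists r, b *: z = \sum_i r i *: x i /\ y = (u * r ord0) *: e.
have [z|y [r [r0 ->]]|a z z' y y' [r [rE ->]] [r' [rE' ->]]|la laE] := @ex_linear_graph R C N g.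
- by have [r rE] := sp z I; exists ((u * r ord0) *: e), r.
- apply/eE/idealMl; apply: contrapT => /negP rm; apply: nr; exists r; split=> //.
  by rewrite -r0 scaler0.
- exists (fun i => a * r i + r' i); split.
    rewrite scalerDr scalerA mulrC -scalerA rE rE' scaler_sumr -big_split.
    by apply: eq_bigr => i _; rewrite scalerDl scalerA.
  by rewrite mulrDr scalerDl scalerA mulrCA.
exists la, (x ord0); apply/laE.
exists (fun i => (i == ord0)%:R * b); split.
  under eq_bigr do rewrite -scalerA.
  by rewrite (comb_delta (fun i => b *: x i)).
rewrite eqxx mul1r; have /eE := um; rewrite scalerBl scale1r => /eqP.
by rewrite subr_eq0 => /eqP.
Qed.

(** For X in the class, evaluation is an isomorphism from Hom(C, X) (x) C
    to X; tau is its inverse followed by la. The second part, that X is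
    spanned by the values of maps from C, makes tau natural. *)
Lemma ex_residue_trace (K : lmodType R -> Prop) (X N : lmodType R) (la : {linear C -> N}) :
  (forall P, K P -> eflat P) -> twist C K X ->
  (exists tau : {linear X -> tensor (homm C X) N},
    forall (q : homm C X) c, tau (q c) = tens q (la c)) /\
  (forall x : X, exists (A : finType) (q : A -> homm C X) (c : A -> C), x = \sum_a q a (c a)).
Proof.
move=> Kflat [P [KP [f /ex_inverse[g [fg gf]]]]].
have fP := Kflat _ KP.
have [k kE] := ex_curry g.
split.
  exists (tensor_map k la \o f) => q c /=.
  have [y yE] := flat_unit_surj hR hC fP (f \o q).
  rewrite -[f (q c)]/((f \o q) c) yE tensor_lift_tens; congr (tens _ _).
  by apply: hommP => c' /=; rewrite kE -yE /= fg.
move=> x; have [A [y [c yE]]] := tensor_sum_fin (f x).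
exists A, (fun a => k (y a)), c; rewrite -[LHS]fg yE linear_sum.
by apply: eq_bigr => a _; rewrite kE.
Qed.

(** Evaluate at a point c0 with la c0 = e, solve in G, and return to Hom(C,
    G) (x) N by tau, where N is a copy of R/m. There the multiples by
    elements of m vanish, and the presentation of N turns the resulting
    equation between tensors into one in Hom(C, G). *)
Lemma hom_residue_trivial (K : lmodType R -> Prop) M (G : augmented M) n
    (N : lmodType R) (e : N) (L : finType) (a : L -> R) :
  (forall P, K P -> eflat P) -> (forall i, twist C K (G i)) ->
  presents (fun _ : unit => e) (fun l (_ : unit) => a l) ->
  (forall r : R, r *: e = 0 <-> r \in m) -> (forall l, a l \in m) ->
  tor_trivial G n (fun l (_ : unit) => a l) ->
  tor_trivial (hom_augmented C G) n (fun l (_ : unit) => a l).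
Proof.
move=> Kflat Gt pr e0 am T z g dg.
have [la [c0 lc0]] := residue_functional e0.
have [[tau tauE] _] := ex_residue_trace la Kflat (Gt n.+1).
have [[tau' tau'E] gen] := ex_residue_trace la Kflat (Gt n.+2).
(* Both sides agree on the values q c of maps q from C, which span. *)
have nat x : tau (cdiff G n.+1 x) =
    tensor_map (cdiff (hom_augmented C G) n.+1) idfun (tau' x).
  have [A [q [c ->]]] := gen x; rewrite !linear_sum; apply: eq_bigr => i _.
  rewrite tau'E tensor_map_tens /= -tauE; congr (tau _).
have [|x' [h hE]] := T (fun l => z l c0) (fun _ => g tt c0).
  case; transitivity ((cdiff (hom_augmented C G) n (g tt)) c0) => //.
  rewrite dg.
  have [ev evE] := @ex_linear R (homm C (G n)) (G n) (fun f => f c0)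
    (fun _ _ _ => erefl).
  by rewrite -evE linear_comb; apply: eq_bigr => l _; rewrite evE.
have genN (X : lmodType R) (u : tensor X N) : exists x, u = tens x e.
  have [gN _ _] := pr; have [x ->] := tens_gens gN u.
  by exists (x tt); rewrite (big_pred1 tt).
have [hq hqE] := genN _ (tau' (h tt)).
have [|g' g'E] := tensor_vanish_pres (x := fun u => g u - cdiff (hom_augmented C G) n.+1 hq) pr.
  rewrite (big_pred1 tt)// tensDl tensNl.
  have := congr1 tau (hE tt); rewrite linearD linear_comb nat hqE tensor_map_tens /=.
  rewrite tauE lc0 => ->; rewrite addrK big1// => l _.
  have [y ->] := genN _ (tau (x' l)).
  by rewrite -tensZr (e0 (a l)).2// tens0r.
by exists g', (fun _ => hq) => -[]; rewrite -(g'E tt) subrK.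
Qed.

End ResidueFunctional.

Section FreeResolutions.
Variables (R : comPzRingType) (hR : noetherian R).
Implicit Types (V W M : lmodType R).

Lemma ex_free_onto_kernel (A B : finType)
    (d : {linear (B -> R^o) -> (A -> R^o)}) :
  exists (B' : finType) (d' : {linear (B' -> R^o) -> (B -> R^o)}), exact_at d' d.
Proof.
have [B' [v [v0 vE]]] := gens_noeth hR (@gens_free R B) (kernel_submodule d).
have [d' d'E] := ex_comb v; exists B', d' => x; split=> [/vE[c ->]|[c <-]].
  by exists c; rewrite d'E.
by rewrite d'E linear_comb big1// => i _; rewrite v0 scaler0.
Qed.

(** A stage of the recursion is a map between finite free modules; the next
    stage is a presentation of its kernel. *)
Lemma ex_free_resolution (A : finType) V (v : A -> V) : gens v ->
  exists F : augmented V, resolves F /\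
    forall i, exists (J : finType) (f : {linear (J -> R^o) -> F i}), bijective f.
Proof.
move=> gv; have [a aE] := ex_comb v.
have [B [w [w0 wE]]] := gens_noeth hR (@gens_free R A) (kernel_submodule a).
have [d0 d0E] := ex_comb w.
pose stage := {A : finType & {B : finType & {linear (B -> R^o) -> (A -> R^o)}}}.
pose cod (s : stage) := projT1 s; pose dom (s : stage) := projT1 (projT2 s).
pose map (s : stage) := projT2 (projT2 s).
pose nxt (s : stage) := cid (ex_free_onto_kernel (map s)).
pose next (s : stage) : stage :=
  existT _ (dom s) (existT _ (projT1 (nxt s)) (projT1 (cid (projT2 (nxt s))))).
have nextP s : exact_at (map (next s) : {linear _ -> (dom s -> R^o)}) (map s).
  exact: (projT2 (cid (projT2 (nxt s)))).
pose t i : stage := iter i next (existT _ A (existT _ B d0)).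
pose d i : {linear (cod (t i.+1) -> R^o) -> (cod (t i) -> R^o)} := map (t i).
have dd i x : d i (d i.+1 x) = 0 by apply/(nextP (t i)); exists x.
have ad x : a (d 0%N x) = 0.
  by rewrite [d 0%N x]d0E linear_comb big1// => i _; rewrite w0 scaler0.
exists (@Augmented R V (@ChainComplex R (fun i => (cod (t i) -> R^o) : lmodType R) d dd) a ad).
split.
  split=> /=.
  - by move=> x; have [c ->] := gv x; exists c; rewrite aE.
  - by move=> x /wE[c ->]; exists c; rewrite [LHS]d0E.
  - by move=> i x /(nextP (t i)).
by move=> i; exists (cod (t i)), idfun; exists id.
Qed.

(** Restriction to the generators of C embeds Hom(C, M) into a finite power
    of M. *)
Lemma hom_gens (A B : finType) (C M : lmodType R) (c : A -> C) (v : B -> M) :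
  gens c -> gens v ->
  exists (E : finType) (w : E -> homm C M), gens w.
Proof.
move=> gc gv.
have gAM : @gens R (A * B)%type (A -> M) (fun p a => (a == p.1)%:R *: v p.2).
  move=> f; have [r rE] := choice (fun a => gv (f a)).
  exists (fun p => r p.1 p.2); apply/funext => a; rewrite fct_sumE.
  rewrite rE; transitivity (\sum_p ((a == p.1)%:R * r p.1 p.2) *: v p.2); last first.
    by apply: eq_bigr => p _; rewrite mulrC -scalerA.
  rewrite -[LHS](comb_pairr (r a) (fun p => v p.2) a); apply: eq_bigr => p _.
  by case: eqP => [->|_]; rewrite ?mul1r ?mul0r.
pose res (f : homm C M) : A -> M := fun a => f (c a).
have [e eE] := @ex_linear R (homm C M) (A -> M) res (fun _ _ _ => erefl).
have ei f g : e f = e g -> f = g.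
  rewrite !eE => /funeqP fg; apply: hommP; exact: gens_linear_eq gc fg.
have [E [w [wP wE]]] := gens_noeth hR gAM (image_submodule e).
have [u uE] := choice wP.
exists E, u => f; have [|r rE] := wE (e f); first by exists f.
exists r; apply: ei; rewrite linear_comb rE.
by apply: eq_bigr => i _; rewrite uE.
Qed.

End FreeResolutions.

Section FinitelyGenerated.
Variables (R : comPzRingType) (hR : noetherian R).
Variables (C : lmodType R) (hC : semidualizing C).

Lemma bijective_eflat (U V : lmodType R) (f : {linear U -> V}) :
  bijective f -> eflat U -> eflat V.
Proof. by move=> /ex_inverse[g [fg gf]]; apply: (eflat_retract (i := g) (p := f)). Qed.

Lemma bijective_projective (U V : lmodType R) (f : {linear U -> V}) :
  bijective f -> projective U -> projective V.
Proof. by move=> /ex_inverse[g [fg gf]]; apply: (projective_retract (i := g) (p := f)). Qed.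

Lemma projective_ring : projective (R^o : lmodType R).
Proof.
move=> U W p f ps; have [u uE] := ps (f 1); have [g gE] := ex_scale u.
by exists g => x; rewrite gE linearZ /= uE -linearZ; congr (f _); apply: mulr1.
Qed.

Lemma eflat_ring : eflat (R^o : lmodType R).
Proof. exact: projective_eflat projective_ring. Qed.

Lemma projective_zero (V : lmodType R) : is_zero_module V -> projective V.
Proof.
by move=> V0 U W p f ps; exists \0 => x; rewrite linear0 [in RHS](V0 x) linear0.
Qed.

Lemma FC_twist : FC C = twist C (@eflat R).
Proof.
apply/funext => X; apply/propext; split=> -[F [fF e]]; exists F; split=> //.
  exact: flat_eflat.
exact: eflat_flat.
Qed.

(** Compare a resolution F of Hom(C, M) by finite free modules with Hom(C,
    G), where G computes the relative Tor with coefficients R/m. The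
    vanishing at m becomes: a boundary of F in degree n that lies in mF
    lies in m times the boundaries. So the cokernel of the n-th
    differential of F is projective, and F can be truncated at n. *)
Lemma residue_tor_bound M n : finitely_generated M ->
  (forall m : ideal R, maximal_ideal m -> Tor_vanishes C n.+1 M (quotm m)) ->
  exists X : augmented M, proper_resolution (PC C) X /\
    forall i, (n < i)%N -> is_zero_module (X i).
Proof.
move=> /fg_gens[B [v gv]] Tm.
have [A [L [c [rel pr]]]] := semidualizing_presented hR hC.
have [gc _ _] := pr.
have [E [w gw]] := hom_gens hR gc gv.
have [F [Fr Ffree]] := ex_free_resolution hR gw.
have Fproj i : projective (F i).
  by have [J [f fb]] := Ffree i; apply: bijective_projective fb (@projective_free R J).
have Ffl i := projective_eflat (Fproj i).
have KW (W : lmodType R) (p : {linear F n -> W}) : onto p -> exact_at (cdiff F n) p -> projective W.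
  move=> ps ex; have [J [f /[dup] fb /ex_inverse[f' [ff' f'f]]]] := Ffree n.
  apply: (split_quot_projective hR (p := p \o f)) => [x|m hm z /= pz zm].
    by have [y <-] := ps x; exists (f' y); rewrite /= f'f.
  have [G [Gp T0]] := Tm m hm.
  have [e [L' [a [pe e0 am aE]]]] := residue_presents hR m.
  move: Gp; rewrite FC_twist => Gp; have [Gt _] := (proper_resolutionE _ _).1 Gp.
  have [Qf _ Qr] := hom_proper hR hC (fun P h => h) bijective_eflat eflat_ring Gp.
  have T1 := hom_residue_trivial hR hC hm (fun P h => h) Gt pe e0 am (Tor_trivial pe T0).
  have cm := ex_chain_map (fun i => projective_hom_exact (Fproj i) Qr).
  have T2 := tor_trivial_compare Ffl Qf Fr Qr cm T1.
  have [g gE] := (ex (f z)).1 pz.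
  have [r rE] := choice (fun j => aE _ (zm j)).
  have [|g' [h hE]] := T2 (fun l => f (fun j => r j l)) (fun _ => g).
    move=> _; rewrite gE -linear_comb; congr (f _); apply/funext => j.
    by rewrite fct_sumE rE; apply: eq_bigr => l _; apply: mulrC.
  exists L', a, (fun l => f' (cdiff F n (g' l))); split=> // [l|].
    by rewrite f'f; apply/ex; exists (g' l).
  rewrite -[LHS]ff' -linear_comb -linear_comb; congr (f' _).
  by rewrite -gE (hE tt) linearD cdiff_eq0 addr0.
have [X [KX Xe X0]] := truncate bijective_projective projective_zero Fproj Fr
   (fun P hP => projective_hom_exact hP Fr) KW.
have [G [Gp G0]] := tensor_proper hR hC (@projective_eflat R) KX Xe.
by exists G; split=> // i ni; apply/G0/X0.
Qed.

End FinitelyGenerated.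

(** * The group Q/Z *)

Section AbelianGroups.
Implicit Types (X T : zmodType).

Definition additive_fun X T (f : X -> T) := forall x y, f (x + y) = f x + f y.

Definition partial_additive X T (G : X -> T -> Prop) :=
  [/\ G 0 0, forall x y t s, G x t -> G y s -> G (x - y) (t - s) &
      forall t, G 0 t -> t = 0].

(** Injectivity in the form in which it is used: a group of pairs that is
    the graph of a partial additive function extends to a total one. *)
Definition injective_group T := forall X (G : X -> T -> Prop),
  partial_additive G ->
  exists f : X -> T, additive_fun f /\ forall x t, G x t -> f x = t.

Definition cogenerator T := forall X (A : X -> Prop) x,
  A 0 -> (forall y z, A y -> A z -> A (y - z)) -> ~ A x ->
  exists f : X -> T, [/\ additive_fun f, forall y, A y -> f y = 0 & f x <> 0].

Lemma subgroupMz X (A : X -> Prop) : A 0 -> (forall y z, A y -> A z -> A (y - z)) ->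
  forall (n : int) x, A x -> A (x *~ n).
Proof.
move=> A0 AB n x Ax.
have AN y : A y -> A (- y) by move=> Ay; rewrite -[- y]add0r; apply: AB.
have An k : A (x *+ k).
  elim: k => [|k IHk]; first by rewrite mulr0n.
  by rewrite mulrS -[_ *+ k]opprK; apply: AB => //; apply: AN.
by case: n => n; rewrite ?NegzE ?mulrNz; [apply: An|apply/AN/An].
Qed.

(** The index m is 0 when no positive multiple of x lies in A. *)
Lemma subgroup_index X (A : X -> Prop) x : A 0 -> (forall y z, A y -> A z -> A (y - z)) ->
  exists m : nat, A (x *+ m) /\
    forall n : int, A (x *~ n) -> exists q : int, n = q * m%:Z.
Proof.
move=> A0 AB.
have [[k [k0 Ak]]|nk] := pselect (exists k : nat, (0 < k)%N /\ A (x *+ k)); last first.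
  exists 0%N; split; first by rewrite mulr0n.
  move=> n An; exists 0; rewrite mul0r; apply: contrapT => n0; apply: nk.
  exists `|n|%N; split; first by rewrite absz_gt0; apply/eqP.
  case: n An n0 => n; first by [].
  by rewrite NegzE mulrNz => An _; rewrite -[x *+ _]opprK -[- - _]add0r; apply: AB.
pose p k := (0 < k)%N && `[< A (x *+ k) >].
have [|m /andP[m0 /asboolP Am] minm] := @ex_minnP p.
  by exists k; rewrite /p k0; apply/asboolP.
exists m; split=> // n An; exists (n %/ m%:Z)%Z.
have Ar : A (x *~ (n %% m%:Z)%Z).
  have -> : (n %% m%:Z)%Z = n - (n %/ m%:Z)%Z * m%:Z.
    by rewrite [X in _ = X - _](divz_eq n m%:Z) addrAC subrr add0r.
  rewrite mulrzBr; apply: (AB) => //.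
  rewrite mulrC mulrzA; exact: (@subgroupMz X A A0 AB _ (x *+ m) Am).
have [r rE] : exists r : nat, (n %% m%:Z)%Z = r.
  have : 0 <= (n %% m%:Z)%Z by apply: modz_ge0; rewrite eqz_nat -lt0n.
  by case: (n %% m%:Z)%Z => // r _; exists r.
have r0 : r = 0%N.
  have rm : (r < m)%N.
    have : (n %% m%:Z)%Z < m%:Z by apply: ltz_pmod; rewrite ltz_nat.
    by rewrite rE ltz_nat.
  apply/eqP; rewrite -leqn0 leqNgt; apply/negP => r0.
  have : (m <= r)%N by apply: minm; rewrite /p r0; apply/asboolP; rewrite rE in Ar.
  by rewrite leqNgt rm.
by rewrite {1}(divz_eq n m%:Z) rE r0 addr0.
Qed.

(** A value t is admissible at x as soon as m t is the value at m x, for m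
    generating the multiples of x in the domain. *)
Lemma partial_additive_extend X T (G : X -> T -> Prop) x m t :
  partial_additive G -> G (x *+ m) (t *+ m) ->
  (forall n : int, (exists s, G (x *~ n) s) -> exists q : int, n = q * m%:Z) ->
  partial_additive (fun y s => exists n z r, [/\ G z r, y = z + x *~ n & s = r + t *~ n]).
Proof.
move=> [G0 GB Gf] Gm mP; split.
- by exists 0, 0, 0; rewrite !mulr0z !addr0.
- move=> _ _ _ _ [n [z [r [Gzr -> ->]]]] [n' [z' [r' [Gzr' -> ->]]]].
  exists (n - n'), (z - z'), (r - r'); split; first exact: GB.
    by rewrite mulrzBr opprD addrACA.
  by rewrite mulrzBr opprD addrACA.
move=> s [n [z [r [Gzr /esym/eqP + ->]]]]; rewrite addrC addr_eq0 => /eqP xz.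
have GN y u : G y u -> G (- y) (- u).
  by move=> Gyu; rewrite -[- y]add0r -[- u]add0r; apply: GB.
have [|q nq] := mP n; first by exists (- r); rewrite xz; apply: GN.
pose A (p : X * T) := G p.1 p.2.
have Gn : G (x *~ n) (t *~ n).
  have := @subgroupMz (X * T)%type A G0 (fun p p' => GB p.1 p'.1 p.2 p'.2) q (x *+ m, t *+ m) Gm.
  rewrite nq mulrC !mulrzA.
  have fstz (p : X * T) (k : int) : p *~ k = (p.1 *~ k, p.2 *~ k).
    have Pn (j : nat) : p *+ j = (p.1 *+ j, p.2 *+ j).
      by elim: j => [|j IHj] //; rewrite !mulrS IHj.
    by case: k => k; rewrite ?NegzE ?mulrNz -?pmulrn Pn.
  by rewrite fstz.
apply: Gf; have := GB _ _ _ _ Gn (GN _ _ Gzr).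
by rewrite opprK opprK xz addNr addrC.
Qed.

(** Zorn's lemma, applied to graphs whose union with G is still functional.
    Divisibility provides the value at a new point. *)
Lemma divisible_injective T :
  (forall (t : T) (m : nat), (0 < m)%N -> exists s, s *+ m = t) -> injective_group T.
Proof.
move=> div X G [G0 GB Gf].
pose J (S : set (X * T)) x t := G x t \/ S (x, t).
have [|S [SP Smax]] := @Zorn_bigcup (X * T)%type (fun S => partial_additive (J S)).
  move=> F FP totF; split; first by left.
    have inF S x y t s : F S -> J S x t -> J S y s ->
        J (\bigcup_(S in F) S)%classic (x - y) (t - s).
      move=> FS Jx Jy; have [_ JB _] := FP _ FS.
      by case: (JB x y t s Jx Jy) => [?|?]; [left|right; exists S].
    move=> x y t s [Gx|[S FS Sx]] [Gy|[S' FS' Sy]].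
    - by left; apply: GB.
    - by apply: (inF S') => //; [left|right].
    - by apply: (inF S) => //; [right|left].
    - have [SS|SS] := totF S S' FS FS'.
        by apply: (inF S') => //; right => //; apply: SS.
      by apply: (inF S) => //; right => //; apply: SS.
  by move=> t [/Gf//|[S FS St]]; have [_ _ Jf] := FP _ FS; apply: Jf; right.
have [J0 JB Jf] := SP.
have JU x t s : J S x t -> J S x s -> t = s.
  move=> Jt Js; apply/eqP; rewrite -subr_eq0; apply/eqP/Jf.
  by rewrite -(subrr x); apply: JB.
have total x : exists t, J S x t.
  apply: contrapT => nx.
  have [m [[t' Jm] mP]] := @subgroup_index X (fun x => exists t, J S x t) x
    (ex_intro _ 0 J0) (fun y z => ltac:(by move=> [t Jt] [s Js]; exists (t - s); apply: JB)).
  have [t tm] : exists t, t *+ m = t'.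
    case: m Jm {mP} => [|m] Jm; last exact: div.
    by exists 0; rewrite mulr0n; apply: JU Jm; rewrite mulr0n.
  rewrite -tm in Jm.
  pose G' y s := exists n z r, [/\ J S z r, y = z + x *~ n & s = r + t *~ n].
  have ext : partial_additive G' := partial_additive_extend SP Jm mP.
  have sub y s : J S y s -> G' y s.
    by move=> Jy; exists 0, y, s; rewrite !mulr0z !addr0.
  apply: (Smax (fun p => G' p.1 p.2)); first split.
  - by move=> [y s] Sy; apply: sub; right.
  - move=> /(_ (x, t)) St; apply: nx; exists t; right; apply: St.
    by exists 1, 0, 0; rewrite !mulr1z !add0r.
  have -> : J (fun p => G' p.1 p.2) = G'; last exact: ext.
  apply/funext => y; apply/funext => s; apply/propext; split; last by right.
  by case=> // Gy; apply: sub; left.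
have [f fP] := choice total; exists f; split=> [x y|x t Gx].
  apply: (JU (x + y)) => //.
  have JN z : J S (- z) (- f z) by rewrite -[- z]add0r -[- f z]add0r; apply: JB.
  by have := JB _ _ _ _ (fP x) (JN y); rewrite !opprK.
by apply: JU (fP x) _; left.
Qed.

(** Send x to a nonzero element whose order divides the index of x modulo
    A, and A to 0. *)
Lemma torsion_cogenerator T :
  injective_group T ->
  (forall m : nat, (1 < m)%N -> exists t : T, t <> 0 /\ t *+ m = 0) -> cogenerator T.
Proof.
move=> inj tors X A x A0 AB Ax.
have [m [Am mP]] := @subgroup_index X A x A0 AB.
have [t [t0 tm]] : exists t : T, t <> 0 /\ t *+ m = 0.
  case: m Am {mP} => [|[|m]] Am; [|by case: Ax|exact: tors].
  by have [t [t0 _]] := tors 2%N isT; exists t.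
have PA : partial_additive (fun y (s : T) => A y /\ s = 0).
  split=> [//|y z s r [Ay ->] [Az ->]|s []//].
  by split; [apply: AB|rewrite subr0].
have [||f [fD fE]] := inj X _ (partial_additive_extend (x := x) (m := m) (t := t) PA _ _).
- by split.
- by move=> n [s [An _]]; apply: mP.
exists f; split=> // [y Ay|].
  by apply: fE; exists 0, y, 0; rewrite !mulr0z !addr0.
by rewrite (fE x t) //; exists 1, 0, 0; rewrite !mulr1z !add0r.
Qed.

Definition integral_rat : {pred rat} := [pred x | x \is a Num.int].
Lemma integral_rat_zmod : zmod_closed integral_rat.
Proof.
by split=> [|x y]; rewrite !inE ?rpred0//; apply: rpredB.
Qed.
HB.instance Definition _ := GRing.isZmodClosed.Build rat integral_rat integral_rat_zmod.
Definition QZ : zmodType := Quotient.quot integral_rat.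

Lemma QZ_eq0 x : (\pi_QZ x = 0)%qT <-> x \is a Num.int.
Proof.
rewrite -[0](raddf0 (\pi_QZ : {additive rat -> QZ})%qT).
split=> [/eqP|xi].
  by rewrite -Quotient.idealrBE subr0.
by apply/eqP; rewrite -Quotient.idealrBE subr0.
Qed.

Lemma QZ_injective : injective_group QZ.
Proof.
apply: divisible_injective => t m m0.
exists (\pi_QZ (repr t / m%:R))%qT.
rewrite -raddfMn -[_ / _ *+ m]mulr_natr mulfVK; first exact: reprK.
by rewrite Num.Theory.pnatr_eq0 -lt0n.
Qed.

Lemma QZ_cogenerator : cogenerator QZ.
Proof.
apply: torsion_cogenerator QZ_injective _ => m m1.
exists (\pi_QZ (m%:R^-1))%qT; split.
  move/QZ_eq0/Num.Theory.intrP => [z zE].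
  have : (m%:R : rat) * z%:~R = 1.
    by rewrite -zE mulfV// Num.Theory.pnatr_eq0 -lt0n ltnW.
  rewrite -[m%:R]/((m%:Z)%:~R) -intrM -[X in _ = X]/(1%:~R) => /intr_inj mz.
  have /(congr1 absz) := mz.
  by rewrite abszM /= => /eqP; rewrite muln_eq1 => /andP[/eqP m1' _]; rewrite m1' in m1.
rewrite -raddfMn /=; apply/QZ_eq0.
by rewrite -[_^-1 *+ m]mulr_natr mulVf ?rpred1// Num.Theory.pnatr_eq0 -lt0n ltnW.
Qed.

End AbelianGroups.

(** * Character modules *)

Section AdditiveFunctions.
Variables (X T : zmodType) (f : X -> T) (fD : additive_fun f).

Lemma additive_fun0 : f 0 = 0.
Proof. by apply: (addrI (f 0)); rewrite -fD !addr0. Qed.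

Lemma additive_funB x y : f (x - y) = f x - f y.
Proof. by apply: (addIr (f y)); rewrite -fD !subrK. Qed.

Lemma additive_fun_sum (I : finType) (x : I -> X) : f (\sum_i x i) = \sum_i f (x i).
Proof. exact: (big_morph f fD additive_fun0). Qed.

End AdditiveFunctions.

Definition single (A : eqType) (V : zmodType) (a : A) (v : V) : A -> V :=
  fun b => if b == a then v else 0.

Lemma sum_single (A : finType) (V : zmodType) (u : A -> V) : u = \sum_a single a (u a).
Proof.
apply/funext => b; rewrite fct_sumE /single (bigD1 b)//= eqxx big1 ?addr0// => a /negPf.
by rewrite eq_sym => ->.
Qed.

Lemma additive_single (A : eqType) (V : zmodType) (a : A) : additive_fun (@single A V a).
Proof.
move=> v w; apply/funext => b; rewrite /single.
transitivity ((if b == a then v else 0) + (if b == a then w else 0)) => //.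
by case: eqP => // _; rewrite addr0.
Qed.

Lemma additive_comp (X Y Z : zmodType) (f : Y -> Z) (g : X -> Y) :
  additive_fun f -> additive_fun g -> additive_fun (fun x => f (g x)).
Proof. by move=> fD gD x y; rewrite gD fD. Qed.

Lemma additive_split (A : finType) (V T : zmodType) (f : (A -> V) -> T) (u : A -> V) :
  additive_fun f -> f u = \sum_a f (single a (u a)).
Proof. by move=> fD; rewrite [in LHS](sum_single u) additive_fun_sum. Qed.

Section Dual.
Variables (R : comPzRingType) (Y : lmodType R).

Definition character_pred : {pred Y -> QZ} := [pred f | `[< additive_fun f >]].
Lemma character_zmod : zmod_closed character_pred.
Proof.
split=> [|f g]; rewrite !inE; first by move=> x y; exact/esym/addr0.
move=> fD gD x y.
transitivity ((f x + f y) - (g x + g y)); first by rewrite -fD -gD.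
by rewrite opprD addrACA.
Qed.
HB.instance Definition _ := GRing.isZmodClosed.Build (Y -> QZ) character_pred character_zmod.

(** The character module Hom_Z(Y, Q/Z), on which a scalar acts through its
    argument. *)
Definition dual := {f : Y -> QZ | f \in character_pred}.
HB.instance Definition _ := SubChoice.on dual.
HB.instance Definition _ := [SubChoice_isSubZmodule of dual by <:].

Lemma dual_additive (f : dual) : additive_fun (val f).
Proof. by have := valP f; rewrite inE. Qed.

Lemma dual_scale_subproof (a : R) (f : dual) :
  (fun y => val f (a *: y)) \in character_pred.
Proof. by rewrite inE => x y; rewrite scalerDr dual_additive. Qed.

Definition dual_scale a f : dual :=
  exist (fun g => g \in character_pred) _ (dual_scale_subproof a f).

Lemma dual_scaleA a b f : dual_scale a (dual_scale b f) = dual_scale (a * b) f.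
Proof. by apply/val_inj/funext => y /=; rewrite scalerA mulrC. Qed.
Lemma dual_scale1 : left_id 1 dual_scale.
Proof. by move=> f; apply/val_inj/funext => y /=; rewrite scale1r. Qed.
Lemma dual_scaleDr : right_distributive dual_scale +%R.
Proof. by move=> a f g; apply/val_inj/funext => y. Qed.
Lemma dual_scaleDl f : {morph dual_scale^~ f : a b / a + b}.
Proof. by move=> a b; apply/val_inj/funext => y /=; rewrite scalerDl dual_additive. Qed.
HB.instance Definition _ := GRing.Zmodule_isLmodule.Build R dual
  dual_scaleA dual_scale1 dual_scaleDr dual_scaleDl.

Lemma dualD (f g : dual) y : val (f + g) y = val f y + val g y. Proof. by []. Qed.
Lemma dualZ a (f : dual) y : val (a *: f) y = val f (a *: y). Proof. by []. Qed.

Lemma dual_sum (A : finType) (f : A -> dual) y : val (\sum_a f a) y = \sum_a val (f a) y.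
Proof. by apply: (big_morph (fun f : dual => val f y)). Qed.

Lemma ex_dual (f : Y -> QZ) : additive_fun f -> exists g : dual, val g = f.
Proof.
move=> fD; have fP : f \in character_pred by rewrite inE.
by exists (exist (fun g => g \in character_pred) f fP).
Qed.

End Dual.

Section DoubleDual.
Variable R : comPzRingType.
Implicit Types (V W X Y : lmodType R).

Definition pure_injective (J : lmodType R) :=
  forall (A B : lmodType R) (i : {linear A -> B}) (f : {linear A -> J}),
  epure i -> exists g : {linear B -> J}, forall a, g (i a) = f a.

(** Maps from A to the dual of Y are characters of A (x) Y, and A (x) Y
    embeds into B (x) Y when A is pure in B. *)
Lemma dual_pure_injective Y : pure_injective (dual Y).
Proof.
move=> A B i f pi.
have bD a y : additive_fun (fun s : R^o => val (f a) ((s : R) *: y)).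
  by move=> s t; rewrite scalerDl dual_additive.
have [b bE] := choice (fun p : A * Y => ex_dual (bD p.1 p.2)).
have bb : bilinear_map (fun a y => b (a, y) : dual R^o).
  split=> [a r x y|y r a a']; apply/val_inj/funext => s.
    rewrite dualD dualZ !bE /= scalerDr dual_additive !scalerA.
    by congr (val (f a) (_ *: x) + _); apply: mulrC.
  by rewrite dualD dualZ !bE /= linearP dualD dualZ scalerA.
have [F FE] := ex_tensor_lift bb.
have ti := epure_tensor_inj (Y := Y) pi.
set t := tensor_map i _ in ti.
have [|psi [psiD psiE]] := @QZ_injective (tensor B Y)
  (fun u s => exists v, t v = u /\ val (F v) 1 = s).
  split.
  - by exists 0; rewrite !linear0.
  - move=> _ _ _ _ [v [<- <-]] [w [<- <-]]; exists (v - w).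
    by rewrite !linearB.
  - move=> s [v [tv <-]].
    by rewrite (ti v 0) ?linear0.
have psit v : psi (t v) = val (F v) 1 by apply: psiE; exists v.
have gD b' : additive_fun (fun y : Y => psi (tens b' y)).
  by move=> x y; rewrite tensDr psiD.
have [g gE] := choice (fun b' => ex_dual (gD b')).
have [|h hE] := @ex_linear R B (dual Y) g.
  move=> r x y; apply/val_inj/funext => z.
  by rewrite dualD dualZ !gE tensDl tensZl psiD -tensZr.
exists h => a; apply/val_inj/funext => y; rewrite hE gE.
have := psit (tens a y); rewrite tensor_map_tens /= => ->.
by rewrite FE bE /= scale1r.
Qed.

Lemma ex_double_dual V : exists ev : {linear V -> dual (dual V)},
  forall v phi, val (ev v) phi = val phi v.
Proof.
have evD v : additive_fun (fun phi : dual V => val phi v) by [].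
have [e eE] := choice (fun v => ex_dual (evD v)).
have [|ev evE] := @ex_linear R V (dual (dual V)) e; last first.
  by exists ev => v phi; rewrite evE eE.
move=> a x y; apply/val_inj/funext => phi.
by rewrite dualD dualZ !eE dualZ dual_additive.
Qed.

(** If a system with constants in V had a solution in the double dual but
    none in V, a character of V^B would separate the constants from the
    solvable ones. Its components form a vector of the dual that is
    orthogonal to the matrix of the system but not to the constants, which
    contradicts the solution. *)
Lemma double_dual_pure V (ev : {linear V -> dual (dual V)}) :
  (forall v phi, val (ev v) phi = val phi v) -> epure ev.
Proof.
move=> evE A B r u x rx.
pose I (w : B -> V) := exists x' : A -> V, forall b, \sum_a r b a *: x' a = w b.
have [[x' x'E]|Iu] := pselect (I u); first by exists x'.
have [||f [fD f0 fu]] := @QZ_cogenerator (B -> V) I u _ _ Iu.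
- by exists (fun _ => 0) => b; rewrite big1// => a _; rewrite scaler0.
- move=> y z [y' y'E] [z' z'E]; exists (fun a => y' a - z' a) => b.
  by rewrite sumB_comb y'E z'E.
have /choice[phi phiE] b : exists phi : dual V, val phi = fun v => f (single b v).
  by apply: ex_dual; apply: additive_comp fD (additive_single _).
case: fu; rewrite (additive_split u fD).
transitivity (\sum_b val (ev (u b)) (phi b)).
  by apply: eq_bigr => b _; rewrite evE phiE.
transitivity (\sum_b \sum_a val (x a) (r b a *: phi b)).
  by apply: eq_bigr => b _; rewrite -rx dual_sum; apply: eq_bigr => a _; rewrite dualZ.
rewrite exchange_big big1// => a _.
rewrite -(additive_fun_sum (dual_additive (x a))).
have -> : \sum_b r b a *: phi b = 0.
  apply/val_inj/funext => v; rewrite dual_sum.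
  transitivity (f (fun b => r b a *: v)).
    rewrite (additive_split _ fD); apply: eq_bigr => b _.
    by rewrite dualZ phiE.
  rewrite f0//; exists (fun a' => (a' == a)%:R *: v) => b.
  rewrite (bigD1 a)//= eqxx scale1r big1 ?addr0// => a' /negPf->.
  by rewrite scale0r scaler0.
exact: additive_fun0 (dual_additive _).
Qed.

(** Exactness of V^L -> V^A -> V^B passes to the dual: phi, as a character
    of V^A, vanishes on the kernel of r, so it factors through the image of
    r and extends to V^B because Q/Z is injective. *)
Lemma dual_exact (A B L : finType) (r : B -> A -> R) (k : L -> A -> R) V (phi : A -> dual V) :
  (forall v : A -> V, (forall b, \sum_a r b a *: v a = 0) ->
     exists z : L -> V, forall a, v a = \sum_l k l a *: z l) ->
  (forall l, \sum_a k l a *: phi a = 0) ->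
  exists chi : B -> dual V, forall a, phi a = \sum_b r b a *: chi b.
Proof.
move=> ex kphi.
pose Phi (v : A -> V) := \sum_a val (phi a) (v a).
have PhiB v w : Phi (v - w) = Phi v - Phi w.
  by rewrite -sumrB; apply: eq_bigr => a _; rewrite -(additive_funB (dual_additive _)).
have [|c [cD cE]] := @QZ_injective (B -> V)
    (fun w t => exists v : A -> V, w = (fun b => \sum_a r b a *: v a) /\ t = Phi v).
  split.
  - exists (fun _ => 0); split.
      by apply/funext => b; rewrite big1// => a _; rewrite scaler0.
    by rewrite /Phi big1// => a _; apply: additive_fun0 (dual_additive _).
  - move=> _ _ _ _ [v [-> ->]] [w [-> ->]]; exists (v - w); split.
      apply/funext => b; exact: (esym (sumB_comb (r b) v w)).
    by rewrite PhiB.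
  - move=> _ [v [v0 ->]].
    have [|z zE] := ex v.
      by move=> b; have := congr1 (fun w : B -> V => w b) v0 => /= <-.
    rewrite /Phi; under eq_bigr do
      rewrite zE (additive_fun_sum (dual_additive _)).
    rewrite exchange_big big1// => l _.
    under eq_bigr do rewrite -dualZ.
    by rewrite -dual_sum kphi.
have /choice[chi chiE] b : exists chi : dual V, val chi = fun v => c (single b v).
  by apply: ex_dual; apply: additive_comp cD (additive_single _).
exists chi => a; apply/val_inj/funext => v; rewrite dual_sum.
have PhiS : Phi (single a v) = val (phi a) v.
  rewrite /Phi /single (bigD1 a)//= eqxx big1 ?addr0// => a' /negPf aa'.
  by rewrite aa'; apply: additive_fun0 (dual_additive _).
have := cE _ _ (ex_intro _ (single a v) (conj erefl erefl)).
rewrite (additive_split _ cD) PhiS => <-; apply: eq_bigr => b _; rewrite dualZ chiE.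
congr (c (single b _)).
rewrite (bigD1 a)//= /single eqxx big1 ?addr0// => a' /negPf ->.
by rewrite scaler0.
Qed.

(** Flatness of V makes V^L -> V^A -> V^B exact, where k generates the
    kernel of the matrix r over R; here R is noetherian. Dualising twice
    keeps it exact, which is the equational criterion for the double dual. *)
Lemma double_dual_flat (hR : noetherian R) V : eflat V -> eflat (dual (dual V)).
Proof.
move=> fV A B r x rx.
have [rm rmE] := ex_comb (fun a b => r b a : R^o).
have rmb c b : rm c b = \sum_a r b a * c a.
  by rewrite rmE fct_sumE; apply: eq_bigr => a _; apply: mulrC.
have [L [k [k0 kE]]] := gens_noeth hR (@gens_free R A) (kernel_submodule rm).
have rk b l : \sum_a r b a * k l a = 0 by rewrite -rmb k0.
have exV (v : A -> V) : (forall b, \sum_a r b a *: v a = 0) ->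
    exists z : L -> V, forall a, v a = \sum_l k l a *: z l.
  move=> /fV[J [c [y [vE rc]]]].
  have /choice[d dE] j : exists d : L -> R, (fun a => c a j) = \sum_l d l *: k l.
    by apply: kE; apply/funext => b; rewrite rmb rc.
  exists (fun l => \sum_j d j l *: y j) => a.
  rewrite scale_comb vE; apply: eq_bigr => j _; congr (_ *: _).
  have := congr1 (fun u : A -> R^o => u a) (dE j) => /= ->.
  by rewrite fct_sumE; apply: eq_bigr => l _; apply: mulrC.
have [|y yE] := @dual_exact A L B (fun l a => k l a) (fun b a => r b a) (dual V) x _ rx.
  move=> phi kphi.
  have [chi chiE] := dual_exact exV kphi.
  by exists chi.
exists L, (fun a l => k l a), y; split=> //.
Qed.

End DoubleDual.

(** * Cotorsion modules and proper flat resolutions *)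

Section Cotorsion.
Variables (R : comPzRingType) (hR : noetherian R).
Implicit Types (B D F H J K M V W P : lmodType R).

(** Ext^1(F, H) = 0 for all flat F, in the form of a lifting property
    against epimorphisms with kernel H. *)
Definition cotorsion H := forall (B M F : lmodType R) (j : {linear H -> B}) (q : {linear B -> M})
    (f : {linear F -> M}), short_exact j q -> eflat F ->
  exists g : {linear F -> B}, forall x, q (g x) = f x.

Lemma cotorsion_zero H : is_zero_module H -> cotorsion H.
Proof.
move=> H0 B M F j q f [ji ex qs] fF.
have [b bE] := choice qs.
have qi : injective q.
  apply: linear_inj0 => x /ex[h <-]; by rewrite (H0 h) linear0.
have [q' [qq' q'q]] : exists q' : {linear M -> B}, cancel q q' /\ cancel q' q.
  by apply: ex_inverse; exists b => // x; apply: qi; rewrite bE.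
by exists (q' \o f) => x /=; rewrite q'q.
Qed.

(** Ext^1(F, H) sits between Ext^1(F, J) and Ext^2(F, H2). The latter is
    Ext^1(F', H2) for the flat syzygy F' of F, so it vanishes. In elements:
    the lift g0 over a free cover P of F restricts to a map from F' to H,
    which lifts to J and then extends to P by pure injectivity; subtracting
    the extension makes g0 descend to F. *)
Lemma cotorsion_quot H2 J H (k : {linear H2 -> J}) (e : {linear J -> H}) :
  short_exact k e -> pure_injective J -> cotorsion H2 -> cotorsion H.
Proof.
move=> ke pJ cH2 B M F j q f jq fF; have [ji ex qs] := jq.
have [P [pi [ps prP fP]]] := free_cover F.
have [F' [io [ioi ioE]]] := ex_kernel pi.
have iopi : short_exact io pi by [].
have pio := epure_flat_quot iopi fF.
have [g0 g0E] := prP _ _ q (f \o pi) qs.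
have [x|g1 g1E] := factor_inj (f := g0 \o io) ji.
  by apply/ex; rewrite /= g0E /= (_ : pi (io x) = 0) ?linear0//; apply/ioE; exists x.
have [g2 g2E] := cH2 _ _ _ k e g1 ke (eflat_pure_sub pio fP).
have [g3 g3E] := pJ _ _ io g2 pio.
have [|d dE] := @ex_linear R P B (fun x => g0 x - j (e (g3 x))).
  move=> a x y.
  by rewrite (linearP g0) (linearP g3) (linearP e) (linearP j) opprD addrACA scalerBr.
have [x /ioE[y <-]|g gE] := factor_surj (f := d) ps.
  by rewrite dE g3E g2E g1E subrr.
exists g => x; have [y <-] := ps x.
rewrite gE dE linearB g0E /= (_ : q (j _) = 0) ?subr0//.
by apply/ex; exists (e (g3 y)).
Qed.

(** Flat dimension at most n - 1, with the zero module at n = 0. *)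
Fixpoint flat_dim_lt (n : nat) K : Prop :=
  match n with
  | 0 => is_zero_module K
  | n.+1 => exists (K1 P : lmodType R) (i : {linear K1 -> P}) (p : {linear P -> K}),
      [/\ short_exact i p, eflat P & flat_dim_lt n K1]
  end.

(** A left resolution of length below n by flat pure-injective modules; all
    its syzygies are cotorsion. *)
Fixpoint cotorsion_resolved (n : nat) H : Prop :=
  match n with
  | 0 => is_zero_module H
  | n.+1 => exists (H2 J : lmodType R) (k : {linear H2 -> J}) (e : {linear J -> H}),
      [/\ short_exact k e, eflat J, pure_injective J & cotorsion_resolved n H2]
  end.

Lemma resolved_cotorsion n H : cotorsion_resolved n H -> cotorsion H.
Proof.
elim: n H => [|n IHn] H /=; first exact: cotorsion_zero.
case=> [H2 [J [k [e [ke _ pJ /IHn cH2]]]]].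
exact: cotorsion_quot ke pJ cH2.
Qed.

(** The pushout Q of P and H under K1 is an extension of K by H and also of
    D by P; the second makes it flat. If H is cotorsion, Q is a special
    flat precover of K. *)
Lemma pushout_precover K1 P K H D (i : {linear K1 -> P}) (p : {linear P -> K})
    (u : {linear K1 -> H}) (v : {linear H -> D}) :
  short_exact i p -> short_exact u v -> eflat P -> eflat D ->
  exists (Q : lmodType R) (h : {linear H -> Q}) (q : {linear Q -> K}),
    short_exact h q /\ eflat Q.
Proof.
move=> [ii ip ps] [ui uv vs] fP fD.
have [|d dE] := @ex_linear R K1 (P * H)%type (fun x => (i x, - u x)).
  by move=> a x y; rewrite (linearP i) (linearP u) opprD -scalerN.
have [Q [c [cs cE]]] := ex_cokernel d.
have [fst' fE] := @ex_linear R (P * H)%type P fst (fun _ _ _ => erefl).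
have [snd' sE] := @ex_linear R (P * H)%type H snd (fun _ _ _ => erefl).
have [x /cE[y <-]|q qE] := factor_surj (f := p \o fst') cs.
  by rewrite /= fE dE /=; apply/ip; exists y.
have [x /cE[y <-]|r rE] := factor_surj (f := v \o snd') cs.
  by rewrite /= sE dE /= linearN (uv (u y)).2 ?oppr0//; exists y.
have [|h hE] := @ex_linear R H Q (fun x => c (0, x)).
  move=> a x y; rewrite -linearP; congr (c _); congr pair.
  by rewrite /= scaler0 addr0.
have [|g gE] := @ex_linear R P Q (fun x => c (x, 0)).
  move=> a x y; rewrite -linearP; congr (c _); congr pair.
  by rewrite /= scaler0 addr0.
have hq : short_exact h q.
  split.
  - apply: linear_inj0 => x; rewrite hE => /cE[y]; rewrite dE => -[iy <-].
    by rewrite (inj_eq0 ii iy) linear0 oppr0.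
  - move=> x; have [[a b] <-] := cs x; rewrite qE /= fE /=; split.
      move=> /ip[y <-]; exists (b + u y); rewrite hE.
      apply/eqP; rewrite -subr_eq0 -linearB; apply/eqP/cE.
      exists (- y); rewrite dE; congr pair; rewrite /=.
        by rewrite linearN sub0r.
      by rewrite (linearN u) opprK addrAC subrr add0r.
    by case=> y /(congr1 q); rewrite hE !qE /= !fE /= linear0 => <-.
  - by move=> x; have [a <-] := ps x; exists (c (a, 0)); rewrite qE /= fE.
have gr : short_exact g r.
  split.
  - apply: linear_inj0 => x; rewrite gE => /cE[y]; rewrite dE => -[<-] /eqP.
    by rewrite oppr_eq0 => /eqP/(inj_eq0 ui)->; rewrite linear0.
  - move=> x; have [[a b] <-] := cs x; rewrite rE /= sE /=; split.
      move=> /uv[y <-]; exists (a + i y); rewrite gE.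
      apply/eqP; rewrite -subr_eq0 -linearB; apply/eqP/cE.
      exists y; rewrite dE; congr pair; rewrite /=.
        by rewrite addrAC subrr add0r.
      by rewrite sub0r.
    by case=> y /(congr1 r); rewrite gE !rE /= !sE /= linear0 => <-.
  - by move=> x; have [a <-] := vs x; exists (c (0, a)); rewrite rE /= sE.
exists Q, h, q; split=> //.
exact: eflat_ext gr fP fD.
Qed.

(** Embed the syzygy K1 by induction and form the pushout Q, a flat module
    over K with cotorsion kernel H1. Its double dual J is flat and pure-
    injective, and contains Q as a pure submodule; then H = J/H1 contains K
    = Q/H1 with flat quotient J/Q. *)
Lemma cotorsion_embedding n K : flat_dim_lt n K ->
  exists (H D : lmodType R) (i : {linear K -> H}) (p : {linear H -> D}),
    [/\ short_exact i p, eflat D & cotorsion_resolved n H].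
Proof.
elim: n K => [|n IHn] K /=.
  move=> K0; exists K, K, idfun, \0; split=> //; last exact: eflat_zero.
  split=> // [x|x]; first by split=> // _; exists x.
  by exists 0; rewrite linear0.
case=> [K1 [P [i [p [ip fP /IHn[H1 [D1 [u [v [uv fD1 cH1]]]]]]]]]].
have [Q [h [q [[hi hq qs] fQ]]]] := pushout_precover ip uv fP fD1.
have [ev evE] := ex_double_dual Q.
have pev := double_dual_pure evE.
have evi := epure_inj pev.
have fJ := double_dual_flat hR fQ.
have [D [pD [pDs pDE]]] := ex_cokernel ev.
have [H [e [es eE]]] := ex_cokernel (ev \o h).
have evD : short_exact ev pD by [].
have [x /hq[y <-]|j jE] := factor_surj (f := e \o ev) qs.
  by apply/eE; exists y.
have [x /eE[y <-]|r rE] := factor_surj (f := pD) es.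
  by apply/pDE; exists (h y).
exists H, D, j, r; split.
- split.
  + apply: linear_inj0 => x; have [y <-] := qs x; rewrite jE /= => /eE[z /evi <-].
    by apply/hq; exists z.
  + move=> x; have [y <-] := es x; rewrite rE; split.
      by move=> /pDE[z <-]; exists (q z); rewrite jE.
    case=> z; have [w <-] := qs z; rewrite jE /= => ew.
    by rewrite -rE -ew rE; apply/pDE; exists w.
  + by move=> x; have [y <-] := pDs x; exists (e y); rewrite rE.
- exact: eflat_pure_quot evD pev fJ.
- exists H1, (dual (dual Q)), (ev \o h), e; split=> //; last exact: dual_pure_injective.
  by split=> //; apply: inj_comp.
Qed.

Definition flat_proper_lt n M := exists X : augmented M,
  [/\ forall i, eflat (X i), forall P, eflat P -> hom_exact P X &
      forall i, (n <= i)%N -> is_zero_module (X i)].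

Lemma flat_proper_zero M : is_zero_module M -> flat_proper_lt 0 M.
Proof.
move=> M0.
have dd (i : nat) (x : M) : (\0 : {linear M -> M}) ((\0 : {linear M -> M}) x) = 0 by [].
pose X := @Augmented R M (@ChainComplex R (fun _ => M) (fun _ => \0) dd) idfun (fun _ => erefl).
exists X; split=> //=; first by move=> _; apply: eflat_zero.
move=> P _; split=> [f|f _|i f _]; exists \0 => y; first by rewrite linear0 [RHS]M0.
- by rewrite linear0 [RHS]M0.
- by rewrite linear0 [RHS]M0.
Qed.

(** Lifting into B is the cotorsion property of H; everything below takes
    place in the resolution of H. *)
Lemma flat_proper_splice n M B H (j : {linear H -> B}) (q : {linear B -> M}) :
  short_exact j q -> cotorsion H -> eflat B -> flat_proper_lt n H ->
  flat_proper_lt n.+1 M.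
Proof.
move=> jq cH fB [X [fX Xe X0]]; have [ji ex qs] := jq.
pose E i : lmodType R := if i is k.+1 then X k else B.
pose d i : {linear E i.+1 -> E i} :=
  match i return {linear E i.+1 -> E i} with
  | 0 => (j \o augm X : {linear X 0%N -> B})
  | k.+1 => cdiff X k end.
have dd i x : d i (d i.+1 x) = 0.
  by case: i x => [|i] x /=; [rewrite augm_eq0 linear0|rewrite cdiff_eq0].
have qd x : q (d 0%N x) = 0 by apply/ex; exists (augm X x).
exists (@Augmented R M (@ChainComplex R E d dd) q qd); split=> /=.
- by case.
- move=> P fP; have [aX d0 dS] := Xe P fP; split=> /=.
  + by move=> f; apply: cH jq fP.
  + move=> f f0; have [y|f' f'E] := factor_inj (f := f) ji; first exact/ex.
    by have [g gE] := aX f'; exists g => y /=; rewrite gE f'E.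
  + case=> [|i] f f0 /=; last exact: dS.
    by apply: d0 => y; apply: ji; rewrite linear0; apply: f0.
- by case.
Qed.

Lemma resolved_proper n H : cotorsion_resolved n H -> flat_proper_lt n H.
Proof.
elim: n H => [|n IHn] H /=; first exact: flat_proper_zero.
case=> [H2 [J [k [e [ke fJ _ cH2]]]]].
exact: flat_proper_splice ke (resolved_cotorsion cH2) fJ (IHn _ cH2).
Qed.

(** A flat or projective resolution of finite length need not be proper for
    flat modules. The special precovers obtained from the cotorsion
    embedding of the first syzygy yield one of the same length that is. *)
Lemma flat_dim_proper n M : flat_dim_lt n M -> flat_proper_lt n M.
Proof.
case: n => [|n] /=; first exact: flat_proper_zero.
case=> [K1 [P [i [p [ip fP /cotorsion_embedding[H [D [u [v [uv fD cH]]]]]]]]]].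
have [Q [h [q [hq fQ]]]] := pushout_precover ip uv fP fD.
exact: flat_proper_splice hq (resolved_cotorsion cH) fQ (resolved_proper cH).
Qed.

Lemma resolution_flat_dim n M (E : nat -> lmodType R) (d : forall i, {linear E i.+1 -> E i})
    (a : {linear E 0%N -> M}) :
  (forall i, eflat (E i)) -> onto a -> exact_at (d 0%N) a ->
  (forall i, exact_at (d i.+1) (d i)) ->
  (forall i, (n <= i)%N -> is_zero_module (E i)) -> flat_dim_lt n M.
Proof.
elim: n M E d a => [|n IHn] M E d a fE as_ ea ed E0 /=.
  by move=> x; have [y <-] := as_ x; have -> : y = 0 by [apply: E0]; rewrite linear0.
have [K1 [i [ii iE]]] := ex_kernel a.
have ia : short_exact i a by [].
have [x|a' a'E] := factor_inj (f := d 0%N) ii.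
  by apply/iE/ea; exists x.
exists K1, (E 0%N), i, a; split=> //.
apply: (IHn K1 (fun i => E i.+1) (fun i => d i.+1) a') => //.
- move=> x; have /ea[y yE] : a (i x) = 0 by apply/iE; exists x.
  by exists y; apply: ii; rewrite a'E.
- move=> x; rewrite -ed; split=> [ax|dx]; first by rewrite -a'E ax linear0.
  by apply: ii; rewrite a'E dx linear0.
- by move=> k nk; apply: E0.
Qed.

End Cotorsion.

(** * The implications between vanishing and dimension *)

Section Bounds.
Variables (R : comPzRingType) (hR : noetherian R).
Variables (C : lmodType R) (hC : semidualizing C).
Implicit Types M N : lmodType R.

(** The resolution G may depend on the coefficient module N. One G is
    fixed; the vanishing for the module presented by each system is moved
    from its own resolution to this G through a comparison map. Then all
    boundaries in degree n of Hom(C, G) are pure, and Hom(C, G) can be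
    truncated at n. *)
Lemma tor_bound M n : (forall N, Tor_vanishes C n.+1 M N) ->
  exists X : augmented M, proper_resolution (FC C) X /\
    forall i, (n < i)%N -> is_zero_module (X i).
Proof.
rewrite FC_twist => Tv.
have [A [L [c [rho pr]]]] := semidualizing_presented hR hC.
have homG (G : augmented M) := @hom_proper R hR C hC (@eflat R) (fun P h => h)
  (@bijective_eflat R) (@eflat_ring R) M G.
have [G [+ _]] := Tv C; rewrite FC_twist => /homG[Qf Qe Qr].
set Q := hom_augmented C G in Qf Qe Qr.
have T (L' K : finType) (rel : L' -> K -> R) : tor_trivial Q n rel.
  have [N [e pe]] := ex_presented_module (hom_system rho rel).
  have [G' [+ T0]] := Tv N; rewrite FC_twist => /homG[Qf' Qe' Qr'].
  have := hom_tor_trivial pr Qr' (Tor_trivial pe T0).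
  by apply: tor_trivial_compare => //; apply: ex_chain_map => i; apply: Qe'.
have [X [KX Xe X0]] := truncate (@bijective_eflat R) (@eflat_zero R) Qf Qr Qe
  (fun W => @tor_trivial_flat_quot R _ Q n (Qf n) T W).
have [G' [Gp G0]] := tensor_proper hR hC (fun P h => h) KX Xe.
by exists G'; split=> // i ni; apply/G0/X0.
Qed.

(** Hom(C, X) is a projective resolution of Hom(C, M) of length n; it is
    replaced by a proper flat resolution of the same length and tensored
    back. *)
Lemma projective_bound M n :
  (exists X : augmented M, proper_resolution (PC C) X /\
    forall i, (n < i)%N -> is_zero_module (X i)) ->
  exists X : augmented M, proper_resolution (FC C) X /\
    forall i, (n < i)%N -> is_zero_module (X i).
Proof.
move=> [X [Xp X0]].
have [Qp Qe [aQ a0 aS]] := hom_proper hR hC (@projective_eflat R) (@bijective_projective R)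
  (@projective_ring R) Xp.
set Q := hom_augmented C X in Qp Qe aQ a0 aS.
have fd : flat_dim_lt n.+1 (homm C M).
  apply: (@resolution_flat_dim R _ _ Q (cdiff Q) (augm Q)) => // [i|x|i x|i ni].
  - exact: projective_eflat.
  - by split=> [/a0//|[y <-]]; apply: augm_eq0.
  - by split=> [/aS//|[y <-]]; apply: cdiff_eq0.
  - by move=> f; apply: hommP => x; apply: X0.
have [Y [fY Ye Y0]] := flat_dim_proper hR fd.
rewrite FC_twist.
have [G [Gp G0]] := tensor_proper hR hC (fun P h => h) fY Ye.
by exists G; split=> // i ni; apply/G0/Y0.
Qed.

Lemma bounded_tor M n :
  (exists X : augmented M, proper_resolution (FC C) X /\
    forall i, (n < i)%N -> is_zero_module (X i)) ->
  forall i, (n < i)%N -> forall N, Tor_vanishes C i M N.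
Proof.
move=> [X [Xp X0]] [//|i] ni N; exists X; split=> //.
exact/Tor_zero/X0.
Qed.

End Bounds.

Theorem theorem3 (R : comPzRingType) (hR : noetherian R)
    (C : lmodType R) (hC : semidualizing C) (M : lmodType R) (n : nat) :
  [<-> (forall i, (n < i)%N -> forall N : lmodType R, Tor_vanishes C i M N);
       (forall N : lmodType R, Tor_vanishes C n.+1 M N);
       (relative_pd (FC C) M <= (n%:Z)%:E)%E]
  /\
  (finitely_generated M ->
   [<-> (forall i, (n < i)%N -> forall N : lmodType R, Tor_vanishes C i M N);
        (forall N : lmodType R, Tor_vanishes C n.+1 M N);
        (relative_pd (FC C) M <= (n%:Z)%:E)%E;
        (forall i, (n < i)%N -> forall m : ideal R, maximal_ideal m ->
           Tor_vanishes C i M (quotm m));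
        (forall m : ideal R, maximal_ideal m ->
           Tor_vanishes C n.+1 M (quotm m));
        (relative_pd (PC C) M <= (n%:Z)%:E)%E]).
Proof.
have ii_iii : (forall N, Tor_vanishes C n.+1 M N) -> (relative_pd (FC C) M <= (n%:Z)%:E)%E.
  by move=> /(tor_bound hR hC)/relative_pd_le.
split=> [|fgM]; tfae=> //.
- by move=> Tv N; apply: Tv.
- by move=> /relative_pd_le; apply: bounded_tor.
- by move=> Tv N; apply: Tv.
- by move=> /relative_pd_le pd i ni m _; apply: (bounded_tor pd).
- by move=> Tv m; apply: Tv.
- by move=> Tv; apply/relative_pd_le/(residue_tor_bound hR hC).
- by move=> /relative_pd_le/(projective_bound hR hC)/bounded_tor.
Qed.
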